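(* Let $\mathcal A$ be a van Hove sequence in $G$ and let $\mu,\nu\in\mathcal{M}^{\infty}(G)$ be Besicovitch almost periodic measures with respect to $\mathcal A$. Then: (a) the twisted Eberlein convolution $[\mu,\nu]_{\mathcal A}$ exists; (b) $[\mu,\nu]_{\mathcal A}$ is a strongly almost periodic measure; (c) $a_\chi^{\mathcal A}([\mu,\nu]_{\mathcal A})=a_\chi^{\mathcal A}(\mu)\,\overline{a_\chi^{\mathcal A}(\nu)}$ for all $\chi\in\widehat G$.
   Context: $G$ is a second countable, locally compact (Hausdorff) Abelian group with Haar measure $|\cdot|$ and dual group $\widehat G$. A van Hove sequence is a sequence $\mathcal A=(A_n)_{n\in\mathbb N}$ of precompact open subsets of $G$ (of positive measure) such that $\lim_{n}|\partial^K A_n|/|A_n|=0$ for each compact $K\subseteq G$, where for open $A$, $\partial^K A:=(\overline{A+K}\setminus A)\cup(((G\setminus A)-K)\cap\overline A)$. A measure on $G$ is a complex Radon measure, viewed as a linear functional on $C_c(G)$; $|\mu|$ denotes its variation measure. $\mathcal M^\infty(G)$ is the set of translation bounded measures, i.e. those with $\sup_{t\in G}|\mu|(t+K)<\infty$ for every compact $K$. For $\varphi\in C_c(G)$, $(\mu*\varphi)(t)=\int_G\varphi(t-s)\,d\mu(s)$. For $g$ on $G$ put $\widetilde g(x)=\overline{g(-x)}$, and for a measure $\widetilde\mu(g)=\overline{\mu(\widetilde g)}$. The Eberlein convolution is $\mu\circledast_{\mathcal A}\nu:=\lim_{n\to\infty}\frac1{|A_n|}(\mu|_{A_n})*(\nu|_{-A_n})$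 if this limit exists in the vague topology, and the twisted Eberlein convolution is $[\mu,\nu]_{\mathcal A}:=\mu\circledast_{\mathcal A}\widetilde\nu$ if it exists. With $(\tau_tf)(x)=f(x-t)$, a bounded uniformly continuous $f$ is strongly almost periodic if the closure of $\{\tau_tf:t\in G\}$ in $(C_u(G),\|\cdot\|_\infty)$ is compact ($C_u(G)$: bounded uniformly continuous functions); a measure $\mu$ is strongly almost periodic if $\mu*\varphi$ is a strongly almost periodic function for all $\varphi\in C_c(G)$. For $f\in L^2_{\mathrm{loc}}(G)$ let $\|f\|_{b,2,\mathcal A}:=(\limsup_{n}\frac1{|A_n|}\int_{A_n}|f|^2\,dt)^{1/2}$ and $BL^2_{\mathcal A}(G)=\{f:\|f\|_{b,2,\mathcal A}<\infty\}$. $Bap^2_{\mathcal A}(G)$ is the closure in $BL^2_{\mathcal A}(G)$ of the trigonometric polynomials (finite linear combinations of characters) with respect to $\|\cdot\|_{b,2,\mathcal A}$. A measure $\mu$ is Besicovitch almost periodic with respect to $\mathcal A$ if $\mu*\varphi\in Bap^2_{\mathcal A}(G)$ for all $\varphi\in C_c(G)$. The Fourier–Bohr coefficient of a measure $\mu$ at $\chi\in\widehat G$ is $a_\chi^{\mathcal A}(\mu)=\lim_{n\to\infty}\frac1{|A_n|}\int_{A_n}\overline{\chi(s)}\,d\mu(s)$, if the limit exists; it exists for translation bounded Besicovitch almost periodic measures, and the identity (c) includes the existence of the left-hand side. *)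

(* Defs.v *)
From HB Require Import structures.
From mathcomp Require Import all_boot all_order all_algebra complex ring.
From mathcomp Require Import all_classical all_reals all_analysis.
From mathcomp Require Import measurable_realfun.

Set Implicit Arguments.
Unset Strict Implicit.
Unset Printing Implicit Defensive.

Import Order.TTheory GRing.Theory Num.Theory.
Import numFieldNormedType.Exports.

Local Open Scope classical_set_scope.
Local Open Scope ring_scope.
Local Open Scope complex_scope.

(* Measurable types are pointed in the library, topological abelian groups are
   not: the chosen point is the neutral element. *)
Definition pointed_group (G : topologicalZmodType) : Type := G.
HB.instance Definition _ (G : topologicalZmodType) :=
  Choice.on (pointed_group G).
HB.instance Definition _ (G : topologicalZmodType) :=
  isPointed.Build (pointed_group G) (0 : G).

(* [borel G] is the group [G] equipped with its Borel sigma-algebra. *)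
Notation borel G :=
  (@g_sigma_algebraType (pointed_group G) (@open G)).

Section Measures.
Variables (R : realType) (G : topologicalZmodType).

Record is_radon (m : set (borel G) -> \bar R) : Prop := IsRadon {
  radon_compact : forall K : set G, compact K -> (m K < +oo)%E ;
  radon_outer : forall E : set (borel G), measurable E ->
    m E = ereal_inf [set m U | U in [set U : set G | open U /\ E `<=` U]] ;
  radon_inner : forall U : set G, open U ->
    m U = ereal_sup [set m K | K in [set K : set G | compact K /\ K `<=` U]]
}.

Record radon := Radon {
  radon_measure :> {measure set (borel G) -> \bar R} ;
  radonP : is_radon radon_measure
}.

Definition is_haar (m : radon) : Prop :=
  m setT != 0%E /\
  forall (t : G) (E : set (borel G)), measurable E ->
    m [set t + x | x in (E : set G)] = m E.

(* A complex Radon measure is a combination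
   [(m1 - m2) + i (m3 - m4)] of four positive Radon measures. The combination
   is not unique (it need not be the Jordan decomposition), and its value is
   only meaningful on relatively compact Borel sets; as a measure it is the
   linear functional [cm_int _ setT] on C_c(G). *)
Record cmeasure := CMeasure {
  re_pos : radon ; re_neg : radon ; im_pos : radon ; im_neg : radon
}.

Definition cint (m : radon) (D : set G) (f : G -> R[i]) : R[i] :=
  (\int[m]_(x in D) complex.Re (f x)) +i* (\int[m]_(x in D) complex.Im (f x)).

(* integral of [f] over [D] against [mu], i.e. of [f] against [mu|_D] *)
Definition cm_int (mu : cmeasure) (D : set G) (f : G -> R[i]) : R[i] :=
  (cint (re_pos mu) D f - cint (re_neg mu) D f)
  + 'i * (cint (im_pos mu) D f - cint (im_neg mu) D f).

Definition cm_val (mu : cmeasure) (E : set (borel G)) : R[i] :=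
  (fine (re_pos mu E) - fine (re_neg mu E))
  +i* (fine (im_pos mu E) - fine (im_neg mu E)).

(* As [cm_val] is only meaningful on relatively compact sets, the supremum runs
   over finite families of disjoint relatively compact Borel subsets of [E]. *)
Definition cm_variation (mu : cmeasure) (E : set G) : \bar R :=
  ereal_sup [set v | exists (n : nat) (F : 'I_n -> set (borel G)),
    [/\ forall i, measurable (F i),
        forall i, precompact (F i : set G) /\ F i `<=` E,
        trivIset setT F
      & v = (\sum_(i < n) Normc.normc (cm_val mu (F i)))%:E]].

Definition translation_bounded (mu : cmeasure) : Prop :=
  forall K : set G, compact K ->
    (ereal_sup [set cm_variation mu [set (t + x)%R | x in K] | t in [set: G]]
      < +oo)%E.

(* [R[i]^o] carries the norm topology of the complex numbers. *)
Definition ccontinuous (f : G -> R[i]) : Prop := continuous (f : G -> R[i]^o).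

Definition Cc (f : G -> R[i]) : Prop :=
  ccontinuous f /\ compact (closure [set x | f x != 0]).

Definition conv_fun (mu : cmeasure) (phi : G -> R[i]) (t : G) : R[i] :=
  cm_int mu setT (fun s => phi (t - s)).

(* the functional [(mu|_D) * (nu|_E)] *)
Definition conv_restr (mu : cmeasure) (D : set G) (nu : cmeasure) (E : set G)
    (phi : G -> R[i]) : R[i] :=
  cm_int mu D (fun x => cm_int nu E (fun y => phi (x + y))).

End Measures.

Section Reflection.
Variables (R : realType) (G : topologicalZmodType).

Let oppG (x : borel G) : borel G := - (x : G).

Let oppG_img (E : set G) : [set - x | x in E] = oppG @^-1` E.
Proof.
apply/seteqP; split=> x /=.
  by case=> y Ey <-; rewrite /oppG opprK.
by move=> Ex; exists (- x) => //; rewrite opprK.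
Qed.

Let open_oppG (U : set G) : open U -> open (oppG @^-1` U : set G).
Proof. by apply: open_comp => x _; exact: (@opp_continuous G x). Qed.

Let compact_oppG (K : set G) : compact K -> compact (oppG @^-1` K : set G).
Proof.
move=> cK; rewrite -oppG_img; apply: continuous_compact => //.
by apply: continuous_subspaceT => x; exact: (@opp_continuous G x).
Qed.

Let measurable_oppG : measurable_fun setT oppG.
Proof.
apply: (measurability (@open G : set (set (borel G)))) => // _ [U oU <-].
rewrite setTI.
by apply: sub_sigma_algebra; exact: open_oppG.
Qed.

Let measurable_oppG_img (E : set (borel G)) :
  measurable E -> measurable (oppG @^-1` E).
Proof.
by move=> mE; rewrite -[X in measurable X]setTI; exact: measurable_oppG.
Qed.

Let oppGK (E : set G) : oppG @^-1` (oppG @^-1` E) = E.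
Proof. by apply/seteqP; split=> x; rewrite /preimage /= /oppG opprK. Qed.

Let oppG_sub (E F : set G) : oppG @^-1` E `<=` oppG @^-1` F <-> E `<=` F.
Proof.
by split=> EF x; [move: (EF (- x)); rewrite /preimage /= /oppG opprK|apply: EF].
Qed.

Section Measure.
Variable m : radon R G.

Definition refl_set (E : set (borel G)) : \bar R :=
  m [set - x | x in (E : set G)].

Let refl_setE E : refl_set E = m (oppG @^-1` E).
Proof. by rewrite /refl_set oppG_img. Qed.

Let refl_set0 : refl_set set0 = 0%E.
Proof. by rewrite refl_setE preimage_set0 measure0. Qed.

Let refl_set_ge0 E : (0 <= refl_set E)%E.
Proof. exact: measure_ge0. Qed.

Let refl_set_sigma_additive : semi_sigma_additive refl_set.
Proof.
move=> F mF tF mUF; rewrite (_ : (fun _ => _) =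
    (fun n => \sum_(0 <= i < n) m (oppG @^-1` F i))%E); last first.
  by apply/funext => n; apply: eq_bigr => i _; rewrite refl_setE.
rewrite refl_setE preimage_bigcup; apply: measure_semi_sigma_additive.
- by move=> n; exact: measurable_oppG_img.
- apply/trivIsetP => /= i j _ _ ij; rewrite -preimage_setI.
  by move/trivIsetP : tF => /(_ _ _ _ _ ij) ->//; rewrite preimage_set0.
- by rewrite -preimage_bigcup; exact: measurable_oppG_img.
Qed.

HB.instance Definition _ := isMeasure.Build _ _ _ refl_set
  refl_set0 refl_set_ge0 refl_set_sigma_additive.

Lemma refl_radon : is_radon refl_set.
Proof.
split.
- move=> K cK; rewrite refl_setE; apply: (radon_compact (radonP m)).
  exact: compact_oppG.
- move=> E mE; rewrite refl_setE (radon_outer (radonP m)); last first.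
    exact: measurable_oppG_img.
  congr ereal_inf; apply/seteqP; split=> _ /= [U [oU EU] <-].
    exists (oppG @^-1` U); last by rewrite refl_setE oppGK.
    by split; [exact: open_oppG|rewrite -oppG_sub oppGK].
  exists (oppG @^-1` U); last by rewrite refl_setE.
  by split; [exact: open_oppG|apply/oppG_sub].
- move=> U oU; rewrite refl_setE (radon_inner (radonP m)); last first.
    exact: open_oppG.
  congr ereal_sup; apply/seteqP; split=> _ /= [K [cK KU] <-].
    exists (oppG @^-1` K); last by rewrite refl_setE oppGK.
    by split; [exact: compact_oppG|rewrite -oppG_sub oppGK].
  exists (oppG @^-1` K); last by rewrite refl_setE.
  by split; [exact: compact_oppG|apply/oppG_sub].
Qed.

Definition reflect_radon : radon R G := Radon refl_radon.

Lemma Rintegral_refl (f : borel G -> R) : measurable_fun setT f ->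
  \int[reflect_radon]_x f x = \int[m]_x f (- (x : G)).
Proof.
move=> mf; rewrite /Rintegral [in LHS]integralE [in RHS]integralE.
have reflE (g : borel G -> \bar R) : (forall x, 0 <= g x)%E ->
    measurable_fun setT g ->
    (\int[reflect_radon]_x g x = \int[m]_x g (- (x : G))%R)%E.
  move=> g0 mg.
  have := ge0_integral_pushforward measurable_oppG m (D := setT) measurableT.
  move=> /(_ g mg (fun x _ => g0 x)); rewrite preimage_setT => <-.
  by apply: eq_measure_integral => A mA _; rewrite /= refl_setE.
have mEf : measurable_fun setT (EFin \o f) by exact/measurable_EFinP.
rewrite !reflE //; [|exact: measurable_funeneg|exact: measurable_funepos].
congr (fine (_ - _)); apply: eq_integral => x _.
  by rewrite !funeposE.
by rewrite !funenegE.
Qed.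

End Measure.
End Reflection.

Section Tilde.
Variables (R : realType) (G : topologicalZmodType).
Implicit Types (mu : cmeasure R G) (g : G -> R[i]).

Definition tilde_fun g : G -> R[i] := fun x => (g (- x))^*.

(* Conjugation exchanges the two imaginary parts; [tildeE] below is the
   defining identity. *)
Definition tilde mu : cmeasure R G :=
  CMeasure (reflect_radon (re_pos mu)) (reflect_radon (re_neg mu))
           (reflect_radon (im_neg mu)) (reflect_radon (im_pos mu)).

Let RintegralN_total (m : radon R G) (f : G -> R) :
  \int[m]_x (- f x) = - \int[m]_x f x.
Proof.
rewrite /Rintegral [in LHS]integralE [in RHS]integralE.
rewrite (_ : (fun x : borel G => (- f x)%:E)^\+%E = (EFin \o f)^\-%E);
  last first.
  by apply/funext => x; rewrite funeposE funenegE.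
rewrite (_ : (fun x : borel G => (- f x)%:E)^\-%E = (EFin \o f)^\+%E);
  last first.
  by apply/funext => x; rewrite funeposE funenegE /= opprK.
have : (0 <= \int[m]_x (EFin \o f)^\+ x)%E by exact: integral_ge0.
have : (0 <= \int[m]_x (EFin \o f)^\- x)%E by exact: integral_ge0.
case: (integral _ _ _) => [a| |] // _; case: (integral _ _ _) => [b| |] // _ /=;
  by rewrite ?oppr0 ?opprB.
Qed.

Let continuous_Re : continuous (@complex.Re R : R[i]^o -> R).
Proof.
move=> z; apply/(@cvgrPdist_lt _ R^o _ _ (@nbhs_filter R[i]^o z)) => e e0.
have e0C : 0 < e%:C by rewrite ltcR.
have : nbhs (z : R[i]^o) (ball (z : R[i]^o) e%:C) by exact: nbhsx_ballx.
move=> zb; apply: (@filterS _ _ (@nbhs_filter R[i]^o z) _ _ _ zb) => w.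
rewrite -ball_normE /ball_ /= normc_def ltcR => /le_lt_trans; apply.
rewrite -sqrtr_sqr ler_wsqrtr //=.
by case: z {zb} => a b; case: w => c d /=; rewrite lerDl sqr_ge0.
Qed.

Let continuous_Im : continuous (@complex.Im R : R[i]^o -> R).
Proof.
move=> z; apply/(@cvgrPdist_lt _ R^o _ _ (@nbhs_filter R[i]^o z)) => e e0.
have e0C : 0 < e%:C by rewrite ltcR.
have : nbhs (z : R[i]^o) (ball (z : R[i]^o) e%:C) by exact: nbhsx_ballx.
move=> zb; apply: (@filterS _ _ (@nbhs_filter R[i]^o z) _ _ _ zb) => w.
rewrite -ball_normE /ball_ /= normc_def ltcR => /le_lt_trans; apply.
rewrite -sqrtr_sqr ler_wsqrtr //=.
by case: z {zb} => a b; case: w => c d /=; rewrite lerDr sqr_ge0.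
Qed.

Let measurable_continuous (f : G -> R) :
  continuous f -> measurable_fun setT (f : borel G -> R).
Proof.
move=> cf; apply: (measurability _ (RGenOpens.measurableE R)).
move=> _ [_ [a [b ->] <-]]; rewrite setTI; apply: sub_sigma_algebra.
by apply: open_comp => [x _|]; [exact: cf|exact: interval_open].
Qed.

Lemma cint_refl (m : radon R G) g : ccontinuous g ->
  cint (reflect_radon m) setT g = cint m setT (fun x => g (- x)).
Proof.
move=> cg; rewrite /cint.
have mRe : measurable_fun setT (fun x : borel G => complex.Re (g x)).
  apply: measurable_continuous => x.
  by apply: (@continuous_comp G R[i]^o R g (@complex.Re R));
    [exact: cg|exact: continuous_Re].
have mIm : measurable_fun setT (fun x : borel G => complex.Im (g x)).
  apply: measurable_continuous => x.
  by apply: (@continuous_comp G R[i]^o R g (@complex.Im R));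
    [exact: cg|exact: continuous_Im].
by rewrite (Rintegral_refl _ mRe) (Rintegral_refl _ mIm).
Qed.

Lemma tildeE mu g : Cc g ->
  cm_int (tilde mu) setT g = (cm_int mu setT (tilde_fun g))^*.
Proof.
move=> [cg _].
have conjE (m : radon R G) :
    cint m setT (tilde_fun g) = (cint m setT (fun x => g (- x)))^*.
  rewrite /cint /tilde_fun /=; congr (_ +i* _).
    by congr (Rintegral _ _ _); apply/funext => x; case: (g (- x)).
  rewrite -RintegralN_total; congr (Rintegral _ _ _).
  by apply/funext => x; case: (g (- x)).
rewrite /cm_int !cint_refl // !conjE.
by do ! case: (cint _ _ _) => ? ?; simpc; congr (_ +i* _); ring.
Qed.

End Tilde.

Section AlmostPeriodicity.
Variables (R : realType) (G : topologicalZmodType) (haar : radon R G).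
Implicit Types (A : nat -> set G) (f phi chi : G -> R[i]).
Implicit Types (mu nu : cmeasure R G).

(* The group uniformity: topological abelian groups carry no uniform structure
   in the library. *)
Definition bounded_ucontinuous f : Prop :=
  (exists M : R, forall x, Normc.normc (f x) <= M) /\
  forall e : R, 0 < e ->
    exists2 U : set G, nbhs 0 U &
      forall x y, U (x - y) -> Normc.normc (f x - f y) < e.

Definition translate (t : G) f : G -> R[i] := fun x => f (x - t).

(* [{uniform G -> R[i]^o}] is the topology of uniform convergence, which on
   bounded functions is that of the supremum norm; intersecting with
   [bounded_ucontinuous] gives the closure inside the subspace C_u(G). *)
Definition sap_fun f : Prop :=
  bounded_ucontinuous f /\
  compact (closure ([set translate t f | t in [set: G]]
                     : set {uniform G -> R[i]^o})
           `&` [set h | bounded_ucontinuous h]).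

Definition sap_measure mu : Prop :=
  forall phi, Cc phi -> sap_fun (conv_fun mu phi).

(* van Hove boundary of an open set *)
Definition vh_boundary (K A : set G) : set G :=
  (closure [set a + k | a in A & k in K] `\` A) `|`
  ([set b - k | b in ~` A & k in K] `&` closure A).

Definition vol (E : set G) : R := fine (haar E).

Definition van_hove A : Prop :=
  [/\ forall n, open (A n) /\ precompact (A n),
      forall n, (0 < haar (A n))%E &
      forall K : set G, compact K ->
        (haar (vh_boundary K (A n)) * ((vol (A n))^-1)%R%:E)%E
          @[n --> \oo] --> 0%E].

Definition L2loc f : Prop :=
  [/\ measurable_fun setT (fun x : borel G => complex.Re (f x)),
      measurable_fun setT (fun x : borel G => complex.Im (f x)) &
      forall K : set G, compact K ->
        (\int[haar]_(x in K) ((Normc.normc (f x)) ^+ 2)%:E < +oo)%E].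

Definition bnorm2 A f : \bar R :=
  poweR (limn_esup (fun n =>
    (((vol (A n))^-1)%R%:E *
     \int[haar]_(x in A n) ((Normc.normc (f x)) ^+ 2)%:E)%E)) 2^-1.

Definition BL2 A f : Prop := L2loc f /\ (bnorm2 A f < +oo)%E.

Definition character chi : Prop :=
  [/\ ccontinuous chi, forall x, Normc.normc (chi x) = 1 &
      forall x y, chi (x + y) = chi x * chi y].

Definition trig_poly f : Prop :=
  exists (n : nat) (c : 'I_n -> R[i]) (chi : 'I_n -> G -> R[i]),
    (forall i, character (chi i)) /\ f = (fun x => \sum_(i < n) c i * chi i x).

Definition Bap2 A f : Prop :=
  BL2 A f /\
  forall e : R, 0 < e ->
    exists2 p, trig_poly p & (bnorm2 A (fun x => (f x - p x)%R) < e%:E)%E.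

Definition besicovitch_ap A mu : Prop :=
  forall phi, Cc phi -> Bap2 A (conv_fun mu phi).

(* [eta] is the vague limit of [|A_n|^-1 (mu|_{A_n}) * (nu|_{-A_n})] *)
Definition is_eberlein A mu nu eta : Prop :=
  forall phi, Cc phi ->
    ((fun n => ((vol (A n))^-1)%:C *
       conv_restr mu (A n) nu [set - x | x in A n] phi) : nat -> R[i]^o)
      @ \oo --> (cm_int eta setT phi : R[i]^o).

Definition is_twisted_eberlein A mu nu eta : Prop :=
  is_eberlein A mu (tilde nu) eta.

Definition fb_mean A mu chi : nat -> R[i]^o := fun n =>
  ((vol (A n))^-1)%:C * cm_int mu (A n) (fun s => (chi s)^*).

Definition fb_exists A mu chi : Prop := cvg (fb_mean A mu chi @ \oo).

(* only meaningful under [fb_exists] *)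
Definition fb_coeff A mu chi : R[i] := lim (fb_mean A mu chi @ \oo).

End AlmostPeriodicity.

(* Main.v *)
Require Import Defs.
From HB Require Import structures.
From mathcomp Require Import all_boot all_order all_algebra complex ring lra.
From mathcomp Require Import all_classical all_reals all_analysis.
From mathcomp Require Import measurable_realfun.
Set Implicit Arguments.
Unset Strict Implicit.
Unset Printing Implicit Defensive.
Import Order.TTheory GRing.Theory Num.Theory.
Import numFieldNormedType.Exports.
Local Open Scope classical_set_scope.
Local Open Scope ring_scope.
Local Open Scope complex_scope.

(* Smear mu and nu by f, g in C_c(G). The smeared functions lie in Bap^2, hence
   are approximated in mean by trigonometric polynomials, so the means
   c(t) = M(mu*f . conj(tau_t (nu*g))) exist and c is a uniform limit of
   trigonometric polynomials. The van Hove property allows to exchange smearing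
   and restriction to A_n: c(t) is the limit of |A_n|^-1 (mu|A_n) * (nu~|-A_n)
   on the translate by t of the correlation of f and g. Correlations, with f
   running through normalized bumps at 0, are uniformly dense in C_c(G) with
   control of the supports, and the averaged convolutions are eventually bounded
   functionals on the functions with support in a translate of a compact set.
   Hence the averages converge on C_c(G); the limit functional is bounded there
   and is a measure by the Riesz theorem, which gives (a). Smearing this measure
   produces uniform limits of the functions c, which gives (b). For (c) take
   f = g = chi b with b a symmetric bump and compare the Fourier coefficients of
   mu*f, nu*f and c. *)

(** * Complex numbers, continuity and compactness *)

(** Cutting a measure off at the boundary of [A n] does not commute with smearing it: mass near the
    boundary spills over. Every exchange is paid for on the van Hove boundary for a compact [K]
    containing the supports and shifts involved, and costs a constant times its relative size. This
    constant must not depend on [n], so it has to come from translation boundedness. The four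
    positive components of a measure may cancel each other and need not be translation bounded;
    therefore translation boundedness is turned into a bound for the functional on functions
    supported in a translate of a compact set, a bound that survives restriction to open sets and
    vague limits of the averages. Masses of the components only multiply errors that are arbitrarily
    small. Integrands are continuous and domains, up to supports, are relatively compact Borel sets,
    so integrability is automatic and Fubini becomes a subdivision argument. For (b) the estimates
    have to be uniform in [t]: the approximating polynomials are chosen before [t], and the bounds
    hold for all translates of a support at once. *)

Notation cj := conjc.

Section ComplexNorm.
Variable R : realType.
Implicit Types z w : R[i].
Local Notation nc := (@Normc.normc R).

Lemma nc_ge0 z : 0 <= nc z.
Proof. by case: z => a b; exact: sqrtr_ge0. Qed.

Lemma nc_norm z : `|z| = (nc z)%:C.
Proof. by []. Qed.

Lemma ncB z w : nc (z - w) <= nc z + nc w.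
Proof. by rewrite -(normcN w); exact: le_normcD. Qed.

Lemma ncBC z w : nc (z - w) = nc (w - z).
Proof. by rewrite -normcN opprB. Qed.

Lemma ncJ z : nc (cj z) = nc z.
Proof. by case: z => a b /=; rewrite sqrrN. Qed.

Lemma nc_Re z : `|complex.Re z| <= nc z.
Proof.
case: z => a b /=; rewrite -sqrtr_sqr ler_wsqrtr //=.
by rewrite lerDl sqr_ge0.
Qed.

Lemma nc_Im z : `|complex.Im z| <= nc z.
Proof.
case: z => a b /=; rewrite -sqrtr_sqr ler_wsqrtr //=.
by rewrite lerDr sqr_ge0.
Qed.

Lemma nc_ReIm z : nc z <= `|complex.Re z| + `|complex.Im z|.
Proof.
case: z => a b /=.
rewrite -(@ler_sqr _ _ _) ?nnegrE ?sqrtr_ge0 ?addr_ge0 ?normr_ge0//.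
rewrite sqr_sqrtr ?addr_ge0 ?sqr_ge0// sqrrD !real_normK ?num_real//.
by rewrite lerD2r lerDl mulrn_wge0// mulr_ge0.
Qed.

Lemma ncR (x : R) : nc x%:C = `|x|.
Proof. by rewrite /= expr0n /= addr0 sqrtr_sqr. Qed.

Lemma nc_eq0 z : nc z <= 0 -> z = 0.
Proof.
by move=> z0; apply: Normc.eq0_normc; apply/eqP; rewrite eq_le z0 nc_ge0.
Qed.

Lemma nc_dist_tri (a b c : R[i]) : nc (a - c) <= nc (a - b) + nc (b - c).
Proof. by rewrite -[a - c](subrKA b); exact: le_normcD. Qed.

Lemma nc_sum (I : Type) (r : seq I) (P : pred I) (F : I -> R[i]) :
  nc (\sum_(i <- r | P i) F i) <= \sum_(i <- r | P i) nc (F i).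
Proof.
elim/big_ind2 : _ => [|a b c d ab cd|//]; first by rewrite Normc.normc0.
by apply: le_trans (le_normcD _ _) _; exact: lerD.
Qed.

Lemma nc_le_sub z w : nc z <= nc (z - w) + nc w.
Proof. by have := le_normcD (z - w) w; rewrite subrK. Qed.

Lemma nc_i : nc 'i = 1.
Proof. by rewrite /= expr0n expr1n add0r sqrtr1. Qed.

End ComplexNorm.
Notation nc := (@Normc.normc _).
Arguments Normc.normc : simpl never.

Section ComplexLimits.
Variable R : realType.

Lemma ccvgP (T : Type) (F : set_system T) (FF : Filter F) (f : T -> R[i])
    (l : R[i]) :
  (f x @[x --> F] --> (l : R[i]^o)) <->
  forall e : R, 0 < e -> \forall x \near F, nc (f x - l) < e.
Proof.
rewrite (@cvgrPdist_lt _ R[i]^o); split => h e e0.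
  have := h e%:C; rewrite ltcR => /(_ e0); apply: filterS => x.
  by rewrite nc_norm ltcR ncBC.
have : 0 < complex.Re e by move: e0; rewrite ltcE => /andP[].
move=> /h; apply: filterS => x.
rewrite nc_norm ltcE /= ncBC => ->; rewrite andbT.
by move: e0; rewrite ltcE => /andP[].
Qed.

(* Inductive, so that unification does not unfold filters when it compares
   two continuity statements. *)
Variant cont (T : topologicalType) (f : T -> R[i]) : Prop :=
  Cont of (forall x (e : R), 0 < e -> \forall y \near x, nc (f y - f x) < e).

Variant rcont (T : topologicalType) (f : T -> R) : Prop :=
  RCont of continuous f.

Lemma contE (T : topologicalType) (f : T -> R[i]) : cont f ->
  forall x (e : R), 0 < e -> \forall y \near x, nc (f y - f x) < e.
Proof. by case. Qed.

Lemma contP (T : topologicalType) (f : T -> R[i]) :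
  cont f <-> continuous (f : T -> R[i]^o).
Proof.
split; first by move=> [cf] x; apply/ccvgP; exact: cf.
by move=> h; split => x; apply/ccvgP; exact: h.
Qed.

Lemma ccont_Re (T : topologicalType) (f : T -> R[i]) :
  cont f -> rcont (fun x => complex.Re (f x)).
Proof.
move=> [cf]; split => x; apply/(@cvgrPdist_lt _ R^o) => e e0.
apply: filterS (cf x e e0) => y; apply: le_lt_trans.
rewrite ncBC; apply: le_trans _ (nc_Re _).
by case: (f x) (f y) => a b [c d].
Qed.

Lemma ccont_Im (T : topologicalType) (f : T -> R[i]) :
  cont f -> rcont (fun x => complex.Im (f x)).
Proof.
move=> [cf]; split => x; apply/(@cvgrPdist_lt _ R^o) => e e0.
apply: filterS (cf x e e0) => y; apply: le_lt_trans.
rewrite ncBC; apply: le_trans _ (nc_Im _).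
by case: (f x) (f y) => a b [c d].
Qed.

Lemma ccont_ReIm (T : topologicalType) (f g : T -> R) :
  rcont f -> rcont g -> cont (fun x => f x +i* g x).
Proof.
move=> [cf] [cg]; split => x e e0.
have e20 : 0 < e / 2 by rewrite divr_gt0.
have /(@cvgrPdist_lt _ R^o) /(_ _ e20) h1 := cf x.
have /(@cvgrPdist_lt _ R^o) /(_ _ e20) h2 := cg x.
apply: filterS2 h1 h2 => y h1 h2.
rewrite ncBC; apply: le_lt_trans (nc_ReIm _) _ => /=.
by rewrite [ltRHS]splitr; exact: ltrD.
Qed.

Lemma rcont_cst (T : topologicalType) (c : R) : rcont (fun _ : T => c).
Proof. by split => x; exact: cvg_cst. Qed.

Lemma rcontM (T : topologicalType) (f g : T -> R) :
  rcont f -> rcont g -> rcont (fun x => f x * g x).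
Proof.
by move=> [cf] [cg]; split => x; apply: continuousM; [exact: cf|exact: cg].
Qed.

Lemma rcontD (T : topologicalType) (f g : T -> R) :
  rcont f -> rcont g -> rcont (fun x => f x + g x).
Proof. by move=> [cf] [cg]; split => x; apply: cvgD; [exact: cf|exact: cg]. Qed.

Lemma rcontB (T : topologicalType) (f g : T -> R) :
  rcont f -> rcont g -> rcont (fun x => f x - g x).
Proof. by move=> [cf] [cg]; split => x; apply: cvgB; [exact: cf|exact: cg]. Qed.

Lemma rcont_norm (T : topologicalType) (f : T -> R) :
  rcont f -> rcont (fun x => `|f x|).
Proof.
by move=> [cf]; split => x; apply: (@cvg_norm _ _ _ _ _ f (f x)); exact: cf.
Qed.

Lemma rcont_comp (S T : topologicalType) (g : S -> T) (f : T -> R) :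
  continuous g -> rcont f -> rcont (fun x => f (g x)).
Proof.
by move=> cg [cf]; split => x; apply: (@continuous_comp _ _ _ g f);
  [exact: cg|exact: cf].
Qed.

Lemma ccont_R (T : topologicalType) (f : T -> R) :
  rcont f -> cont (fun x => (f x)%:C).
Proof. by move=> cf; apply: ccont_ReIm cf _; exact: rcont_cst. Qed.

Lemma ccont_conj (T : topologicalType) (f : T -> R[i]) :
  cont f -> cont (fun x => (cj (f x))).
Proof.
move=> [cf]; split => x e e0.
by apply: filterS (cf x e e0) => y; rewrite -rmorphB /= ncJ.
Qed.

Lemma ccont_nc (T : topologicalType) (f : T -> R[i]) :
  cont f -> rcont (fun x => nc (f x)).
Proof.
move=> [cf]; split => x; apply/(@cvgrPdist_lt _ R^o) => e e0.
apply: filterS (cf x e e0) => y; apply: le_lt_trans.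
rewrite ler_norml; apply/andP; split.
  by have := nc_le_sub (f y) (f x); lra.
by have := nc_le_sub (f x) (f y); rewrite ncBC; lra.
Qed.

Lemma ccontD (T : topologicalType) (f g : T -> R[i]) :
  cont f -> cont g -> cont (fun x => f x + g x).
Proof.
move=> /contP cf /contP cg; apply/contP => x.
by apply: cvgD; [exact: cf|exact: cg].
Qed.

Lemma ccontB (T : topologicalType) (f g : T -> R[i]) :
  cont f -> cont g -> cont (fun x => f x - g x).
Proof.
move=> /contP cf /contP cg; apply/contP => x.
by apply: cvgB; [exact: cf|exact: cg].
Qed.

Lemma ccontM (T : topologicalType) (f g : T -> R[i]) :
  cont f -> cont g -> cont (fun x => f x * g x).
Proof.
move=> /contP cf /contP cg; apply/contP => x.
by apply: continuousM; [exact: cf|exact: cg].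
Qed.

Lemma ccont_cst (T : topologicalType) (c : R[i]) : cont (fun _ : T => c).
Proof. by apply/contP => x; exact: cvg_cst. Qed.

Lemma ccont_comp (S T : topologicalType) (g : S -> T) (f : T -> R[i]) :
  continuous g -> cont f -> cont (fun x => f (g x)).
Proof. by move=> cg [cf]; split => x e e0; exact: (cg x _ (cf (g x) e e0)). Qed.

Lemma ccont_sum (T : topologicalType) (I : Type) (r : seq I) (F : I -> T -> R[i]) :
  (forall i, cont (F i)) -> cont (fun x => \sum_(i <- r) F i x).
Proof.
move=> cF; elim: r => [|i r ih].
  by under eq_fun do rewrite big_nil; exact: ccont_cst.
by under eq_fun do rewrite big_cons; apply: ccontD.
Qed.

Lemma ccvg_cauchy (u : nat -> R[i]) :
  (forall e : R, 0 < e -> exists m, forall n, (m <= n)%N ->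
     nc (u n - u m) < e) ->
  exists l : R[i], u n @[n --> \oo] --> (l : R[i]^o).
Proof.
move=> h.
have real_case (v : nat -> R) : (forall m n, `|v m - v n| <= nc (u n - u m)) ->
    cvgn v.
  move=> vu; apply/cauchy_cvgP/cauchy_exP => e e0.
  have [m hm] := h e e0; exists (v m); exists m => // n /= mn.
  by rewrite /ball /=; apply: le_lt_trans (vu _ _) _; exact: hm.
have c1 : cvgn (fun n => complex.Re (u n)).
  apply: real_case => m n; rewrite ncBC; apply: le_trans _ (nc_Re _).
  by case: (u m) (u n) => a b [].
have c2 : cvgn (fun n => complex.Im (u n)).
  apply: real_case => m n; rewrite ncBC; apply: le_trans _ (nc_Im _).
  by case: (u m) (u n) => a b [].
exists (limn (fun n => complex.Re (u n)) +i* limn (fun n => complex.Im (u n))).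
apply/ccvgP => e e0; have e20 : 0 < e / 2 by rewrite divr_gt0.
move/(@cvgrPdist_lt _ R^o)/(_ _ e20) : c1 => h1.
move/(@cvgrPdist_lt _ R^o)/(_ _ e20) : c2 => h2.
apply: filterS2 h1 h2 => n h1 h2.
rewrite ncBC; apply: le_lt_trans (nc_ReIm _) _.
move: h1 h2; case: (u n) => a b /= h1 h2.
by rewrite [ltRHS]splitr; exact: ltrD.
Qed.

Lemma ccvg_unique (u : nat -> R[i]) (l l' : R[i]) :
  u n @[n --> \oo] --> (l : R[i]^o) -> u n @[n --> \oo] --> (l' : R[i]^o) ->
  l = l'.
Proof. by move=> /(cvg_unique (@norm_hausdorff _ R[i]^o)); apply. Qed.

Lemma nc_le_lim (u : nat -> R[i]) (l : R[i]) (C : R) :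
  u n @[n --> \oo] --> (l : R[i]^o) -> (\forall n \near \oo, nc (u n) <= C) ->
  nc l <= C.
Proof.
move=> /ccvgP ul uC; apply/ler_addgt0Pr => e e0.
have [n [h1 h2]] := @filter_ex _ _ (eventually_filter) _ (filterI uC (ul e e0)).
rewrite ncBC in h2.
by apply: le_trans (nc_le_sub _ (u n)) _; rewrite addrC lerD// ltW.
Qed.

Lemma ccvg_near (u v : nat -> R[i]) (l : R[i]) :
  u n @[n --> \oo] --> (l : R[i]^o) ->
  (forall e : R, 0 < e -> \forall n \near \oo, nc (v n - u n) < e) ->
  v n @[n --> \oo] --> (l : R[i]^o).
Proof.
move=> /ccvgP ul vu; apply/ccvgP => e e0.
have e20 : 0 < e / 2 by rewrite divr_gt0.
apply: filterS2 (ul _ e20) (vu _ e20) => n h1 h2.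
apply: le_lt_trans (nc_dist_tri _ (u n) _) _.
by rewrite [ltRHS]splitr; exact: ltrD.
Qed.

End ComplexLimits.

(* Applied to the filter of the sets whose complement in K satisfies P. *)
Lemma compact_ind (T : topologicalType) (K : set T) (P : set T -> Prop) :
  P set0 -> (forall A B, A `<=` B -> P B -> P A) ->
  (forall A B, P A -> P B -> P (A `|` B)) ->
  compact K -> (forall x, K x -> exists2 U, nbhs x U & P U) -> P K.
Proof.
move=> P0 Psub PU cK Ploc; apply: contrapT => nPK.
pose F : set_system T := [set B | P (K `\` B)].
have FF : ProperFilter F.
  apply: Build_ProperFilter_ex.
    move=> B FB; apply: contrapT => /nonemptyPn B0.
    by move: FB; rewrite /F /= B0 setD0.
  split.
  - by rewrite /F /= setDT.
  - move=> A B PA PB; change (P (K `\` (A `&` B))).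
    by rewrite setDIr; exact: PU.
  - by move=> A B AB; apply: Psub; exact: setDS.
have [|x [Kx clx]] := cK F FF; first by rewrite /F /= setDv.
have [U xU PU'] := Ploc x Kx.
have FU : F (~` U) by apply: Psub PU' => y [_ /contrapT].
by have [y []] := clx _ _ FU xU.
Qed.

(** * Urysohn functions on locally compact groups *)

Section GroupTopology.
Variables (R : realType) (G : topologicalZmodType).
Hypothesis G_lc : locally_compact [set: G].
Hypothesis G_hd : hausdorff_space G.

Lemma contG_add (T : topologicalType) (f g : T -> G) :
  continuous f -> continuous g -> continuous (fun x => f x + g x).
Proof.
move=> cf cg x; apply: (@continuous_comp _ _ _ (fun x => (f x, g x))
  (fun p : G * G => p.1 + p.2)); last exact: add_continuous.
by apply: cvg_pair; [exact: cf|exact: cg].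
Qed.

Lemma contG_opp (T : topologicalType) (f : T -> G) :
  continuous f -> continuous (fun x => - f x).
Proof.
move=> cf x; apply: (@continuous_comp _ _ _ f (-%R : G -> G)); first exact: cf.
exact: opp_continuous.
Qed.

Lemma contG_sub (T : topologicalType) (f g : T -> G) :
  continuous f -> continuous g -> continuous (fun x => f x - g x).
Proof. by move=> cf cg; apply: contG_add => //; exact: contG_opp. Qed.

Lemma contG_id (T : topologicalType) : continuous (fun x : T => x).
Proof. by move=> x; exact: cvg_id. Qed.

Lemma contG_cst (S T : topologicalType) (c : S) : continuous (fun _ : T => c).
Proof. by move=> x; exact: cvg_cst. Qed.

Lemma contG_fst (S T : topologicalType) : continuous (fun p : S * T => p.1).
Proof. by move=> x; exact: cvg_fst. Qed.

Lemma contG_snd (S T : topologicalType) : continuous (fun p : S * T => p.2).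
Proof. by move=> x; exact: cvg_snd. Qed.

Lemma precompact_nbhs (x : G) : exists2 U : set G, open U /\ precompact U & U x.
Proof.
have [K + [cK clK]] := @G_lc x I.
rewrite withinET /= nbhsE => -[U [oU Ux] UK].
exists U => //; split => //; apply: (@precompact_subset _ _ K).
  exact: UK.
by rewrite precompact_closed.
Qed.

Lemma compact_open_nbhs (K : set G) : compact K ->
  exists2 U : set G, open U /\ precompact U & K `<=` U.
Proof.
move=> cK; apply: (@compact_ind _ K
  (fun S => exists2 U : set G, open U /\ precompact U & S `<=` U)) => //.
- exists set0 => //; split; first exact: open0.
  by apply: compact_precompact => //; exact: compact0.
- by move=> A B AB [U oU BU]; exists U => //; exact: subset_trans BU.
- move=> A B [U [oU pU] AU] [V [oV pV] BV]; exists (U `|` V); last exact: setUSS.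
  split; first exact: openU.
  by move: pU pV; rewrite !precompactE closureU; exact: compactU.
- move=> x _; have [U oU Ux] := precompact_nbhs x.
  by exists U; [apply: open_nbhs_nbhs; split => //; case: oU|exists U].
Qed.

(** The one-point compactification is compact Hausdorff, hence normal. Separating [K] from the
    complement of [U] intersected with a precompact open [V], a closed set that contains the point
    at infinity, makes the support compact as well. *)
Lemma urysohn_compact (K U : set G) : compact K -> open U -> K `<=` U ->
  exists f : G -> R, [/\ rcont f, (forall x, 0 <= f x <= 1),
    (forall x, K x -> f x = 1), (forall x, ~ U x -> f x = 0) &
    compact (closure [set x | f x != 0])].
Proof.
move=> cK oU KU.
have [V [oV pV] KV] := compact_open_nbhs cK.
pose opc := one_point_compactification G.
have nopc : normal_space opc.
  apply: compact_normal; [|exact: one_point_compactification_compact].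
  exact: one_point_compactification_hausdorff G_lc G_hd.
have cA : closed [set (Some x : opc) | x in K].
  apply: compact_closed; first exact: one_point_compactification_hausdorff G_lc G_hd.
  apply: continuous_compact => //; apply: continuous_subspaceT => x.
  exact: one_point_compactification_some_continuous.
have cB : closed (~` [set (Some x : opc) | x in U `&` V]).
  rewrite closedC; apply: one_point_compactification_open_some.
  exact: openI.
have AB0 : ~` [set (Some x : opc) | x in U `&` V] `&`
    [set (Some x : opc) | x in K] = set0.
  rewrite -subset0 => y [ny [x Kx xy]]; apply: ny; exists x => //.
  by split; [exact: KU|exact: KV].
have := (normal_separatorP (R := R)).1 nopc _ _ cB cA AB0.
move=> /uniform_separatorP => /(_ R) [f [cf f01 f0 f1]].
have g0 x : ~ (U `&` V) x -> f (Some x) = 0.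
  move=> nUV; apply: f0; exists (Some x) => // -[y UVy [yx]].
  by apply: nUV; rewrite -yx.
exists (fun x => f (Some x)); split.
- split => x; apply: (@continuous_comp _ _ _ (Some : G -> opc) f).
    exact: one_point_compactification_some_continuous.
  exact: cf.
- by move=> x; have := f01 (f (Some x)); rewrite /= in_itv /=; apply; exists (Some x).
- by move=> x Kx; apply: f1; exists (Some x) => //; exists x.
- by move=> x nU; apply: g0 => -[].
- rewrite -precompactE; apply: precompact_subset pV => x /= fx.
  by apply: contrapT => nV; move/eqP : fx; apply; apply: g0 => -[].
Qed.

End GroupTopology.

(** * Uniformity on compact sets; sums of sets *)

Section Compactness.
Variable R : realType.

(** Tube argument: near each [y] of [K] the values are compared with [H (s, y)], at half the
    tolerance each, and compactness makes the neighbourhood of [s] common to all [y]. *)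
Lemma near_compact_close (S T : topologicalType) (H : S * T -> R[i])
    (K : set T) (s : S) (e : R) :
  cont H -> compact K -> 0 < e ->
  \forall s' \near s, forall y, K y -> nc (H (s', y) - H (s, y)) < e.
Proof.
move=> [cH] /compact_near_coveringP cK e0.
have e20 : 0 < e / 2 by rewrite divr_gt0.
apply: (cK S (nbhs s) (fun s' y => nc (H (s', y) - H (s, y)) < e)).
move=> y Ky; have [[A B] /= [sA yB] AB] := cH (s, y) _ e20.
exists (B, A) => //= -[y' s'] /= [By' As'].
apply: le_lt_trans (nc_dist_tri _ (H (s, y)) _) _.
rewrite [ltRHS]splitr ltrD//; first by apply: (AB (s', y')).
rewrite ncBC; apply: (AB (s, y')); split => //=; exact: nbhs_singleton.
Qed.

Lemma bounded_compact (T : topologicalType) (f : T -> R[i]) (K : set T) :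
  cont f -> compact K ->
  exists M : R, 0 <= M /\ forall x, K x -> nc (f x) <= M.
Proof.
move=> [cf] cK.
apply: (@compact_ind _ K (fun S => exists M : R, 0 <= M /\
    forall x, S x -> nc (f x) <= M)) => //.
- by exists 0.
- by move=> A B AB [M [M0 h]]; exists M; split => // x /AB; exact: h.
- move=> A B [M [M0 hM]] [N [N0 hN]]; exists (M + N).
  split; first exact: addr_ge0.
  move=> x [/hM|/hN] h; apply: le_trans h _; first by rewrite lerDl.
  by rewrite lerDr.
move=> x _; exists [set y | nc (f y - f x) < 1]; first exact: cf.
exists (1 + nc (f x)); split; first by rewrite addr_ge0// nc_ge0.
move=> y /= h; apply: le_trans (nc_le_sub _ (f x)) _.
by rewrite lerD2r ltW.
Qed.

Variable G : topologicalZmodType.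
Hypothesis G_hd : hausdorff_space G.

Lemma cadd (p : G * G) (U : set G) : nbhs (p.1 + p.2) U ->
  exists A B : set G, [/\ nbhs p.1 A, nbhs p.2 B &
    forall a b, A a -> B b -> U (a + b)].
Proof.
move=> h; have [[A B] /= [hA hB] AB] := @add_continuous G p _ h.
by exists A, B; split => // a b Aa Bb; apply: (AB (a, b)).
Qed.

Lemma Cc_ucont (f : G -> R[i]) (K : set G) (e : R) :
  cont f -> compact K -> (forall x, ~ K x -> f x = 0) -> 0 < e ->
  exists2 U : set G, nbhs 0 U & forall x y, U (x - y) -> nc (f x - f y) < e.
Proof.
move=> cf cK f0 e0.
pose H (p : G * G) := f (p.1 + p.2).
have cH : cont H.
  apply: (@ccont_comp _ _ _ (fun p : G * G => p.1 + p.2)) => //.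
  exact: add_continuous.
pose U : set G := [set s | forall y, K y -> nc (f (s + y) - f (0 + y)) < e].
have nU : nbhs 0 U by apply: (@near_compact_close G G H K 0 e).
have nU' : nbhs 0 [set x | U (- x)].
  by apply: (@opp_continuous G 0); rewrite oppr0.
(* Symmetrized, because possibly only one of [x] and [y] lies in [K], and the estimate is applied
   around that one. *)
exists (U `&` [set x | U (- x)]); first exact: filterI.
move=> x y [Ux Uy].
have [Ky|nKy] := pselect (K y).
  by have := Ux y Ky; rewrite subrK add0r.
have [Kx|nKx] := pselect (K x).
  have := Uy x Kx; rewrite opprB subrK add0r ncBC.
  by [].
by rewrite !f0// subrr Normc.normc0.
Qed.

Definition sumset (A K : set G) : set G := [set a + k | a in A & k in K].

Lemma compact_sumset (A K : set G) : compact A -> compact K ->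
  compact (sumset A K).
Proof.
move=> cA cK; have -> : sumset A K = (fun p : G * G => p.1 + p.2) @` (A `*` K).
  apply/seteqP; split=> [_ [a Aa [k Kk] <-]|_ [[a k] [/= Aa Kk] <-]].
    by exists (a, k).
  by exists a => //; exists k.
apply: continuous_compact; last exact: compact_setX.
by apply: continuous_subspaceT; exact: add_continuous.
Qed.

Lemma compact_opp (K : set G) : compact K -> compact [set - x | x in K].
Proof.
move=> cK; apply: continuous_compact => //.
by apply: continuous_subspaceT; exact: opp_continuous.
Qed.

Lemma compact_shift (t : G) (K : set G) : compact K ->
  compact [set t + x | x in K].
Proof.
move=> cK; apply: continuous_compact => //.
apply: continuous_subspaceT.
by apply: contG_add; [exact: contG_cst|exact: contG_id].
Qed.

Lemma open_shift (t : G) (U : set G) : open U -> open [set x | U (x + t)].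
Proof.
move=> oU; apply: open_comp => // x _.
by apply: contG_add; [exact: contG_id|exact: contG_cst].
Qed.

Lemma open_sumset (A K : set G) : open A -> open (sumset A K).
Proof.
move=> oA; have -> : sumset A K = \bigcup_(k in K) [set x | A (x + - k)].
  apply/seteqP; split=> [_ [a Aa [k Kk] <-]|x [k Kk /= Axk]].
    by exists k => //=; rewrite addrK.
  by exists (x - k) => //; exists k => //; rewrite subrK.
by apply: bigcup_open => k _; exact: open_shift.
Qed.

(** Makes the part of the van Hove boundary that is built from the complement of [A n] a Borel set:
    this complement is closed, and the other summand is compact. *)
Lemma closed_sumset (C K : set G) : closed C -> compact K ->
  closed (sumset C K).
Proof.
move=> cC /compact_near_coveringP cK; rewrite -openC openE => x nx.
have oC : open (~` C) by rewrite openC.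
have : \forall x' \near x, K `<=` fun k => ~ C (x' - k).
  apply: (cK G (nbhs x) (fun x' k => ~ C (x' - k))) => k Kk.
  have nC : ~ C (x - k).
    by move=> Cxk; apply: nx; exists (x - k) => //; exists k => //; rewrite subrK.
  have /cadd [A [B [hA hB AB]]] :
      nbhs ((x, - k).1 + (x, - k).2) (~` C) by apply: open_nbhs_nbhs.
  have hB' : nbhs k [set y | B (- y)] by exact: (@opp_continuous G k).
  by exists ([set y | B (- y)], A) => //= -[y x'] /= [By Ax']; exact: AB.
apply: filterS => x' h [c Cc [k Kk] cx]; apply: (h k Kk).
by rewrite -cx addrK.
Qed.

End Compactness.

(** * Relatively compact Borel sets *)

Section RelCompact.
Variables (R : realType) (G : topologicalZmodType).
Hypothesis G_hd : hausdorff_space G.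
Implicit Types (m : radon R G) (D E : set G).

(** The domains of integration of the proof: Radon measures are finite on them, and continuous
    functions are bounded, hence integrable, over them. *)
Definition relc D := measurable (D : set (borel G)) /\
  exists2 K : set G, compact K & D `<=` K.

Lemma measurable_open (U : set G) : open U -> measurable (U : set (borel G)).
Proof. exact: sub_sigma_algebra. Qed.

Lemma measurable_closed (U : set G) : closed U -> measurable (U : set (borel G)).
Proof.
by move=> cU; rewrite -(setCK U); apply: measurableC; apply: measurable_open;
  rewrite openC.
Qed.

Lemma measurable_compact (K : set G) : compact K ->
  measurable (K : set (borel G)).
Proof. by move=> cK; apply: measurable_closed; exact: compact_closed. Qed.

Lemma relc_compact K : compact K -> relc K.
Proof. by move=> cK; split; [exact: measurable_compact|exists K]. Qed.

Lemma relc_open U : open U -> precompact U -> relc U.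
Proof.
rewrite precompactE => oU pU; split; first exact: measurable_open.
by exists (closure U) => //; exact: subset_closure.
Qed.

Lemma relc_sub D E : relc D -> measurable (E : set (borel G)) -> E `<=` D ->
  relc E.
Proof.
by move=> [_ [K cK DK]] mE ED; split => //; exists K => //; exact: subset_trans DK.
Qed.

Lemma relc_finite m D : relc D -> (m D < +oo)%E.
Proof.
move=> [mD [K cK DK]]; apply: le_lt_trans (radon_compact (radonP m) cK).
by apply: le_measure; rewrite ?inE//; exact: measurable_compact.
Qed.

Lemma relc_fin_num m D : relc D -> m D \is a fin_num.
Proof. by move=> rD; rewrite ge0_fin_numE//; exact: relc_finite. Qed.

Lemma continuous_measurable (f : G -> R) (D : set G) :
  rcont f -> measurable_fun (D : set (borel G)) (f : borel G -> R).
Proof.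
move=> [cf]; apply: (@measurable_funS _ _ _ _ setT) => //.
apply: (measurability _ (RGenOpens.measurableE R)).
move=> _ [_ [a [b ->] <-]]; rewrite setTI; apply: sub_sigma_algebra.
by apply: open_comp => [x _|]; [exact: cf|exact: interval_open].
Qed.

Lemma continuous_integrable m D (f : G -> R) : relc D -> rcont f ->
  m.-integrable D (EFin \o f).
Proof.
move=> rD cf; have [mD [K cK DK]] := rD.
apply: measurable_bounded_integrable => //.
- exact: relc_finite.
- exact: continuous_measurable.
have [M [M0 h]] := bounded_compact (ccont_R cf) cK.
exists M; split; first exact: num_real.
move=> x Mx y Dy; apply: le_trans (ltW Mx).
by have := h y (DK _ Dy); rewrite ncR.
Qed.

End RelCompact.

(** * Integration over relatively compact Borel sets *)

Section Sections.
Variables (R : realType) (S T : topologicalType) (H : S * T -> R[i]).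
Hypothesis cH : cont H.

Lemma ccont_sect1 (x : S) : cont (fun y => H (x, y)).
Proof.
apply: (ccont_comp (g := fun y : T => (x, y))) cH => y.
by apply: cvg_pair; [exact: cvg_cst|exact: cvg_id].
Qed.

Lemma ccont_sect2 (y : T) : cont (fun x => H (x, y)).
Proof.
apply: (ccont_comp (g := fun x : S => (x, y))) cH => x.
by apply: cvg_pair; [exact: cvg_id|exact: cvg_cst].
Qed.

Lemma ccont_swap :
  cont (fun p => H (p.2, p.1)).
Proof.
apply: (ccont_comp (g := fun p : T * S => (p.2, p.1))) cH => p.
by apply: cvg_pair; [exact: cvg_snd|exact: cvg_fst].
Qed.

End Sections.

Arguments cint : simpl never.
Arguments cm_int : simpl never.

(** * Integrals of continuous functions and Fubini *)

Section RadonIntegral.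
Variables (R : realType) (G : topologicalZmodType).
Hypothesis G_hd : hausdorff_space G.
Implicit Types (m : radon R G) (mu nu : cmeasure R G) (D E : set G).
Implicit Types (f g : G -> R[i]).

Lemma relc0 : relc (set0 : set G).
Proof. by apply: relc_compact => //; exact: compact0. Qed.

Lemma relcU D E : relc D -> relc E -> relc (D `|` E).
Proof.
move=> [mD [K cK DK]] [mE [L cL EL]]; split; first exact: measurableU.
by exists (K `|` L); [exact: compactU|exact: setUSS].
Qed.

(* Additive estimates on relatively compact Borel sets may be checked locally;
   this replaces Riemann sums. *)
Lemma relc_ind (Q : set G -> Prop) :
  (forall x : G, exists2 U : set G, nbhs x U &
    forall D, relc D -> D `<=` U -> Q D) ->
  (forall A B, relc A -> relc B -> A `&` B = set0 -> Q A -> Q B ->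
    Q (A `|` B)) ->
  forall D, relc D -> Q D.
Proof.
move=> Qloc QU D rD; have [mD [K cK DK]] := rD.
have Q0 : Q set0.
  by have [U _ h] := Qloc 0; apply: h; [exact: relc0|exact: sub0set].
have [S [mS KS QS]] : exists S : set G, [/\ measurable (S : set (borel G)),
    K `<=` S & forall D, relc D -> D `<=` S -> Q D].
  apply: (@compact_ind _ K (fun T => exists S : set G,
    [/\ measurable (S : set (borel G)),
    T `<=` S & forall D, relc D -> D `<=` S -> Q D])) => //.
  - by exists set0; split => // E _; rewrite subset0 => ->; exact: Q0.
  - by move=> A B AB [S [mS BS h]]; exists S; split => //; exact: subset_trans BS.
  - move=> A B [S [mS AS hS]] [T [mT BT hT]]; exists (S `|` T); split.
    + exact: measurableU.
    + exact: setUSS.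
    + move=> E rE EST; have [mE _] := rE.
      have rES : relc (E `&` S) by apply: relc_sub rE _ _ => //; exact: measurableI.
      have rEDS : relc (E `\` S) by apply: relc_sub rE _ _ => //; exact: measurableD.
      rewrite -(setUIDK E S); apply: QU => //.
      * by rewrite setDE setIACA setICr setI0.
      * by apply: hS => // x [].
      * by apply: hT => // x [/EST[]].
  - move=> x _; have [U xU h] := Qloc x.
    rewrite nbhsE in xU; have [V [oV Vx] VU] := xU.
    exists V; first by apply: open_nbhs_nbhs; split.
    exists V; split => //; first exact: measurable_open.
    by move=> E rE EV; apply: h => //; exact: subset_trans VU.
by apply: QS => //; exact: subset_trans KS.
Qed.

Lemma RintegralD_relc m D (f g : G -> R) : relc D -> rcont f ->
  rcont g ->
  \int[m]_(x in D) (f x + g x) = \int[m]_(x in D) f x + \int[m]_(x in D) g x.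
Proof.
by move=> rD cf cg; apply: RintegralD; [case: rD|exact: continuous_integrable..].
Qed.

Lemma RintegralB_relc m D (f g : G -> R) : relc D -> rcont f ->
  rcont g ->
  \int[m]_(x in D) (f x - g x) = \int[m]_(x in D) f x - \int[m]_(x in D) g x.
Proof.
by move=> rD cf cg; apply: RintegralB; [case: rD|exact: continuous_integrable..].
Qed.

Lemma RintegralZ_relc m D (f : G -> R) r : relc D -> rcont f ->
  \int[m]_(x in D) (r * f x) = r * \int[m]_(x in D) f x.
Proof.
by move=> rD cf; apply: RintegralZl; [case: rD|exact: continuous_integrable].
Qed.

Lemma le_Rintegral_relc m D (f g : G -> R) : relc D -> rcont f ->
  rcont g -> (forall x, D x -> f x <= g x) ->
  \int[m]_(x in D) f x <= \int[m]_(x in D) g x.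
Proof.
move=> rD cf cg fg; apply: le_Rintegral => //; [by case: rD|
  exact: continuous_integrable..].
Qed.

Lemma Rintegral_bound m D (f : G -> R) (s : R) : relc D -> rcont f ->
  (forall x, D x -> `|f x| <= s) ->
  `|\int[m]_(x in D) f x| <= s * fine (m D).
Proof.
move=> rD cf fs.
apply: le_trans (le_normr_Rintegral _ _) _; first by case: rD.
  exact: continuous_integrable.
have <- : \int[m]_(x in D) s = s * fine (m D) by rewrite Rintegral_cst//; case: rD.
apply: le_Rintegral_relc => //.
- exact: rcont_norm.
- exact: rcont_cst.
Qed.

(** Real and imaginary parts are estimated separately, hence the factor 2; it propagates into the
    factors 4 and 8 of later estimates. *)
Lemma cint_bound m D f (s : R) : relc D -> cont f ->
  (forall x, D x -> nc (f x) <= s) ->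
  nc (cint m D f) <= 2 * s * fine (m D).
Proof.
move=> rD cf fs; apply: le_trans (nc_ReIm _) _ => /=.
rewrite -mulrA mulr_natl mulr2n; apply: lerD; apply: Rintegral_bound => //.
- exact: ccont_Re.
- by move=> x Dx; apply: le_trans (nc_Re _) _; exact: fs.
- exact: ccont_Im.
- by move=> x Dx; apply: le_trans (nc_Im _) _; exact: fs.
Qed.

Lemma cintD m D f g : relc D -> cont f -> cont g ->
  cint m D (fun x => f x + g x) = cint m D f + cint m D g.
Proof.
move=> rD cf cg; rewrite /cint; simpc.
rewrite -(RintegralD_relc m rD (ccont_Re cf) (ccont_Re cg)).
rewrite -(RintegralD_relc m rD (ccont_Im cf) (ccont_Im cg)).
by congr (_ +i* _); congr (Rintegral _ _ _); apply/funext => x;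
  case: (f x) (g x) => a b [].
Qed.

Lemma cintZ m D f c : relc D -> cont f ->
  cint m D (fun x => c * f x) = c * cint m D f.
Proof.
move=> rD cf; rewrite /cint; case: c => a b; simpc.
have cr := ccont_Re cf; have ci := ccont_Im cf.
have cM r (h : G -> R) : rcont h -> rcont (fun x => r * h x).
  by move=> ch; apply: rcontM ch; exact: rcont_cst.
rewrite -!(RintegralZ_relc m _ rD cr) -!(RintegralZ_relc m _ rD ci).
rewrite -(RintegralB_relc m rD (cM _ _ cr) (cM _ _ ci)).
rewrite -(RintegralD_relc m rD (cM _ _ ci) (cM _ _ cr)).
by congr (_ +i* _); congr (Rintegral _ _ _); apply/funext => x; case: (f x).
Qed.

Lemma eq_cint m D f g : (forall x, D x -> f x = g x) ->
  cint m D f = cint m D g.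
Proof.
move=> fg; rewrite /cint; congr (_ +i* _); apply: eq_Rintegral => x;
  by rewrite inE => /fg ->.
Qed.

Lemma cint_mkcond m D E f : D `<=` E -> (forall x, E x -> ~ D x -> f x = 0) ->
  cint m E f = cint m D f.
Proof.
move=> DE f0; rewrite /cint; congr (_ +i* _); rewrite Rintegral_mkcond
  [RHS]Rintegral_mkcond; congr (Rintegral _ _ _); apply/funext => x;
  rewrite !patchE; case: ifPn; case: ifPn => //; rewrite ?inE ?notin_setE.
- by move=> nD Ex; rewrite f0.
- by move=> /DE.
- by move=> nD Ex; rewrite f0.
- by move=> /DE.
Qed.

Lemma cint_setU m D E f : relc D -> relc E -> D `&` E = set0 ->
  cont f -> cint m (D `|` E) f = cint m D f + cint m E f.
Proof.
move=> rD rE DE0 cf; rewrite /cint; simpc.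
congr (_ +i* _); apply: Rintegral_setU; try (by case: rD); try (by case: rE).
- by apply: continuous_integrable => //; [exact: relcU|exact: ccont_Re].
- exact/eqP.
- by apply: continuous_integrable => //; [exact: relcU|exact: ccont_Im].
- exact/eqP.
Qed.

Lemma fine_measureU m D E : relc D -> relc E -> D `&` E = set0 ->
  fine (m (D `|` E)) = fine (m D) + fine (m E).
Proof.
move=> rD rE DE0; rewrite measureU//; [|by case: rD|by case: rE].
by rewrite fineD//; exact: relc_fin_num.
Qed.

Lemma le_fine_measure m D E : relc E -> measurable (D : set (borel G)) ->
  D `<=` E -> fine (m D) <= fine (m E).
Proof.
move=> rE mD DE; apply: fine_le.
- by apply: relc_fin_num => //; exact: relc_sub DE.
- exact: relc_fin_num.
- by apply: le_measure; rewrite ?inE//; case: rE.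
Qed.

(** The four components need not be a minimal decomposition, so this may exceed the variation and be
    unbounded under translation. Except for Haar measure, it only enters errors that can be made
    arbitrarily small. *)
Definition cm_mass mu D : R :=
  fine (re_pos mu D) + fine (re_neg mu D) +
  (fine (im_pos mu D) + fine (im_neg mu D)).

Lemma cm_mass_ge0 mu D : 0 <= cm_mass mu D.
Proof. by rewrite /cm_mass !addr_ge0// fine_ge0. Qed.

Lemma cm_massU mu D E : relc D -> relc E -> D `&` E = set0 ->
  cm_mass mu (D `|` E) = cm_mass mu D + cm_mass mu E.
Proof. by move=> rD rE DE0; rewrite /cm_mass !fine_measureU//; ring. Qed.

Lemma cm_int_bound mu D f (s : R) : relc D -> cont f ->
  (forall x, D x -> nc (f x) <= s) ->
  nc (cm_int mu D f) <= 2 * s * cm_mass mu D.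
Proof.
move=> rD cf fs; rewrite /cm_int.
apply: le_trans (le_normcD _ _) _.
rewrite Normc.normcM nc_i mul1r /cm_mass mulrDr.
apply: lerD; apply: le_trans (ncB _ _) _; rewrite mulrDr; apply: lerD;
  exact: cint_bound.
Qed.

Lemma cm_intD mu D f g : relc D -> cont f -> cont g ->
  cm_int mu D (fun x => f x + g x) = cm_int mu D f + cm_int mu D g.
Proof. by move=> rD cf cg; rewrite /cm_int !cintD//; ring. Qed.

Lemma cm_intZ mu D f c : relc D -> cont f ->
  cm_int mu D (fun x => c * f x) = c * cm_int mu D f.
Proof. by move=> rD cf; rewrite /cm_int !cintZ//; ring. Qed.

Lemma eq_cm_int mu D f g : (forall x, D x -> f x = g x) ->
  cm_int mu D f = cm_int mu D g.
Proof. by move=> fg; rewrite /cm_int !(eq_cint _ fg). Qed.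

Lemma cm_intB mu D f g : relc D -> cont f -> cont g ->
  cm_int mu D (fun x => f x - g x) = cm_int mu D f - cm_int mu D g.
Proof.
move=> rD cf cg.
have cNg : cont (fun x => -1 * g x) := @ccontM R G _ _ (@ccont_cst R G (-1)) cg.
transitivity (cm_int mu D f + cm_int mu D (fun x => -1 * g x)).
  rewrite -(cm_intD mu rD cf cNg).
  by apply: eq_cm_int => x _; rewrite mulN1r.
by rewrite (cm_intZ mu (-1) rD cg) mulN1r.
Qed.

Lemma cm_int_mkcond mu D E f : D `<=` E ->
  (forall x, E x -> ~ D x -> f x = 0) -> cm_int mu E f = cm_int mu D f.
Proof. by move=> DE f0; rewrite /cm_int !(cint_mkcond _ DE f0). Qed.

Lemma cm_int_setU mu D E f : relc D -> relc E -> D `&` E = set0 ->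
  cont f -> cm_int mu (D `|` E) f = cm_int mu D f + cm_int mu E f.
Proof. by move=> rD rE DE0 cf; rewrite /cm_int !cint_setU//; ring. Qed.

Lemma cm_int_sum mu D (I : Type) (r : seq I) (F : I -> G -> R[i]) :
  relc D -> (forall i, cont (F i)) ->
  cm_int mu D (fun x => \sum_(i <- r) F i x) = \sum_(i <- r) cm_int mu D (F i).
Proof.
move=> rD cF; elim: r => [|i r ih].
  rewrite big_nil -[RHS](mul0r (cm_int mu D (fun=> 0))) -cm_intZ//.
    by apply: eq_cm_int => x _; rewrite big_nil mul0r.
  exact: ccont_cst.
rewrite big_cons -ih -cm_intD//.
  by apply: eq_cm_int => x _; rewrite big_cons.
exact: ccont_sum.
Qed.

Lemma cm_int_param_cont mu D (T : topologicalType) (H : T * G -> R[i]) :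
  relc D -> cont H ->
  cont (fun t => cm_int mu D (fun y => H (t, y))).
Proof.
move=> rD cH; have [mD [K cK DK]] := rD.
have cHt t : cont (fun y => H (t, y)) := @ccont_sect1 R T G H cH t.
split => t e e0; pose M := 2 * cm_mass mu D + 1.
have M0 : 0 < M by rewrite ltr_wpDl// mulr_ge0// cm_mass_ge0.
have eM0 : 0 < e / M by rewrite divr_gt0.
apply: filterS (@near_compact_close R T G H K t _ cH cK eM0) => t' h.
rewrite -cm_intB//.
apply: le_lt_trans (_ : 2 * (e / M) * cm_mass mu D < e).
  apply: cm_int_bound => //; first exact: (ccontB (cHt _) (cHt _)).
  by move=> x Dx; apply/ltW/h/DK.
have -> : 2 * (e / M) * cm_mass mu D = e * (2 * cm_mass mu D) / M by ring.
by rewrite ltr_pdivrMr// ltr_pM2l// /M ltrDl.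
Qed.

Lemma cm_int_cst mu D c : relc D ->
  cm_int mu D (fun=> c) = c * cm_int mu D (fun=> 1).
Proof.
move=> rD; rewrite -cm_intZ//; last exact: ccont_cst.
by apply: eq_cm_int => x _; rewrite mulr1.
Qed.

(** The difference of the two iterated integrals is additive in [D], and on a piece of [D] where
    [H (x, y)] varies with [x] by less than [e], uniformly for [y] in [K], it is at most [8 e] times
    the product of the masses. Subdivision gives this bound on all of [D], for every [e]. *)
Lemma cm_int_fubini mu nu D E (H : G * G -> R[i]) :
  relc D -> relc E -> cont H ->
  cm_int mu D (fun x => cm_int nu E (fun y => H (x, y))) =
  cm_int nu E (fun y => cm_int mu D (fun x => H (x, y))).
Proof.
move=> rD0 rE cH; have [mE [K cK EK]] := rE.
pose H' (p : G * G) := H (p.2, p.1).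
have cH' : cont H' := @ccont_swap R G G H cH.
have cHx x : cont (fun y => H (x, y)) := @ccont_sect1 R G G H cH x.
have cHy y : cont (fun x => H (x, y)) := @ccont_sect2 R G G H cH y.
have cI : cont (fun x => cm_int nu E (fun y => H (x, y))).
  exact: cm_int_param_cont.
have cJ C : relc C -> cont (fun y => cm_int mu C (fun x => H (x, y))).
  by move=> rC; exact: (@cm_int_param_cont mu C G H').
pose Delta D := cm_int mu D (fun x => cm_int nu E (fun y => H (x, y))) -
  cm_int nu E (fun y => cm_int mu D (fun x => H (x, y))).
have estim e : 0 < e -> forall D, relc D ->
    nc (Delta D) <= 8 * e * (cm_mass mu D * cm_mass nu E).
  move=> e0; apply: relc_ind.
    move=> x0; exists [set x | forall y, K y -> nc (H (x, y) - H (x0, y)) < e].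
      exact: near_compact_close.
    move=> D1 rD1 D1U.
    (* Both iterated integrals are compared with the one whose first argument is frozen at [x0],
       each with error at most [4 e] times the masses. *)
    pose c := cm_int nu E (fun y => H (x0, y)).
    have h1 : nc (cm_int mu D1 (fun x => cm_int nu E (fun y => H (x, y)) - c)) <=
        2 * (2 * e * cm_mass nu E) * cm_mass mu D1.
      apply: cm_int_bound => //; first by apply: ccontB => //; exact: ccont_cst.
      move=> x D1x; rewrite -cm_intB//; apply: cm_int_bound => //.
        exact: (ccontB (cHx _) (cHx _)).
      by move=> y Ey; apply/ltW/D1U => //; exact: EK.
    pose h y := H (x0, y) * cm_int mu D1 (fun=> 1).
    have ch : cont h by apply: ccontM => //; exact: ccont_cst.
    have h2 : nc (cm_int nu E (fun y => cm_int mu D1 (fun x => H (x, y)) - h y))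
        <= 2 * (2 * e * cm_mass mu D1) * cm_mass nu E.
      apply: cm_int_bound => //; first by apply: ccontB => //; exact: cJ.
      move=> y /EK Ky; rewrite /h -cm_int_cst// -cm_intB//; last exact: ccont_cst.
      apply: cm_int_bound => //; first by apply: ccontB => //; exact: ccont_cst.
      by move=> x /D1U /(_ _ Ky)/ltW.
    rewrite cm_intB// in h1; try exact: ccont_cst.
    rewrite cm_intB// in h2; try exact: cJ.
    have hc : cm_int mu D1 (fun=> c) = cm_int nu E h.
      rewrite (cm_int_cst mu c rD1) mulrC -(cm_intZ nu _ rE (cHx x0)).
      by apply: eq_cm_int => y _; rewrite /h mulrC.
    rewrite hc in h1; apply: le_trans (nc_dist_tri _ (cm_int nu E h) _) _.
    rewrite [X in _ + X]ncBC; apply: le_trans (lerD h1 h2) _.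
    by rewrite le_eqVlt; apply/orP; left; apply/eqP; ring.
  move=> A B rA rB AB0 hA hB; rewrite /Delta cm_int_setU// cm_massU//.
  have -> : cm_int nu E (fun y => cm_int mu (A `|` B) (fun x => H (x, y))) =
      cm_int nu E (fun y => cm_int mu A (fun x => H (x, y))) +
      cm_int nu E (fun y => cm_int mu B (fun x => H (x, y))).
    rewrite -(cm_intD nu rE (cJ _ rA) (cJ _ rB)).
    by apply: eq_cm_int => y _; rewrite cm_int_setU.
  rewrite [(cm_mass mu A + _) * _]mulrDl mulrDr.
  by apply: le_trans (lerD hA hB); rewrite opprD addrACA; exact: le_normcD.
apply/eqP; rewrite -subr_eq0; apply/eqP; apply: nc_eq0.
apply/ler_addgt0Pr => e e0; rewrite add0r.
set M := cm_mass mu D * cm_mass nu E.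
have M0 : 0 <= M by rewrite mulr_ge0// cm_mass_ge0.
have eM : 0 < e / (8 * (M + 1)) by rewrite divr_gt0// mulr_gt0// ltr_wpDl.
apply: le_trans (estim _ eM _ rD0) _.
have -> : 8 * (e / (8 * (M + 1))) * M = e * M / (M + 1).
  by field; rewrite gt_eqF// ltr_wpDl.
by rewrite ler_pdivrMr ?ltr_wpDl// ler_wpM2l ?lerDl// ltW.
Qed.

Lemma mzero_radon : is_radon (@mzero _ (borel G) R).
Proof.
split=> [K _|E mE|U oU]; first by rewrite /mzero ltry.
  rewrite (_ : [set _ | _ in _] = [set 0%E]) ?ereal_inf1//.
  apply/seteqP; split=> [_ [U _ <-]//|_ ->]; exists setT => //.
  by split; [exact: openT|exact: subsetT].
rewrite (_ : [set _ | _ in _] = [set 0%E]) ?ereal_sup1//.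
apply/seteqP; split=> [_ [K _ <-]//|_ ->]; exists set0 => //.
by split; [exact: compact0|exact: sub0set].
Qed.

Definition radon0 : radon R G := Radon mzero_radon.

(** Lets Haar measure enter as a complex measure, so that the rules for [cm_int], Fubini in
    particular, apply to [mu] and [haar] together. *)
Definition cm_of_radon m : cmeasure R G := CMeasure m radon0 radon0 radon0.

Lemma cint_radon0 D f : cint radon0 D f = 0.
Proof.
rewrite /cint /Rintegral.
by rewrite !integral_measure_zero.
Qed.

Lemma cm_of_radonE m D f : cm_int (cm_of_radon m) D f = cint m D f.
Proof. by rewrite /cm_int /= !cint_radon0 !subr0 mulr0 addr0. Qed.

End RadonIntegral.

(** * Translation bounded measures as functionals *)

Section TranslationBounded.
Variables (R : realType) (G : topologicalZmodType).
Hypothesis G_lc : locally_compact [set: G].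
Hypothesis G_hd : hausdorff_space G.
Implicit Types (m : radon R G) (mu nu : cmeasure R G) (D E K : set G).
Implicit Types (f g : G -> R[i]).

(* Translation boundedness of [mu] as a functional on C_c(G): it replaces the
   variation measure throughout. *)
Definition tb_on mu K (C : R) : Prop :=
  forall (t : G) g (s : R), cont g ->
    (forall x, ~ K (x - t) -> g x = 0) -> (forall x, nc (g x) <= s) ->
    nc (cm_int mu setT g) <= C * s.

Definition tb_fun mu : Prop :=
  forall K, compact K -> exists2 C : R, 0 <= C & tb_on mu K C.

Lemma cm_int_compact mu K g : (forall x, ~ K x -> g x = 0) ->
  cm_int mu setT g = cm_int mu K g.
Proof. by move=> g0; apply: cm_int_mkcond => // x _; exact: g0. Qed.

Lemma cint1 m D : measurable (D : set (borel G)) ->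
  cint m D (fun=> 1) = (fine (m D))%:C.
Proof.
move=> mD; rewrite /cint /= (Rintegral_cst _ mD 1) (Rintegral_cst _ mD 0).
by rewrite mul1r mul0r.
Qed.

Lemma cm_int1 mu D : measurable (D : set (borel G)) ->
  cm_int mu D (fun=> 1) = cm_val mu D.
Proof.
move=> mD; rewrite /cm_int /cm_val !cint1//; simpc.
by congr (_ +i* _); ring.
Qed.

(** Link to [cm_variation], a supremum over finite disjoint families: on a piece where [g] is nearly
    constant the piece itself is such a family, and families on disjoint pieces are concatenated.
    The oscillation of [g] only costs [e] times the mass. *)
Lemma cm_int_partition mu g (s e : R) : cont g -> 0 < e ->
  (forall x, nc (g x) <= s) -> forall D, relc D ->
  exists (n : nat) (F : 'I_n -> set (borel G)),
    [/\ forall i, measurable (F i), forall i, F i `<=` D, trivIset setT F &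
    nc (cm_int mu D g) <=
      s * (\sum_(i < n) nc (cm_val mu (F i))) + e * cm_mass mu D].
Proof.
move=> cg e0 gs; apply: relc_ind => //.
  move=> x0; have e20 : 0 < e / 2 by rewrite divr_gt0.
  exists [set x | nc (g x - g x0) < e / 2].
    exact: (contE cg).
  move=> D rD DU; exists 1, (fun=> D); split => //.
  - by case: rD.
  - by move=> _ x.
  - by move=> i j; rewrite (ord1 i) (ord1 j).
  rewrite big_ord1.
  have -> : cm_int mu D g = cm_int mu D (fun x => g x - g x0) + g x0 * cm_val mu D.
    rewrite -cm_int1 -?cm_int_cst//; last by case: rD.
    rewrite -cm_intD//; last 2 first.
    - by apply: (ccontB cg); exact: ccont_cst.
    - exact: ccont_cst.
    by apply: eq_cm_int => x _; rewrite subrK.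
  apply: le_trans (le_normcD _ _) _; rewrite addrC lerD//.
    by rewrite Normc.normcM ler_wpM2r ?nc_ge0.
  have -> : e = 2 * (e / 2) by field.
  apply: cm_int_bound => //; first by apply: (ccontB cg); exact: ccont_cst.
  by move=> x /DU /ltW.
move=> A B rA rB AB0 [n [F [mF FA tF hF]]] [p [H [mH HB tH hH]]].
pose FH (i : 'I_(n + p)) := match fintype.split i with inl a => F a | inr b => H b end.
exists (n + p)%N, FH; split.
- by move=> i; rewrite /FH; case: fintype.split.
- by move=> i x; rewrite /FH; case: fintype.split => j Fjx;
    [left; exact: FA Fjx|right; exact: HB Fjx].
- move=> i j _ _; rewrite /FH -{2}(fintype.splitK i) -{2}(fintype.splitK j).
  case: (fintype.split i) => a; case: (fintype.split j) => b /= => -[x [xa xb]].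
  + by congr lshift; apply: tF => //; exists x.
  + have : (A `&` B) x by split; [exact: FA xa|exact: HB xb].
    by rewrite AB0.
  + have : (A `&` B) x by split; [exact: FA xb|exact: HB xa].
    by rewrite AB0.
  + by congr rshift; apply: tH => //; exists x.
have -> : \sum_(i < n + p) nc (cm_val mu (FH i)) =
    \sum_(i < n) nc (cm_val mu (F i)) + \sum_(i < p) nc (cm_val mu (H i)).
  rewrite big_split_ord; congr (_ + _); apply: eq_bigr => i _; rewrite /FH.
    by have -> : fintype.split (lshift p i) = inl i
      by exact: (fintype.unsplitK (inl i)).
  by have -> : fintype.split (rshift n i) = inr i
    by exact: (fintype.unsplitK (inr i)).
rewrite cm_int_setU// cm_massU//.
apply: le_trans (le_normcD _ _) _; apply: le_trans (lerD hF hH) _.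
by rewrite !mulrDr addrACA.
Qed.

Lemma translation_bounded_tb mu : translation_bounded mu -> tb_fun mu.
Proof.
move=> tmu K cK; have := tmu K cK.
set V := ereal_sup _ => Voo.
have hV t : (cm_variation mu [set (t + x)%R | x in K] <= V)%E.
  by apply: ereal_sup_ubound; exists t.
exists (fine V).
  (* The empty family shows that the supremum is nonnegative. *)
  apply: fine_ge0; apply: le_trans (hV 0); apply: ereal_sup_ubound.
  exists 0%N, (fun=> set0); split => //; last by rewrite big_ord0.
  - by case.
  - by move=> [].
move=> t g s cg g0 gs; pose S := [set t + x | x in K].
have rS : relc S by apply: relc_compact => //; exact: compact_shift.
rewrite (@cm_int_compact _ S); last first.
  by move=> x nS; apply: g0 => Kx; apply: nS; exists (x - t) => //; rewrite addrC subrK.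
apply/ler_addgt0Pr => e e0.
have s0 : 0 <= s by apply: le_trans (gs 0); exact: nc_ge0.
have M0 : 0 < cm_mass mu S + 1 by rewrite ltr_wpDl// cm_mass_ge0.
(* The partition error is scaled by the mass of this one translate, so that the mass does not enter
   the constant. *)
have eM0 : 0 < e / (cm_mass mu S + 1) by rewrite divr_gt0.
have [n [F [mF FS tF]]] := cm_int_partition mu cg eM0 gs rS.
move/le_trans; apply; apply: lerD; last first.
  by rewrite mulrAC ler_pdivrMr// ler_wpM2l ?lerDl// ltW.
rewrite mulrC ler_wpM2r// -lee_fin fineK; last first.
  rewrite ge0_fin_numE//; apply: le_trans (hV 0); apply: ereal_sup_ubound.
  exists 0%N, (fun=> set0); split => //; last by rewrite big_ord0.
  - by case.
  - by move=> [].
apply: le_trans (hV t); apply: ereal_sup_ubound.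
exists n, F; split => // i; split => //.
by apply: precompact_subset (FS i) _; apply: compact_precompact => //; exact: compact_shift.
Qed.

Lemma inner_approx m D (e : R) : open D -> relc D -> 0 < e ->
  exists2 K, compact K & K `<=` D /\ fine (m (D `\` K)) <= e.
Proof.
move=> oD rD e0; have fD : m D \is a fin_num by exact: relc_fin_num.
have := radon_inner (radonP m) oD => mD.
have : ereal_sup [set m K | K in [set K | compact K /\ K `<=` D]] \is a fin_num.
  by rewrite -mD.
move=> /(ub_ereal_sup_adherent e0)[_ [K [cK KD] <-]]; rewrite -mD => h.
have rK : relc K by exact: relc_compact.
exists K => //; split => //.
have rDK : relc (D `\` K).
  by apply: (relc_sub rD) => //; apply: measurableD; [case: rD|case: rK].
have DE : fine (m D) = fine (m K) + fine (m (D `\` K)).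
  rewrite -fine_measureU ?setDUK//.
  by rewrite setIC setDKI.
move: h; rewrite -(fineK fD) -(fineK (relc_fin_num G_hd m rK)) -EFinB lte_fin.
by rewrite DE; lra.
Qed.

Lemma cm_inner_approx mu D (e : R) : open D -> relc D -> 0 < e ->
  exists2 K, compact K & K `<=` D /\ cm_mass mu (D `\` K) <= e.
Proof.
move=> oD rD e0; have e40 : 0 < e / 4 by rewrite divr_gt0.
have [K1 c1 [s1 h1]] := inner_approx (re_pos mu) oD rD e40.
have [K2 c2 [s2 h2]] := inner_approx (re_neg mu) oD rD e40.
have [K3 c3 [s3 h3]] := inner_approx (im_pos mu) oD rD e40.
have [K4 c4 [s4 h4]] := inner_approx (im_neg mu) oD rD e40.
have mono m K L (c : R) : compact K -> compact L -> K `<=` L ->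
    fine (m (D `\` K)) <= c -> fine (m (D `\` L)) <= c.
  move=> cK cL KL; apply: le_trans; apply: le_fine_measure => //.
  - apply: (relc_sub rD) => //; apply: measurableD; first by case: rD.
    exact: measurable_compact.
  - by apply: measurableD; [case: rD|exact: measurable_compact].
  - exact: setDS.
have cK : compact (K1 `|` K2 `|` (K3 `|` K4)) by do !apply: compactU.
exists (K1 `|` K2 `|` (K3 `|` K4)) => //; split.
  by move=> x [[/s1|/s2]|[/s3|/s4]].
have -> : e = e / 4 + e / 4 + (e / 4 + e / 4) by field.
rewrite /cm_mass !lerD//.
- by apply: mono h1 => // x; left; left.
- by apply: mono h2 => // x; left; right.
- by apply: mono h3 => // x; right; left.
- by apply: mono h4 => // x; right; right.
Qed.

(** Restriction to an open set keeps the constant: multiplying [g] by a Urysohn function that is 1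
    on a compact [L] inside [D] and vanishes off [D] gives a test function for [mu] itself, and [D]
    minus [L] carries arbitrarily little mass. With [D] equal to [A n] the bounds do not depend on
    [n]. *)
Lemma tb_open mu K C D : tb_on mu K C -> open D -> relc D ->
  forall (t : G) g (s : R), cont g ->
    (forall x, ~ K (x - t) -> g x = 0) -> (forall x, nc (g x) <= s) ->
    nc (cm_int mu D g) <= C * s.
Proof.
move=> tmu oD rD t g s cg g0 gs.
have s0 : 0 <= s by apply: le_trans (gs 0); exact: nc_ge0.
apply/ler_addgt0Pr => e e0.
have M0 : 0 < 2 * s + 1 by rewrite ltr_wpDl// mulr_ge0.
have eM0 : 0 < e / (2 * s + 1) by rewrite divr_gt0.
have [L cL [LD hL]] := cm_inner_approx mu oD rD eM0.
have [h [ch h01 h1 h0 _]] := urysohn_compact R G_lc G_hd cL oD LD.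
pose gh x := g x * (h x)%:C.
have cgh : cont gh by apply: (ccontM cg); exact: ccont_R.
have ghs x : nc (gh x) <= s.
  rewrite Normc.normcM ncR ger0_norm; last by case/andP: (h01 x).
  apply: le_trans (gs x); rewrite ler_piMr ?nc_ge0//.
  by case/andP: (h01 x).
have gh0 x : ~ K (x - t) -> gh x = 0 by move=> /g0; rewrite /gh => ->; rewrite mul0r.
have := tmu t gh s cgh gh0 ghs.
rewrite (@cm_int_compact _ D); last by move=> x /h0; rewrite /gh => ->; rewrite mulr0.
move=> b; apply: le_trans (nc_le_sub _ (cm_int mu D gh)) _.
rewrite addrC; apply: lerD => //.
rewrite -cm_intB// (@cm_int_mkcond _ _ _ (D `\` L)); last 2 first.
- by move=> x [].
- move=> x Dx nDL; have /h1 : L x by apply: contrapT => nL; apply: nDL.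
  by rewrite /gh => ->; rewrite mulr1 subrr.
have rDL : relc (D `\` L).
  apply: (relc_sub rD) => //; apply: measurableD; first by case: rD.
  exact: measurable_compact.
have /le_trans : nc (cm_int mu (D `\` L) (fun x => g x - gh x)) <=
    2 * s * cm_mass mu (D `\` L).
  apply: cm_int_bound; [by []|by []|exact: (ccontB cg cgh)|move=> x _].
  rewrite /gh -[X in X - _]mulr1 -mulrBr Normc.normcM.
  apply: le_trans (gs x); rewrite ler_piMr ?nc_ge0//.
  have /andP[ha hb] := h01 x.
  by rewrite -(rmorph1 (real_complex R)) -rmorphB ncR ger0_norm; lra.
apply.
apply: le_trans (ler_wpM2l _ hL) _; first by rewrite mulr_ge0.
have -> : 2 * s * (e / (2 * s + 1)) = e * (2 * s) / (2 * s + 1) by ring.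
by rewrite ler_pdivrMr// ler_pM2l// lerDl.
Qed.

End TranslationBounded.

(** * Haar measure and van Hove sequences *)

Section HaarVanHove.
Variables (R : realType) (G : topologicalZmodType).
Hypothesis G_hd : hausdorff_space G.
Variable haar : radon R G.
Hypothesis haarP : is_haar haar.
Implicit Types (mu nu : cmeasure R G) (D E K U : set G).
Implicit Types (f g : G -> R[i]).

Lemma haar_shift (a : G) D : measurable (D : set (borel G)) ->
  haar [set x | D (x + a)] = haar D.
Proof.
move=> mD; rewrite -(haarP.2 (- a) D mD); congr (haar _).
apply/seteqP; split=> [x /= Dxa|_ [y Dy <-] /=].
  by exists (x + a) => //; rewrite addrC addrK.
by rewrite addrC addrA subrr add0r.
Qed.

Lemma contG_shift (a : G) : continuous (fun x : G => x + a).
Proof. by apply: contG_add; [exact: contG_id|exact: contG_cst]. Qed.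

Lemma contG_mirror (a : G) : continuous (fun x : G => a - x).
Proof. by apply: contG_sub; [exact: contG_cst|exact: contG_id]. Qed.

Lemma measurable_shift (a : G) :
  measurable_fun setT ((fun x : G => x + a) : borel G -> borel G).
Proof.
apply: (measurability (@open G : set (set (borel G)))) => // _ [U oU <-].
by rewrite setTI; apply: sub_sigma_algebra; exact: open_shift.
Qed.

Lemma relc_shift (a : G) D : relc D -> relc [set x | D (x + a)].
Proof.
move=> [mD [K cK DK]]; split.
  by rewrite -[X in measurable X]setTI; exact: measurable_shift.
exists [set - a + x | x in K]; first exact: compact_shift.
by move=> x /= /DK Kxa; exists (x + a) => //; rewrite addrC addrK.
Qed.

Lemma Rintegral_shift (a : G) D (f : G -> R) : relc D -> rcont f ->
  \int[haar]_(x in [set x | D (x + a)]) f (x + a) = \int[haar]_(x in D) f x.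
Proof.
move=> rD cf; have [mD _] := rD; rewrite /Rintegral; congr fine.
pose phi : borel G -> borel G := fun x : G => x + a.
have mphi : measurable_fun setT phi := @measurable_shift a.
have cphi : rcont (fun x => f (x + a)) := rcont_comp (@contG_shift a) cf.
have mE : measurable_fun setT ((EFin \o f) : borel G -> \bar R).
  by apply/measurable_EFinP; exact: continuous_measurable.
have iphi : haar.-integrable (phi @^-1` D) ((EFin \o f) \o phi).
  have := @continuous_integrable R G G_hd haar _ _ (relc_shift a rD) cphi.
  by [].
have := @integral_pushforward _ _ _ _ _ phi mphi haar D _ mE iphi mD.
move=> <-; apply: (@eq_measure_integral _ _ _ _ haar) => B mB _.
by rewrite /pushforward; exact: haar_shift.
Qed.

Local Notation hint := (cm_int (cm_of_radon haar)).

Lemma hint_shift (a : G) D f : relc D -> cont f ->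
  hint [set x | D (x + a)] (fun x => f (x + a)) = hint D f.
Proof.
move=> rD cf; rewrite !cm_of_radonE /cint.
by rewrite (Rintegral_shift a rD (ccont_Re cf)) (Rintegral_shift a rD (ccont_Im cf)).
Qed.

Lemma cint_conj (m : radon R G) D f : relc D -> cont f ->
  cint m D (fun x => (cj (f x))) = (cj (cint m D f)).
Proof.
move=> rD cf; rewrite /cint; congr (_ +i* _).
  by congr (Rintegral _ _ _); apply/funext => x; case: (f x).
rewrite -mulN1r -(RintegralZ_relc G_hd m _ rD (ccont_Im cf)).
by congr (Rintegral _ _ _); apply/funext => x; case: (f x) => u v /=; rewrite mulN1r.
Qed.

Lemma hint_conj D f : relc D -> cont f ->
  hint D (fun x => (cj (f x))) = (cj (hint D f)).
Proof. by move=> rD cf; rewrite !cm_of_radonE; exact: cint_conj. Qed.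

Lemma cm_mass_haar D : cm_mass (cm_of_radon haar) D = fine (haar D).
Proof. by rewrite /cm_mass /= /mzero !addr0. Qed.

Lemma hint_bound D f (s : R) : relc D -> cont f ->
  (forall x, D x -> nc (f x) <= s) -> nc (hint D f) <= 2 * s * fine (haar D).
Proof. by move=> rD cf fs; rewrite -cm_mass_haar; exact: cm_int_bound. Qed.

Lemma hint_nc D f : relc D -> cont f ->
  nc (hint D f) <= 2 * \int[haar]_(x in D) nc (f x).
Proof.
move=> rD cf; have [mD _] := rD; rewrite cm_of_radonE.
apply: le_trans (nc_ReIm _) _; rewrite mulr_natl mulr2n.
have part (h : G -> R) : rcont h -> (forall x, `|h x| <= nc (f x)) ->
    `|\int[haar]_(x in D) h x| <= \int[haar]_(x in D) nc (f x).
  move=> ch hf; apply: le_trans (le_normr_Rintegral mD _) _.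
    exact: continuous_integrable.
  by apply: le_Rintegral_relc => //; [exact: (rcont_norm ch)|exact: (ccont_nc cf)].
apply: lerD; apply: part.
- exact: (ccont_Re cf).
- by move=> x; exact: nc_Re.
- exact: (ccont_Im cf).
- by move=> x; exact: nc_Im.
Qed.

(** The common form of all boundary errors, with [B] a van Hove boundary: off [B] domains and
    integrands agree, and on [B] each of the two integrals is bounded by [hint_bound]. *)
Lemma hint_diff D E B f g (C : R) : relc D -> relc E -> relc B ->
  D `\` B = E `\` B -> cont f -> cont g ->
  (forall x, E x -> ~ B x -> f x = g x) ->
  (forall x, D x -> nc (f x) <= C) -> (forall x, E x -> nc (g x) <= C) ->
  0 <= C ->
  nc (hint D f - hint E g) <= 4 * C * fine (haar B).
Proof.
move=> rD rE rB DEB cf cg fg fC gC C0.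
have [mD _] := rD; have [mE _] := rE; have [mB _] := rB.
have rDB : relc (D `&` B).
  by apply: (relc_sub rD); [exact: measurableI|exact: subIsetl].
have rEB : relc (E `&` B).
  by apply: (relc_sub rE); [exact: measurableI|exact: subIsetl].
have rDB' : relc (D `\` B).
  by apply: (relc_sub rD); [exact: measurableD|exact: subDsetl].
have rEB' : relc (E `\` B).
  by apply: (relc_sub rE); [exact: measurableD|exact: subDsetl].
have IE (X : set G) : (X `&` B) `&` (X `\` B) = set0.
  by rewrite setDE setIACA setICr setI0.
rewrite -{1}(setUIDK D B) -{1}(setUIDK E B).
rewrite (cm_int_setU G_hd _ rDB rDB' (IE D) cf).
rewrite (cm_int_setU G_hd _ rEB rEB' (IE E) cg) DEB.
have -> : hint (E `\` B) f = hint (E `\` B) g.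
  by apply: eq_cm_int => x [Ex nBx]; exact: fg.
rewrite opprD addrACA subrr addr0.
apply: le_trans (ncB _ _) _.
have b1 : nc (hint (D `&` B) f) <= 2 * C * fine (haar B).
  apply: le_trans (hint_bound rDB cf (fun x Dx => fC x Dx.1)) _.
  rewrite ler_wpM2l ?mulr_ge0//.
  by apply: le_fine_measure => //; case: rDB.
have b2 : nc (hint (E `&` B) g) <= 2 * C * fine (haar B).
  apply: le_trans (hint_bound rEB cg (fun x Dx => gC x Dx.1)) _.
  rewrite ler_wpM2l ?mulr_ge0//.
  by apply: le_fine_measure => //; case: rEB.
by apply: le_trans (lerD b1 b2) _; rewrite -!mulrA -mulrDl; lra.
Qed.

Variable A : nat -> set G.
Hypothesis A_vh : van_hove haar A.

Lemma vh_open n : open (A n).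
Proof. by have [h _ _] := A_vh; case: (h n). Qed.

Lemma vh_relc n : relc (A n).
Proof.
have [h _ _] := A_vh; have [oA pA] := h n.
exact: relc_open.
Qed.

Lemma vol_gt0 n : 0 < vol haar (A n).
Proof.
have [_ h _] := A_vh; rewrite /vol fine_gt0// h/=.
exact: relc_finite (vh_relc n).
Qed.

Definition bnd K n : set G := vh_boundary K (A n).

Lemma bnd_relc K n : compact K -> relc (bnd K n).
Proof.
move=> cK; have [h _ _] := A_vh; have [oA pA] := h n.
have cA : compact (closure (A n)) by rewrite -precompactE.
have rA : relc (closure (A n)) by exact: relc_compact.
apply: relcU.
  have sub : closure [set a + k | a in A n & k in K] `<=`
      sumset (closure (A n)) K.
    rewrite [X in _ `<=` X](closure_id _).1.
      apply: closureS => _ [a Aa [k Kk] <-]; exists a; last by exists k.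
      exact: subset_closure.
    by apply: compact_closed => //; exact: compact_sumset.
  split.
    apply: measurableD; last exact: measurable_open.
    by apply: measurable_closed; exact: closed_closure.
  exists (sumset (closure (A n)) K); first exact: compact_sumset.
  by move=> x [/sub].
apply: (relc_sub rA); last exact: subIsetr.
apply: measurableI; last by case: rA.
apply: measurable_closed.
have -> : [set b - k | b in ~` A n & k in K] = sumset (~` A n) [set - k | k in K].
  apply/seteqP; split=> [_ [b Ab [k Kk] <-]|_ [b Ab [_ [k Kk <-]] <-]].
    by exists b => //; exists (- k) => //; exists k.
  by exists b => //; exists k.
by apply: closed_sumset; [rewrite closedC|exact: compact_opp].
Qed.

Definition bndr K n : R := fine (haar (bnd K n)) / vol haar (A n).

Lemma bndr_ge0 K n : 0 <= bndr K n.
Proof. by rewrite divr_ge0 ?fine_ge0// ltW// vol_gt0. Qed.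

Lemma bndr_cvg K : compact K -> forall e : R, 0 < e ->
  \forall n \near \oo, bndr K n < e.
Proof.
move=> cK e e0; have [_ _ /(_ K cK)] := A_vh.
have -> : (fun n => (haar (vh_boundary K (A n)) * (vol haar (A n))^-1%:E)%E) =
    EFin \o (bndr K).
  apply/funext => n; rewrite /= /bndr EFinM fineK//.
  exact: relc_fin_num (bnd_relc n cK).
move=> /fine_cvgP [_ /(@cvgrPdist_lt _ R^o) /(_ _ e0)].
apply: filterS => n /=; rewrite sub0r normrN ger0_norm//.
exact: bndr_ge0.
Qed.

(** With 0 in [K] the set [A n] is part of [sumset (A n) K]; symmetry lets supports be reflected, as
    convolutions do. *)
Definition symk K := [/\ compact K, K 0 & forall x, K x -> K (- x)].

Lemma symk_hull K : compact K -> exists2 L, symk L & K `<=` L.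
Proof.
move=> cK; exists ((K `|` [set - x | x in K]) `|` [set 0]).
  split.
  - apply: compactU; last exact: compact_set1.
    by apply: compactU => //; exact: compact_opp.
  - by right.
  - move=> x [[Kx|[y Ky <-]]|->].
    + by left; right; exists x.
    + by left; left; rewrite opprK.
    + by right; rewrite /= oppr0.
by move=> x Kx; left; left.
Qed.

(** A point of [A n] off the boundary keeps its [K]-neighbourhood in [A n]; this uses the half of
    the boundary inside the closure of [A n]. The other half, outside [A n], serves [sumset_bnd]. *)
Lemma vh_sub K n t k : symk K -> A n t -> ~ bnd K n t -> K k -> A n (t - k).
Proof.
move=> [_ _ sK] At nB Kk; apply: contrapT => nA; apply: nB; right.
split; last exact: subset_closure.
exists (t - k) => //; exists (- k); first exact: sK.
by rewrite opprK subrK.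
Qed.

Lemma sumset_relc K n : compact K -> relc (sumset (A n) K).
Proof.
move=> cK; have [h _ _] := A_vh; have [oA pA] := h n.
split; first by apply: measurable_open; exact: open_sumset.
exists (sumset (closure (A n)) K).
  by apply: compact_sumset => //; rewrite -precompactE.
by move=> _ [a Aa [k Kk] <-]; exists a; [exact: subset_closure|exists k].
Qed.

Lemma sub_sumset K n : K 0 -> A n `<=` sumset (A n) K.
Proof. by move=> K0 a Aa; exists a => //; exists 0 => //; rewrite addr0. Qed.

Lemma sumset_bnd K n : symk K ->
  sumset (A n) K `\` bnd K n = A n `\` bnd K n.
Proof.
move=> [_ K0 _]; apply/seteqP; split=> x [h nB]; split => //.
  apply: contrapT => nA; apply: nB; left; split => //.
  exact: subset_closure.
exact: sub_sumset.
Qed.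

Lemma shift_bnd K n a : symk K -> K a ->
  [set x | A n (x + a)] `\` bnd K n = A n `\` bnd K n.
Proof.
move=> sK Ka; have [_ _ oK] := sK; apply/seteqP; split=> x [/= h nB]; split => //.
  apply: contrapT => nA; apply: nB; left; split => //.
  apply: subset_closure; exists (x + a) => //; exists (- a); first exact: oK.
  by rewrite addrK.
by rewrite -[a]opprK; apply: vh_sub nB (oK _ Ka).
Qed.

End HaarVanHove.

(** * Bump functions and convolutions *)

Section CompactSupport.
Variables (R : realType) (G : topologicalZmodType).
Hypothesis G_hd : hausdorff_space G.

Lemma Cc_cont (f : G -> R[i]) : Cc f ->
  cont f /\ exists2 K, compact K & forall x, ~ K x -> f x = 0.
Proof.
move=> [cf ck]; split; first exact/contP.
exists (closure [set x | f x != 0]) => // x nx; apply/eqP/negPn/negP => fx.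
by apply: nx; exact: subset_closure.
Qed.

Lemma cont_Cc (f : G -> R[i]) (K : set G) : cont f -> compact K ->
  (forall x, ~ K x -> f x = 0) -> Cc f.
Proof.
move=> cf cK f0; split; first exact/contP.
apply: (subclosed_compact _ cK); first exact: closed_closure.
rewrite [X in _ `<=` X](closure_id _).1; last exact: compact_closed.
by apply: closureS => x /= fx; apply: contrapT => /f0 /eqP; apply/negP.
Qed.

Lemma cont_mirror (f : G -> R[i]) (a : G) : cont f -> cont (fun x => f (a - x)).
Proof. by apply: ccont_comp; exact: contG_mirror. Qed.

Lemma cont_sub21 (f : G -> R[i]) : cont f -> cont (fun p : G * G => f (p.2 - p.1)).
Proof.
apply: (ccont_comp (g := fun p : G * G => p.2 - p.1)).
by apply: contG_sub; [exact: contG_snd|exact: contG_fst].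
Qed.

Lemma cont_sub12 (f : G -> R[i]) : cont f -> cont (fun p : G * G => f (p.1 - p.2)).
Proof.
apply: (ccont_comp (g := fun p : G * G => p.1 - p.2)).
by apply: contG_sub; [exact: contG_fst|exact: contG_snd].
Qed.

Lemma cont_fst (f : G -> R[i]) : cont f -> cont (fun p : G * G => f p.1).
Proof. by apply: (ccont_comp (g := fun p : G * G => p.1)); exact: contG_fst. Qed.

Lemma cont_snd (f : G -> R[i]) : cont f -> cont (fun p : G * G => f p.2).
Proof. by apply: (ccont_comp (g := fun p : G * G => p.2)); exact: contG_snd. Qed.

Lemma conjCM (a b : R[i]) : (cj (a * b)) = (cj a) * (cj b).
Proof. exact: rmorphM. Qed.

End CompactSupport.

(** * Symmetric bumps at 0 with positive integral *)

Section HaarBump.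
Variables (R : realType) (G : topologicalZmodType).
Hypothesis G_lc : locally_compact [set: G].
Hypothesis G_hd : hausdorff_space G.
Variable haar : radon R G.
Hypothesis haarP : is_haar haar.
Variable A : nat -> set G.
Hypothesis A_vh : van_hove haar A.
Local Notation hint := (cm_int (cm_of_radon haar)).

(** If [U] were null, finitely many null translates of it would cover the compact closure of [A 0],
    which has positive measure. *)
Lemma haar_open_gt0 (U : set G) (x0 : G) : open U -> relc U -> U x0 ->
  0 < fine (haar U).
Proof.
move=> oU rU Ux0; rewrite lt_neqAle fine_ge0// andbT eq_sym; apply/negP => /eqP U0.
have hU0 : haar U = 0%E by rewrite -(fineK (relc_fin_num G_hd haar rU)) U0.
have [h hA _] := A_vh; have [oA pA] := h 0%N.
have cA : compact (closure (A 0%N)) by rewrite -precompactE.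
have [S [mS AS S0]] : exists S : set G, [/\ measurable (S : set (borel G)),
    closure (A 0%N) `<=` S & haar S = 0%E].
  apply: (@compact_ind _ _ (fun T => exists S : set G,
    [/\ measurable (S : set (borel G)), T `<=` S & haar S = 0%E]) _ _ _ cA).
  - by exists set0; split => //; rewrite measure0.
  - by move=> B C BC [S [mS CS S0]]; exists S; split => //; exact: subset_trans CS.
  - move=> B C [S [mS BS S0]] [T [mT CT T0]]; exists (S `|` T); split.
    + exact: measurableU.
    + exact: setUSS.
    + apply/eqP; rewrite eq_le measure_ge0 andbT.
      have : (haar (S `|` T) <= haar S + haar T)%E by exact: measureU2.
      by rewrite S0 T0 adde0.
  - move=> x _; have oV := open_shift (x0 - x) oU.
    exists [set y | U (y + (x0 - x))].
      by apply: open_nbhs_nbhs; split => //=; rewrite addrC subrK.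
    exists [set y | U (y + (x0 - x))]; split => //.
      exact: measurable_open.
    rewrite (haar_shift haarP)//; exact: measurable_open.
have := hA 0%N; rewrite lt_neqAle => /andP[/eqP ne _]; apply: ne.
apply/eqP; rewrite eq_le measure_ge0 /= -S0 le_measure ?inE//.
  exact: measurable_open.
by move=> x Ax; apply: AS; exact: subset_closure.
Qed.

Lemma bump_exists (U : set G) : nbhs 0 U ->
  exists (b : G -> R) (K : set G),
    [/\ rcont b, forall x, 0 <= b x <= 1, forall x, b (- x) = b x,
        symk K & [/\ (forall x, ~ U x -> b x = 0), (forall x, ~ K x -> b x = 0) &
        exists2 c : R, 0 < c & hint K (fun x => (b x)%:C) = c%:C]].
Proof.
rewrite nbhsE => -[V [oV V0] VU].
have c0 : compact [set (0 : G)] by exact: compact_set1.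
have V0' : [set (0 : G)] `<=` V by move=> _ ->.
have [f [cf f01 f1 f0 cS]] := urysohn_compact R G_lc G_hd c0 oV V0'.
have [K sK SK] := symk_hull cS; have [cK K0 oK] := sK.
(* The product with the reflection is symmetric and still equals 1 at 0. *)
pose b x := f x * f (- x).
have cb : rcont b.
  apply: (rcontM cf); apply: (rcont_comp (g := fun x : G => - x)) cf.
  exact: opp_continuous.
have b01 x : 0 <= b x <= 1.
  have /andP[p1 p2] := f01 x; have /andP[q1 q2] := f01 (- x).
  by rewrite mulr_ge0//= mulr_ile1.
have bs x : b (- x) = b x by rewrite /b opprK mulrC.
have fK x : ~ K x -> f x = 0.
  move=> nK; apply/eqP/negPn/negP => fx; apply: nK; apply: SK.
  exact: subset_closure.
have bK x : ~ K x -> b x = 0 by move=> /fK; rewrite /b => ->; rewrite mul0r.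
exists b, K; split => //; split => //.
  by move=> x nU; rewrite /b f0 ?mul0r// => /VU.
exists (\int[haar]_(x in K) b x); last first.
  rewrite cm_of_radonE /cint; congr (_ +i* _).
  rewrite /Rintegral (eq_integral (cst 0%E)) ?integral0//.
have rK : relc K by exact: relc_compact.
(* The integral is positive because it is at least half the measure of this open neighbourhood of
   0. *)
pose V' : set G := [set x | 2^-1 < b x].
have oV' : open V'.
  have [cb'] := cb.
  have -> : V' = b @^-1` [set y | 2^-1 < y] by [].
  by apply: open_comp => [x _|]; [exact: cb'|exact: open_gt].
have V'K : V' `<=` K.
  move=> x /= hx; apply: contrapT => /bK b0; move: hx; rewrite /V' /= b0.
  by rewrite ltNge invr_ge0 ler0n.
have rV' : relc V' by apply: (relc_sub rK) => //; exact: measurable_open.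
have V'0 : V' 0.
  rewrite /V' /= /b oppr0 f1// mulr1 invf_lt1 ?ltr1n//.
have hV' := haar_open_gt0 oV' rV' V'0.
have rD : relc (K `\` V').
  by apply: (relc_sub rK); [apply: measurableD; [case: rK|case: rV']|exact: subDsetl].
have -> : \int[haar]_(x in K) b x =
    \int[haar]_(x in V') b x + \int[haar]_(x in K `\` V') b x.
  rewrite -Rintegral_setU.
  - by rewrite setDUK.
  - by case: rV'.
  - by case: rD.
  - by rewrite setDUK//; exact: continuous_integrable.
  - by apply/eqP; rewrite setIC setDKI.
apply: (@lt_le_trans _ _ (2^-1 * fine (haar V'))).
  by rewrite mulr_gt0// invr_gt0.
rewrite -[leLHS]addr0 lerD//; last first.
  by apply: Rintegral_ge0 => x _; case/andP: (b01 x).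
have <- : \int[haar]_(x in V') 2^-1 = 2^-1 * fine (haar V').
  by rewrite Rintegral_cst//; case: rV'.
apply: le_Rintegral_relc => //; first exact: rcont_cst.
by move=> x /ltW.
Qed.

End HaarBump.

(** * Exchange of smearing and restriction *)

Section ConvolutionEstimates.
Variables (R : realType) (G : topologicalZmodType).
Hypothesis G_lc : locally_compact [set: G].
Hypothesis G_hd : hausdorff_space G.
Variable haar : radon R G.
Variable A : nat -> set G.
Hypothesis A_vh : van_hove haar A.
Implicit Types (mu nu : cmeasure R G) (K D : set G) (phi psi f w : G -> R[i]).
Local Notation hint := (cm_int (cm_of_radon haar)).
Local Notation bnd := (bnd A).

Definition conv_on mu D phi (t : G) : R[i] := cm_int mu D (fun x => phi (t - x)).

Lemma conv_on_cont mu D phi : relc D -> cont phi -> cont (conv_on mu D phi).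
Proof.
move=> rD cphi.
exact: (@cm_int_param_cont R G G_hd mu D G (fun p => phi (p.1 - p.2)) rD
  (cont_sub12 cphi)).
Qed.

(** The integral over all of [G] is not one over a relatively compact set; for [s] near [t],
    however, it reduces to the integral over one compact [L], where continuity in the parameter is
    known. *)
Lemma conv_fun_cont mu K phi : cont phi -> compact K ->
  (forall x, ~ K x -> phi x = 0) -> cont (conv_fun mu phi).
Proof.
move=> cphi cK phi0; split => t e e0.
have [U [oU pU] Ut] := precompact_nbhs G_lc t.
pose L := sumset (closure U) [set - x | x in K].
have cL : compact L.
  by apply: compact_sumset; [rewrite -precompactE|exact: compact_opp].
have eqf s : U s -> conv_fun mu phi s = conv_on mu L phi s.
  move=> Us; rewrite /conv_fun /conv_on; apply: cm_int_compact => x nL.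
  apply: phi0 => Ksx; apply: nL; exists s; first exact: subset_closure.
  by exists (x - s); [exists (s - x) => //; rewrite opprB|rewrite addrC subrK].
have [cc] := conv_on_cont mu (relc_compact G_hd cL) cphi.
have nU : nbhs t U by apply: open_nbhs_nbhs.
by apply: filterS2 nU (cc t e e0) => s Us; rewrite !eqf.
Qed.

Lemma symk_sub K (x y : G) : symk K -> K (x - y) -> K (y - x).
Proof. by move=> [_ _ oK] /oK; rewrite opprB. Qed.

Lemma conv_fun_bound mu K C phi (s : R) : symk K -> tb_on mu K C -> cont phi ->
  (forall x, ~ K x -> phi x = 0) -> (forall x, nc (phi x) <= s) ->
  forall t, nc (conv_fun mu phi t) <= C * s.
Proof.
move=> sK tmu cphi phi0 phis t; apply: (tmu t) => //; first exact: cont_mirror.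
by move=> x nK; apply: phi0 => h; apply: nK; exact: symk_sub h.
Qed.

Lemma conv_on_bound mu K C n phi (s : R) : symk K -> tb_on mu K C -> cont phi ->
  (forall x, ~ K x -> phi x = 0) -> (forall x, nc (phi x) <= s) ->
  forall t, nc (conv_on mu (A n) phi t) <= C * s.
Proof.
move=> sK tmu cphi phi0 phis t.
rewrite /conv_on.
apply: (tb_open G_lc G_hd tmu (vh_open A_vh n) (vh_relc A_vh n) (t := t)) => //.
  exact: cont_mirror.
by move=> x nK; apply: phi0 => h; apply: nK; exact: symk_sub h.
Qed.

Lemma conv_on_inside mu K n phi t : symk K -> (forall x, ~ K x -> phi x = 0) ->
  A n t -> ~ bnd K n t -> conv_on mu (A n) phi t = conv_fun mu phi t.
Proof.
move=> sK phi0 At nB; rewrite /conv_fun /conv_on; apply/esym.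
apply: cm_int_compact => x nA; apply: phi0 => Ktx; apply: nA.
by rewrite -[x](subKr t); exact: vh_sub Ktx.
Qed.

Lemma mass_constant_ge0 mu K C (s : R) (phi : G -> R[i]) : tb_on mu K C ->
  0 <= C -> (forall x : G, nc (phi x) <= s) -> 0 <= C * s.
Proof. by move=> _ C0 h; rewrite mulr_ge0// (le_trans _ (h 0))// nc_ge0. Qed.

(** By Fubini the first term integrates the convolution of the restricted [mu] with [phi], times
    [w], over [sumset (A n) K]. Off the boundary this convolution is [conv_fun mu phi], and both are
    bounded by [C * s]. The weight [w] will be a conjugate character, or the conjugate of a smeared
    restriction of [nu]. *)
Lemma swap_estimate mu K C n phi w (s B : R) : symk K -> tb_on mu K C -> 0 <= C ->
  cont phi -> (forall x, ~ K x -> phi x = 0) -> (forall x, nc (phi x) <= s) ->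
  cont w -> (forall x, nc (w x) <= B) ->
  nc (cm_int mu (A n) (fun x => hint (sumset (A n) K) (fun t => phi (t - x) * w t))
    - hint (A n) (fun t => conv_fun mu phi t * w t)) <=
  4 * (C * s * B) * fine (haar (bnd K n)).
Proof.
move=> sK tmu C0 cphi phi0 phis cw wB; have [cK K0 _] := sK.
have rW := sumset_relc A_vh n cK; have rA := vh_relc A_vh n.
pose H (p : G * G) := phi (p.2 - p.1) * w p.2.
have cH : cont H := ccontM (cont_sub21 cphi) (cont_snd cw).
rewrite (cm_int_fubini G_hd mu (cm_of_radon haar) rA rW cH) /=.
have Cs0 := mass_constant_ge0 tmu C0 phis.
have B0 : 0 <= B by apply: le_trans (wB 0); exact: nc_ge0.
have -> : hint (sumset (A n) K) (fun y => cm_int mu (A n) (fun x => H (x, y))) =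
    hint (sumset (A n) K) (fun t => conv_on mu (A n) phi t * w t).
  apply: eq_cm_int => t _; rewrite mulrC -(cm_intZ G_hd mu _ rA (cont_mirror _ cphi)).
  by apply: eq_cm_int => x _; rewrite /H mulrC.
apply: hint_diff => //.
- exact: (bnd_relc G_hd A_vh n cK).
- exact: sumset_bnd.
- exact: ccontM (conv_on_cont mu rA cphi) cw.
- exact: ccontM (conv_fun_cont mu cphi cK phi0) cw.
- by move=> x Ax nB; rewrite (conv_on_inside mu sK phi0 Ax nB).
- move=> x _; rewrite Normc.normcM ler_pM ?nc_ge0//.
  exact: conv_on_bound sK tmu cphi phi0 phis x.
- move=> x _; rewrite Normc.normcM ler_pM ?nc_ge0//.
  exact: conv_fun_bound sK tmu cphi phi0 phis x.
- exact: mulr_ge0.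
Qed.

End ConvolutionEstimates.

(** * The twisted restricted convolution *)

Section TildeRestriction.
Variables (R : realType) (G : topologicalZmodType).
Hypothesis G_hd : hausdorff_space G.
Implicit Types (mu nu : cmeasure R G) (D : set G) (f g : G -> R[i]).

Lemma Rintegral_refl_on (m : radon R G) D (h : G -> R) :
  measurable (D : set (borel G)) -> rcont h ->
  \int[reflect_radon m]_(x in [set - x | x in D]) h x =
  \int[m]_(x in D) h (- x).
Proof.
move=> mD ch.
have DN x : [set - x | x in D] (- x) <-> D x.
  split; first by move=> [y Dy /oppr_inj <-].
  by move=> Dx; exists x.
have mDN : measurable ([set - x | x in D] : set (borel G)).
  have -> : [set - x | x in D] = [set x | D (- x)].
    apply/seteqP; split=> [_ [y Dy <-] /=|x /= Dx]; first by rewrite opprK.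
    by exists (- x) => //; rewrite opprK.
  rewrite -[X in measurable X]setTI.
  apply: (measurability (@open G : set (set (borel G)))) => // _ [U oU <-].
  rewrite setTI; apply: sub_sigma_algebra.
  by apply: open_comp => // x _; exact: opp_continuous.
rewrite Rintegral_mkcond Rintegral_refl; last first.
  by apply/(measurable_restrictT _ mDN); exact: continuous_measurable.
rewrite [RHS]Rintegral_mkcond; congr (Rintegral _ _ _); apply/funext => x.
rewrite !patchE; case: ifPn; case: ifPn => //; rewrite ?inE ?notin_setE.
- by move=> nD /DN.
- by move=> /DN.
Qed.

Lemma cm_int_tilde nu D g : relc D -> cont g ->
  cm_int (tilde nu) [set - x | x in D] g =
  (cj (cm_int nu D (fun z => (cj (g (- z)))))).
Proof.
move=> rD cg; have [mD _] := rD.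
have cgN : cont (fun z => g (- z)).
  by apply: (ccont_comp (g := fun x : G => - x)) cg; exact: opp_continuous.
have E (m : radon R G) : cint (reflect_radon m) [set - x | x in D] g =
    cint m D (fun z => g (- z)).
  rewrite /cint (Rintegral_refl_on m mD (ccont_Re cg)).
  by rewrite (Rintegral_refl_on m mD (ccont_Im cg)).
have E2 (m : radon R G) : cint m D (fun z => (cj (g (- z)))) =
    (cj (cint m D (fun z => g (- z)))) := cint_conj G_hd m rD cgN.
rewrite /cm_int /tilde; cbn [re_pos re_neg im_pos im_neg]; rewrite !E !E2.
by do ! case: (cint _ _ _) => ? ?; simpc; congr (_ +i* _); ring.
Qed.

(** The restricted convolution with [tilde nu] after the substitution [y = - z]: reflection and
    conjugation are carried out, and both measures live on the same set [D]. *)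
Definition twist mu nu D (phi : G -> R[i]) : R[i] :=
  cm_int mu D (fun x => (cj (cm_int nu D (fun z => (cj (phi (x - z))))))).

Lemma conv_restr_twist mu nu D phi : relc D -> cont phi ->
  conv_restr mu D (tilde nu) [set - x | x in D] phi = twist mu nu D phi.
Proof.
move=> rD cphi; apply: eq_cm_int => x _; rewrite cm_int_tilde//.
apply: (ccont_comp (g := fun y : G => x + y)) cphi.
by apply: contG_add; [exact: contG_cst|exact: contG_id].
Qed.

Lemma twist_inner_cont nu D phi : relc D -> cont phi ->
  cont (fun x => (cj (cm_int nu D (fun z => (cj (phi (x - z))))))).
Proof.
move=> rD cphi; apply: ccont_conj.
exact: (@cm_int_param_cont R G G_hd nu D G (fun p => (cj (phi (p.1 - p.2)))) rD
  (ccont_conj (cont_sub12 cphi))).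
Qed.

Lemma twistB mu nu D phi psi : relc D -> cont phi -> cont psi ->
  twist mu nu D (fun x => phi x - psi x) = twist mu nu D phi - twist mu nu D psi.
Proof.
move=> rD cphi cpsi.
rewrite /twist -(cm_intB G_hd mu rD (twist_inner_cont nu rD cphi)
  (twist_inner_cont nu rD cpsi)).
apply: eq_cm_int => x _; rewrite -rmorphB; congr conjc.
rewrite -(cm_intB G_hd nu rD (ccont_conj (cont_mirror x cphi))
  (ccont_conj (cont_mirror x cpsi))).
by apply: eq_cm_int => z _; rewrite rmorphB.
Qed.

Lemma twistD mu nu D phi psi : relc D -> cont phi -> cont psi ->
  twist mu nu D (fun x => phi x + psi x) = twist mu nu D phi + twist mu nu D psi.
Proof.
move=> rD cphi cpsi.
rewrite /twist -(cm_intD G_hd mu rD (twist_inner_cont nu rD cphi)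
  (twist_inner_cont nu rD cpsi)).
apply: eq_cm_int => x _; rewrite -rmorphD; congr conjc.
rewrite -(cm_intD G_hd nu rD (ccont_conj (cont_mirror x cphi))
  (ccont_conj (cont_mirror x cpsi))).
by apply: eq_cm_int => z _; rewrite rmorphD.
Qed.

Lemma twistZ mu nu D phi c : relc D -> cont phi ->
  twist mu nu D (fun x => c * phi x) = c * twist mu nu D phi.
Proof.
move=> rD cphi.
rewrite /twist -(cm_intZ G_hd mu c rD (twist_inner_cont nu rD cphi)).
apply: eq_cm_int => x _; cbv beta; rewrite -[c in RHS]conjcK -conjCM; congr conjc.
rewrite -(cm_intZ G_hd nu _ rD (ccont_conj (cont_mirror x cphi))).
by apply: eq_cm_int => z _; rewrite conjCM.
Qed.

End TildeRestriction.

(** * Estimates for the twisted convolution *)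

Section TwistEstimates.
Variables (R : realType) (G : topologicalZmodType).
Hypothesis G_lc : locally_compact [set: G].
Hypothesis G_hd : hausdorff_space G.
Variable haar : radon R G.
Hypothesis haarP : is_haar haar.
Variable A : nat -> set G.
Hypothesis A_vh : van_hove haar A.
Implicit Types (mu nu : cmeasure R G) (K D : set G) (phi psi f w : G -> R[i]).
Local Notation hint := (cm_int (cm_of_radon haar)).
Local Notation bnd := (bnd A).

(** Chosen so that at [u = x - z] the substitution of [t - x] for [t] separates the variables:
    [phi (t - x)] is integrated against [mu], the conjugate of [psi (t - z)] against the conjugate
    of [nu], and the smeared functions appear as a product in [t]. *)
Definition corr K phi psi (u : G) : R[i] :=
  hint K (fun t => phi t * (cj (psi (t + u)))).

Lemma corr_cont K phi psi : relc K -> cont phi -> cont psi ->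
  cont (corr K phi psi).
Proof.
move=> rK cphi cpsi.
apply: (@cm_int_param_cont R G G_hd (cm_of_radon haar) K G
  (fun p => phi p.2 * (cj (psi (p.2 + p.1)))) rK).
apply: (ccontM (cont_snd cphi)); apply: ccont_conj.
apply: (ccont_comp (g := fun p : G * G => p.2 + p.1)) cpsi.
by apply: contG_add; [exact: contG_snd|exact: contG_fst].
Qed.

(** Fubini needs one domain for all [x]; [sumset (A n) K] contains every translate of [K] by a point
    of [A n]. *)
Lemma corr_shift K n phi psi x z : symk K -> cont phi -> cont psi ->
  (forall x, ~ K x -> phi x = 0) -> A n x ->
  corr K phi psi (x - z) =
  hint (sumset (A n) K) (fun t => phi (t - x) * (cj (psi (t - z)))).
Proof.
move=> sK cphi cpsi phi0 Ax; have [cK K0 oK] := sK.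
rewrite /corr -(hint_shift G_hd haarP (- x) (relc_compact G_hd cK)); last first.
  apply: (ccontM cphi); apply: ccont_conj.
  by apply: (ccont_comp (g := fun t : G => t + (x - z))) cpsi; exact: contG_shift.
rewrite [RHS](@cm_int_mkcond _ _ _ [set t | K (t - x)]); last 2 first.
- by move=> t /= Ktx; exists x => //; exists (t - x) => //; rewrite addrC subrK.
- by move=> t _ nK; rewrite phi0// mul0r.
by apply: eq_cm_int => t _; rewrite addrA subrK.
Qed.

(** The two restrictions are removed one after the other: that of [mu] by [swap_estimate], with the
    restricted and smeared [nu] as weight, then that of [nu] by [hint_diff]. Each costs a factor
    4. *)
Lemma product_estimate mu nu K C C' n phi psi (s s' : R) : symk K ->
  tb_on mu K C -> 0 <= C -> tb_on nu K C' -> 0 <= C' ->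
  cont phi -> (forall x, ~ K x -> phi x = 0) -> (forall x, nc (phi x) <= s) ->
  cont psi -> (forall x, ~ K x -> psi x = 0) -> (forall x, nc (psi x) <= s') ->
  nc (twist mu nu (A n) (corr K phi psi) -
      hint (A n) (fun t => conv_fun mu phi t * (cj (conv_fun nu psi t)))) <=
  8 * (C * s * (C' * s')) * fine (haar (bnd K n)).
Proof.
move=> sK tmu C0 tnu C'0 cphi phi0 phis cpsi psi0 psis.
have [cK K0 oK] := sK.
have rW := sumset_relc A_vh n cK; have rA := vh_relc A_vh n.
pose gn := conv_on nu (A n) psi.
have cgn : cont gn := conv_on_cont G_hd nu rA cpsi.
have gnb t : nc (cj (gn t)) <= C' * s'.
  rewrite ncJ; exact: (conv_on_bound G_lc G_hd A_vh n sK tnu cpsi psi0 psis).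
have cg : cont (conv_fun nu psi) := conv_fun_cont G_lc G_hd nu cpsi cK psi0.
have cf : cont (conv_fun mu phi) := conv_fun_cont G_lc G_hd mu cphi cK phi0.
have -> : twist mu nu (A n) (corr K phi psi) =
    cm_int mu (A n) (fun x =>
      hint (sumset (A n) K) (fun t => phi (t - x) * (cj (gn t)))).
  apply: eq_cm_int => x Ax.
  have cphix : cont (fun t => phi (t - x)).
    by apply: (ccont_comp (g := fun t : G => t + - x)) cphi; exact: contG_shift.
  have -> : (fun t => phi (t - x) * (cj (gn t))) =
      (fun t => (cj ((cj (phi (t - x))) * gn t))).
    by apply/funext => t; rewrite conjCM conjcK.
  rewrite (hint_conj G_hd haar rW (ccontM (ccont_conj cphix) cgn)).
  congr conjc.
  pose H (p : G * G) := (cj (phi (p.2 - x))) * psi (p.2 - p.1).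
  have cH : cont H.
    exact: (ccontM (cont_snd (ccont_conj cphix)) (cont_sub21 cpsi)).
  have -> : (fun t => (cj (phi (t - x))) * gn t) =
      (fun t => cm_int nu (A n) (fun z => H (z, t))).
    apply/funext => t; rewrite /H /gn /conv_on.
    by rewrite -(cm_intZ G_hd nu _ rA (cont_mirror t cpsi)).
  rewrite -(cm_int_fubini G_hd nu (cm_of_radon haar) rA rW cH).
  apply: eq_cm_int => z _; rewrite (@corr_shift K n)//.
  have cpsiz : cont (fun t => psi (t - z)).
    by apply: (ccont_comp (g := fun t : G => t + - z)) cpsi; exact: contG_shift.
  rewrite -(hint_conj G_hd haar rW (ccontM cphix (ccont_conj cpsiz))).
  by apply: eq_cm_int => t _; rewrite conjCM conjcK.
have C's'0 := mass_constant_ge0 tnu C'0 psis.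
have Cs0 := mass_constant_ge0 tmu C0 phis.
have h1 := swap_estimate G_lc G_hd A_vh n sK tmu C0 cphi phi0 phis
  (ccont_conj cgn) gnb.
have rB := bnd_relc G_hd A_vh n cK.
have h2 : nc (hint (A n) (fun t => conv_fun mu phi t * (cj (gn t))) -
    hint (A n) (fun t => conv_fun mu phi t * (cj (conv_fun nu psi t)))) <=
    4 * (C * s * (C' * s')) * fine (haar (bnd K n)).
  have fb t : nc (conv_fun mu phi t) <= C * s.
    exact: (conv_fun_bound sK tmu cphi phi0 phis).
  apply: (hint_diff G_hd haar rA rA rB erefl (ccontM cf (ccont_conj cgn))
    (ccontM cf (ccont_conj cg))).
  - by move=> t At nB; rewrite /gn (conv_on_inside nu sK psi0 At nB).
  - by move=> t _; rewrite Normc.normcM ler_pM ?nc_ge0.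
  - move=> t _; rewrite Normc.normcM ler_pM ?nc_ge0// ncJ.
    exact: (conv_fun_bound sK tnu cpsi psi0 psis).
  - exact: mulr_ge0.
have -> : 8 * (C * s * (C' * s')) * fine (haar (bnd K n)) =
    4 * (C * s * (C' * s')) * fine (haar (bnd K n)) +
    4 * (C * s * (C' * s')) * fine (haar (bnd K n)) by ring.
exact: le_trans (nc_dist_tri _ _ _) (lerD h1 h2).
Qed.

Lemma haar_sumset K n : symk K ->
  fine (haar (sumset (A n) K)) <= vol haar (A n) + fine (haar (bnd K n)).
Proof.
move=> sK; have [cK K0 oK] := sK.
have rW := sumset_relc A_vh n cK; have rA := vh_relc A_vh n.
have rB := bnd_relc G_hd A_vh n cK.
have rAB : relc (A n `\` bnd K n).
  apply: (relc_sub rA); last exact: subDsetl.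
  by apply: measurableD; [case: rA|case: rB].
apply: (@le_trans _ _ (fine (haar ((A n `\` bnd K n) `|` bnd K n)))).
  apply: (le_fine_measure G_hd); [exact: relcU|by case: rW|].
  move=> x Wx; have [xB|xB] := pselect (bnd K n x); [by right|left].
  by rewrite -(sumset_bnd A n sK).
rewrite (fine_measureU G_hd haar rAB rB) ?setDKI// lerD2r /vol.
by apply: (le_fine_measure G_hd haar rA); [case: rAB|exact: subDsetl].
Qed.

(** Translation boundedness only controls integrands supported in a translate of a compact set.
    Writing [c] times [F] as the integral over [t] of [F] times a bump centred at [t], with [t] in
    [sumset (A n) K], reduces to such integrands; for large [n] this domain has at most twice the
    volume of [A n]. *)
Lemma cm_int_vol_bound nu : tb_fun nu -> exists2 C : R, 0 <= C &
  \forall n \near \oo, forall (F : G -> R[i]) (s : R), cont F ->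
    (forall x, nc (F x) <= s) ->
    nc (cm_int nu (A n) F) <= C * s * vol haar (A n).
Proof.
move=> tnu.
have [b [K [cb b01 bs sK [_ bK [c c0 hc]]]]] :=
  bump_exists G_lc G_hd haarP A_vh (@filterT _ _ (nbhs_filter (0 : G))).
have [cK K0 oK] := sK; have [C C0 tC] := tnu K cK.
have cbc : cont (fun x => (b x)%:C) := ccont_R cb.
have bc1 x : nc (b x)%:C <= 1.
  by rewrite ncR ger0_norm; case/andP: (b01 x).
(* One factor 2 comes from [hint_bound], one from the volume of [sumset (A n) K]; [c] is the
   integral of the bump. *)
exists (4 * C / c); first by rewrite divr_ge0 ?mulr_ge0// ltW.
apply: filterS (bndr_cvg G_hd A_vh cK ltr01) => n hn F s cF Fs.
have rW := sumset_relc A_vh n cK; have rA := vh_relc A_vh n.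
have s0 : 0 <= s by apply: le_trans (Fs 0); exact: nc_ge0.
have v0 := vol_gt0 G_hd A_vh n.
pose H (p : G * G) := F p.1 * (b (p.2 - p.1))%:C.
have cH : cont H := ccontM (cont_fst cF) (cont_sub21 cbc).
have E : c%:C * cm_int nu (A n) F =
    hint (sumset (A n) K) (fun t => cm_int nu (A n) (fun x => H (x, t))).
  rewrite -(cm_int_fubini G_hd nu (cm_of_radon haar) rA rW cH).
  rewrite -(cm_intZ G_hd nu _ rA cF); apply: eq_cm_int => x Ax.
  have cbx : cont (fun t => (b (t - x))%:C).
    by apply: (ccont_comp (g := fun t : G => t + - x)) cbc; exact: contG_shift.
  rewrite /H mulrC (cm_intZ G_hd _ (F x) rW cbx) -hc.
  congr (_ * _); rewrite -(hint_shift G_hd haarP (- x) (relc_compact G_hd cK) cbc).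
  apply/esym; apply: cm_int_mkcond.
    by move=> t /= Ktx; exists x => //; exists (t - x) => //; rewrite addrC subrK.
  by move=> t _ nK; rewrite bK.
have hW : fine (haar (sumset (A n) K)) <= 2 * vol haar (A n).
  apply: le_trans (haar_sumset n sK) _; rewrite mulr_natl mulr2n lerD2l.
  by move: hn; rewrite /bndr ltr_pdivrMr// mul1r => /ltW.
have inner t : nc (cm_int nu (A n) (fun x => H (x, t))) <= C * s.
  apply: (tb_open G_lc G_hd tC (vh_open A_vh n) rA (t := t)).
  - exact: (ccont_sect2 cH).
  - move=> x nK; rewrite /H bK ?mulr0// => h; apply: nK; exact: symk_sub h.
  - move=> x; rewrite /H Normc.normcM -[s]mulr1 ler_pM ?nc_ge0//.
have cI : cont (fun t => cm_int nu (A n) (fun x => H (x, t))).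
  exact: (@cm_int_param_cont R G G_hd nu (A n) G (fun p => H (p.2, p.1)) rA
    (ccont_swap cH)).
have := hint_bound G_hd haar rW cI (fun x _ => inner x).
rewrite -E Normc.normcM ncR gtr0_norm// => h.
rewrite -(ler_pM2l c0); apply: le_trans h _.
have -> : c * (4 * C / c * s * vol haar (A n)) = 2 * (C * s) * (2 * vol haar (A n)).
  by field; rewrite gt_eqF.
by rewrite ler_wpM2l// !mulr_ge0.
Qed.

Lemma twist_bound mu nu : tb_fun mu -> tb_fun nu -> forall K, compact K ->
  exists2 C : R, 0 <= C &
  \forall n \near \oo, forall (t : G) phi (s : R), cont phi ->
    (forall x, ~ K (x - t) -> phi x = 0) -> (forall x, nc (phi x) <= s) ->
    nc (twist mu nu (A n) phi) <= C * s * vol haar (A n).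
Proof.
move=> tmu tnu K cK; have [C C0 hC] := cm_int_vol_bound tmu.
(* As a function of [z], [phi (x - z)] is supported in a translate of the reflected [K], hence in
   one of the symmetric [L]. *)
have [L sL KL] := symk_hull cK; have [cL _ oL] := sL.
have [C' C'0 hC'] := tnu L cL.
exists (C * C'); first exact: mulr_ge0.
apply: filterS hC => n hn t phi s cphi phi0 phis.
have rA := vh_relc A_vh n.
rewrite -[C * C' * s]mulrA; apply: hn; first exact: twist_inner_cont.
move=> x; rewrite ncJ.
apply: (tb_open G_lc G_hd hC' (vh_open A_vh n) rA (t := x - t)).
- exact: ccont_conj (cont_mirror x cphi).
- move=> z nL; rewrite phi0 ?conjc0// => /KL /oL h; apply: nL.
  by rewrite opprB in h; move: h; rewrite !opprB addrCA; congr (L _); rewrite addrC.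
- by move=> z; rewrite ncJ.
Qed.

End TwistEstimates.

(** * Means of Besicovitch almost periodic functions *)

Section Means.
Variables (R : realType) (G : topologicalZmodType).
Hypothesis G_hd : hausdorff_space G.
Variable haar : radon R G.
Hypothesis haarP : is_haar haar.
Variable A : nat -> set G.
Hypothesis A_vh : van_hove haar A.
Implicit Types (K D : set G) (f g h p q chi xi : G -> R[i]).
Local Notation hint := (cm_int (cm_of_radon haar)).

Lemma limn_esup_lt (u : nat -> \bar R) (c : \bar R) : (limn_esup u < c)%E ->
  \forall n \near \oo, (u n < c)%E.
Proof.
rewrite limn_esup_lim (cvg_lim _ (@cvg_esups_inf _ u))//.
move=> /ereal_inf_lt[_ [N _ <-] hN].
exists N => // n /= Nn; apply: le_lt_trans hN.
by apply: ereal_sup_ubound; exists n.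
Qed.

Definition mean n f : R[i] := ((vol haar (A n))^-1)%:C * hint (A n) f.

Definition absmean n f : R := (vol haar (A n))^-1 * \int[haar]_(x in A n) nc (f x).

Let rA n := vh_relc A_vh n.
Let v0 n := vol_gt0 G_hd A_vh n.

Let vi n : 0 <= (vol haar (A n))^-1.
Proof. by rewrite invr_ge0 ltW. Qed.

Lemma nc_mean n f : cont f -> nc (mean n f) <= 2 * absmean n f.
Proof.
move=> cf; rewrite /mean /absmean Normc.normcM ncR gtr0_norm ?invr_gt0//.
rewrite mulrCA; apply: (ler_wpM2l (vi n)).
exact: (hint_nc G_hd haar (rA n) cf).
Qed.

Lemma absmean_le n f g (c : R) : cont f -> cont g ->
  (forall x, nc (f x) <= c * nc (g x)) -> absmean n f <= c * absmean n g.
Proof.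
move=> cf cg fg; rewrite /absmean mulrCA; apply: (ler_wpM2l (vi n)).
rewrite -(RintegralZ_relc G_hd haar c (rA n) (ccont_nc cg)).
apply: (le_Rintegral_relc G_hd _ (rA n) (ccont_nc cf)) => [|x _]; last exact: fg.
by apply: rcontM (ccont_nc cg); exact: rcont_cst.
Qed.

Lemma absmean_le2 n f g h (c d : R) : cont f -> cont g -> cont h ->
  (forall x, nc (f x) <= c * nc (g x) + d * nc (h x)) ->
  absmean n f <= c * absmean n g + d * absmean n h.
Proof.
move=> cf cg ch fgh; rewrite /absmean mulrCA [d * _]mulrCA -mulrDr.
apply: (ler_wpM2l (vi n)).
have cc (k : G -> R[i]) (r : R) : cont k -> rcont (fun x => r * nc (k x)).
  by move=> ck; apply: rcontM (ccont_nc ck); exact: rcont_cst.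
rewrite -(RintegralZ_relc G_hd haar c (rA n) (ccont_nc cg)).
rewrite -(RintegralZ_relc G_hd haar d (rA n) (ccont_nc ch)).
rewrite -(RintegralD_relc G_hd haar (rA n) (cc _ _ cg) (cc _ _ ch)).
apply: (le_Rintegral_relc G_hd _ (rA n) (ccont_nc cf)) => [|x _]; last exact: fgh.
exact: rcontD (cc _ _ cg) (cc _ _ ch).
Qed.

Lemma absmean_bound n f (B : R) : cont f -> (forall x, nc (f x) <= B) ->
  absmean n f <= B.
Proof.
move=> cf fB; rewrite /absmean mulrC ler_pdivrMr//.
have mA : measurable (A n : set (borel G)) by case: (rA n).
have <- : \int[haar]_(x in A n) B = B * vol haar (A n).
  by rewrite Rintegral_cst.
by apply: (le_Rintegral_relc G_hd _ (rA n) (ccont_nc cf)) => //; exact: rcont_cst.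
Qed.

Lemma meanB n f g : cont f -> cont g ->
  mean n (fun x => f x - g x) = mean n f - mean n g.
Proof. by move=> cf cg; rewrite /mean (cm_intB G_hd _ (rA n) cf cg) mulrBr. Qed.

Lemma meanZ n f c : cont f -> mean n (fun x => c * f x) = c * mean n f.
Proof. by move=> cf; rewrite /mean (cm_intZ G_hd _ c (rA n) cf) mulrCA. Qed.

Lemma mean_sum n (I : Type) (r : seq I) (F : I -> G -> R[i]) :
  (forall i, cont (F i)) ->
  mean n (fun x => \sum_(i <- r) F i x) = \sum_(i <- r) mean n (F i).
Proof.
by move=> cF; rewrite /mean (cm_int_sum G_hd _ r (rA n) cF) mulr_sumr.
Qed.

(** Invariance of Haar measure moves the shift from the function to the domain, which changes only
    inside the boundary. *)
Lemma absmean_shift n f (t : G) (K : set G) (B : R) : symk K -> K t -> cont f ->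
  (forall x, nc (f x) <= B) ->
  absmean n (fun x => f (x - t)) <= absmean n f + 4 * B * bndr haar A K n.
Proof.
move=> sK Kt cf fB; have [cK K0 _] := sK.
have B0 : 0 <= B by apply: le_trans (fB 0); exact: nc_ge0.
have rAt := relc_shift t (rA n).
have rB := bnd_relc G_hd A_vh n cK.
pose h x := (nc (f x))%:C.
have ch : cont h := ccont_R (ccont_nc cf).
have hE D : hint D h = (\int[haar]_(x in D) nc (f x))%:C.
  rewrite cm_of_radonE /cint /h; congr (_ +i* _).
  by rewrite /Rintegral (eq_integral (cst 0%E)) ?integral0.
have hB x : nc (h x) <= B by rewrite /h ncR ger0_norm ?nc_ge0.
have := hint_diff G_hd haar rAt (rA n) rB (shift_bnd A n sK Kt) ch ch
  (fun x _ _ => erefl) (fun x _ => hB x) (fun x _ => hB x) B0.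
rewrite !hE -rmorphB ncR => hd.
have shE : \int[haar]_(x in A n) nc (f (x - t)) =
    \int[haar]_(x in [set x | A n (x + t)]) nc (f x).
  have ct : rcont (fun x => nc (f (x - t))).
    by apply: (rcont_comp (g := fun x : G => x + - t)) (ccont_nc cf);
      exact: contG_shift.
  rewrite -(Rintegral_shift G_hd haarP t (rA n) ct).
  by congr (Rintegral _ _ _); apply/funext => x; rewrite addrK.
rewrite /absmean shE /bndr mulrA [_ / _]mulrC -mulrDr.
apply: (ler_wpM2l (vi n)); rewrite -lerBlDl.
exact: le_trans (ler_norm _) hd.
Qed.

(** The smeared measures are bounded and continuous, and for products of bounded functions
    approximation in the first mean is enough; this is what is kept of [Bap2]. *)
Definition bap f := [/\ cont f, exists B : R, forall x, nc (f x) <= B &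
  forall e : R, 0 < e -> exists2 p, trig_poly p &
    \forall n \near \oo, absmean n (fun x => f x - p x) < e].

Lemma character_cont chi : character chi -> cont chi.
Proof. by case=> cc _ _; exact/contP. Qed.

Lemma character_nc chi x : character chi -> nc (chi x) = 1.
Proof. by case. Qed.

Lemma characterD chi x y : character chi -> chi (x + y) = chi x * chi y.
Proof. by case. Qed.

Lemma character0 chi : character chi -> chi 0 = 1.
Proof.
move=> hc; have n0 : chi 0 != 0.
  apply/eqP => h; have := character_nc 0 hc; rewrite h Normc.normc0 => /esym/eqP.
  by rewrite oner_eq0.
by apply: (mulfI n0); rewrite mulr1 -(characterD _ _ hc) addr0.
Qed.

Lemma ncJM (z : R[i]) : nc z = 1 -> z * cj z = 1.
Proof.
move=> z1; rewrite -sqr_normc nc_norm z1; simpc.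
by rewrite expr1n.
Qed.

Lemma characterN chi x : character chi -> chi (- x) = cj (chi x).
Proof.
move=> hc; have h := ncJM (character_nc x hc).
rewrite -[LHS]mulr1 -h mulrA -(characterD _ _ hc) addNr character0// mul1r.
by [].
Qed.

Lemma characterM chi xi : character chi -> character xi ->
  character (fun x => chi x * xi x).
Proof.
move=> hc hx; split.
- by apply/contP; apply: ccontM; exact: character_cont.
- by move=> x; rewrite Normc.normcM !character_nc// mulr1.
- by move=> x y; rewrite (characterD _ _ hc) (characterD _ _ hx) mulrACA.
Qed.

Lemma characterJ chi : character chi -> character (fun x => cj (chi x)).
Proof.
move=> hc; split.
- by apply/contP; apply: ccont_conj; exact: character_cont.
- by move=> x; rewrite ncJ character_nc.
- by move=> x y; rewrite (characterD _ _ hc) conjCM.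
Qed.

Lemma character_cMJ chi xi : character chi -> character xi ->
  character (fun x => chi x * cj (xi x)).
Proof. by move=> hc hx; apply: characterM => //; exact: characterJ. Qed.

Definition chi_mean chi : R[i] := if `[< forall x, chi x = 1 >] then 1 else 0.

(** If [chi a] is not 1, moving the domain by [a] multiplies the integral by a number other than 1,
    and yet changes it only by a boundary term; so the mean tends to 0. *)
Lemma chi_meanP chi : character chi ->
  mean n chi @[n --> \oo] --> (chi_mean chi : R[i]^o).
Proof.
move=> hc; have cc := character_cont hc; rewrite /chi_mean; case: asboolP => h.
  apply/ccvgP => e e0; near=> n.
  have -> : mean n chi = 1.
    rewrite /mean (@eq_cm_int _ _ _ _ _ (fun=> 1)); last by move=> x _; exact: h.
    rewrite cm_of_radonE cint1; last by case: (rA n).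
    by rewrite -rmorphM /= mulVf ?gt_eqF//; exact: v0.
  by rewrite subrr Normc.normc0.
have [a ha] : exists a, chi a <> 1.
  by apply: contrapT => nh; apply: h => x; apply: contrapT => hx; apply: nh; exists x.
have d0 : 0 < nc (1 - chi a).
  rewrite lt_neqAle nc_ge0 andbT eq_sym; apply/negP => /eqP /Normc.eq0_normc.
  by move/eqP; rewrite subr_eq0 => /eqP /esym.
have c1 : compact [set a] by exact: compact_set1.
have [K sK aK] := symk_hull c1; have [cK K0 _] := sK.
apply/ccvgP => e e0.
have e1 : 0 < e * nc (1 - chi a) / 4 by rewrite divr_gt0// mulr_gt0.
apply: filterS (bndr_cvg G_hd A_vh cK e1) => n hn; rewrite subr0.
have rB := bnd_relc G_hd A_vh n cK.
have cb x : nc (chi x) <= 1 by rewrite character_nc.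
have := hint_diff G_hd haar (relc_shift a (rA n)) (rA n) rB
  (shift_bnd A n sK (aK a erefl)) cc cc
  (fun x _ _ => erefl) (fun x _ => cb x) (fun x _ => cb x) ler01.
rewrite mulr1 => hd.
have E : (1 - chi a) * hint (A n) chi =
    chi a * (hint [set x | A n (x + a)] chi - hint (A n) chi).
  rewrite mulrBl mul1r mulrBr; congr (_ - _).
  rewrite -(cm_intZ G_hd _ _ (relc_shift a (rA n)) cc).
  rewrite -(hint_shift G_hd haarP a (rA n) cc).
  by apply: eq_cm_int => x _; rewrite (characterD _ _ hc) mulrC.
have E2 : nc (1 - chi a) * nc (hint (A n) chi) <= 4 * fine (haar (bnd A K n)).
  by rewrite -Normc.normcM E Normc.normcM character_nc// mul1r.
rewrite /mean Normc.normcM ncR gtr0_norm ?invr_gt0//.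
rewrite -(ltr_pM2l d0) mulrCA -ltr_pdivlMl ?invr_gt0// invrK.
apply: le_lt_trans E2 _; move: hn; rewrite /bndr ltr_pdivrMr// => hn.
rewrite mulrC -ltr_pdivlMr//; apply: lt_le_trans hn _.
by rewrite le_eqVlt; apply/orP; left; apply/eqP; field.
Unshelve. all: by end_near. Qed.

Lemma Bap2_bap f : cont f -> (exists B : R, forall x, nc (f x) <= B) ->
  Bap2 haar A f -> bap f.
Proof.
move=> cf fB [_ hf]; split => // e e0.
have [p tp lt_e] := hf e e0; exists p => //.
have cp : cont p.
  have [n [c [chi [hchi ->]]]] := tp.
  by apply: ccont_sum => i; apply: ccontM (character_cont (hchi i)); exact: ccont_cst.
pose h x := f x - p x; have ch : cont h := ccontB cf cp.
have cn2 : rcont (fun x => nc (h x) ^+ 2).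
  have -> : (fun x => nc (h x) ^+ 2) = (fun x => nc (h x) * nc (h x)).
    by apply/funext => x; rewrite expr2.
  exact: rcontM (ccont_nc ch) (ccont_nc ch).
pose u n := ((vol haar (A n))^-1 * \int[haar]_(x in A n) (nc (h x) ^+ 2))%R.
have intE n : (\int[haar]_(x in A n) (nc (h x) ^+ 2)%:E)%E =
    (\int[haar]_(x in A n) (nc (h x) ^+ 2))%:E.
  rewrite /Rintegral fineK//.
  apply: integrable_fin_num; first by case: (rA n).
  exact: (continuous_integrable G_hd haar (rA n) cn2).
have vE : (fun n => (((vol haar (A n))^-1)%:E *
    \int[haar]_(x in A n) (nc (h x) ^+ 2)%:E)%E) = (fun n => (u n)%:E).
  by apply/funext => n; rewrite intE -EFinM.
have : (limn_esup (fun n => (u n)%:E) < (e ^+ 2)%:E)%E.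
  rewrite ltNge; apply/negP => le_e; move: lt_e.
  rewrite /bnorm2 vE ltNge => /negP; apply.
  have -> : (e%:E = (e ^+ 2)%:E `^ 2^-1)%E.
    by rewrite poweR_EFin powR12_sqrt ?sqr_ge0// sqrtr_sqr gtr0_norm.
  apply: gt0_ler_poweR => //.
  - by rewrite in_itv/= leey andbT lee_fin sqr_ge0.
  - rewrite in_itv/= leey andbT.
    by apply: le_trans le_e; rewrite lee_fin sqr_ge0.
move=> /limn_esup_lt; apply: filterS => n; rewrite lte_fin => un.
(* The inequality of arithmetic and geometric means replaces Cauchy-Schwarz; with the weight [e],
   and the mean square below [e ^+ 2], each of the two terms has mean at most [e / 2]. *)
have le1 x : nc (h x) <= (2^-1 * e) * nc (1 : R[i]) + (2^-1 / e) * nc ((nc (h x) ^+ 2)%:C).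
  rewrite Normc.normc1 mulr1 ncR ger0_norm ?sqr_ge0//.
  have e2 : 0 < 2 * e by rewrite mulr_gt0.
  rewrite -(ler_pM2l e2) mulrDr.
  have -> : 2 * e * (2^-1 * e) = e ^+ 2 by field.
  have -> : 2 * e * (2^-1 / e * nc (h x) ^+ 2) = nc (h x) ^+ 2.
    by field; rewrite gt_eqF.
  by have := sqr_ge0 (e - nc (h x)); rewrite sqrrB; lra.
have := absmean_le2 n ch (@ccont_cst R G 1) (ccont_R cn2) le1.
move/le_lt_trans; apply.
have b1 : absmean n (fun=> 1) <= 1.
  by apply: absmean_bound; [exact: ccont_cst|move=> x; rewrite Normc.normc1].
have b2 : absmean n (fun x => (nc (h x) ^+ 2)%:C) = u n.
  rewrite /absmean /u; congr (_ * _); congr (Rintegral _ _ _); apply/funext => x.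
  by rewrite ncR ger0_norm ?sqr_ge0.
rewrite b2; set a := absmean n _ in b1 *.
have -> : 2^-1 * e * a + 2^-1 / e * u n = (e * a + u n / e) / 2.
  by field; rewrite gt_eqF.
have h1 : e * a <= e * 1 by rewrite ler_wpM2l// ltW.
have h2 : u n / e < e by rewrite ltr_pdivrMr// -expr2.
by rewrite ltr_pdivrMr//; lra.
Qed.

End Means.

Section ComplexLimitTools.
Variable R : realType.
Implicit Types (u v : nat -> R[i]) (l : R[i]).

Lemma ccvgD u v (l l' : R[i]) : u n @[n --> \oo] --> (l : R[i]^o) ->
  v n @[n --> \oo] --> (l' : R[i]^o) ->
  (u n + v n) @[n --> \oo] --> (l + l' : R[i]^o).
Proof. by move=> ul vl; exact: (@cvgD _ R[i]^o nat \oo _ u v l l' ul vl). Qed.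

Lemma ccvgB u v (l l' : R[i]) : u n @[n --> \oo] --> (l : R[i]^o) ->
  v n @[n --> \oo] --> (l' : R[i]^o) ->
  (u n - v n) @[n --> \oo] --> (l - l' : R[i]^o).
Proof. by move=> ul vl; exact: (@cvgB _ R[i]^o nat \oo _ u v l l' ul vl). Qed.

Lemma ccvgMl u (c l : R[i]) : u n @[n --> \oo] --> (l : R[i]^o) ->
  (c * u n) @[n --> \oo] --> (c * l : R[i]^o).
Proof.
by move=> ul; apply: (@cvgM R[i] nat \oo _ (fun=> c) u c l _ ul); apply: (@cvg_cst R[i]^o).
Qed.

Lemma ccvg_sum (I : Type) (r : seq I) (u : I -> nat -> R[i]) (l : I -> R[i]) :
  (forall i, u i n @[n --> \oo] --> (l i : R[i]^o)) ->
  (\sum_(i <- r) u i n) @[n --> \oo] --> (\sum_(i <- r) l i : R[i]^o).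
Proof.
move=> ul; elim: r => [|i r ih].
  by under eq_fun do rewrite big_nil; rewrite big_nil; apply: (@cvg_cst R[i]^o).
by under eq_fun do rewrite big_cons; rewrite big_cons;
  exact: (@ccvgD (u i) (fun n => \sum_(j <- r) u j n) _ _ (ul i) ih).
Qed.

(** The limits for different [e] need not be compared: each approximating sequence is Cauchy and
    hands this on to [u] at the scale [e]. *)
Lemma ccvg_approx u : (forall e : R, 0 < e -> exists v l,
    v n @[n --> \oo] --> (l : R[i]^o) /\ \forall n \near \oo, nc (u n - v n) < e) ->
  exists l, u n @[n --> \oo] --> (l : R[i]^o).
Proof.
move=> h; apply: ccvg_cauchy => e e0.
have e40 : 0 < e / 4 by rewrite divr_gt0.
have [v [l [/ccvgP vl uv]]] := h _ e40.
have [N _ hN] := filterI (vl _ e40) uv.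
exists N => n Nn; have [/= a1 a2] := hN n Nn; have [/= b1 b2] := hN N (leqnn N).
apply: le_lt_trans (nc_dist_tri _ (v n) _) _.
have := nc_dist_tri (v n) (v N) (u N); have := nc_dist_tri (v n) l (v N).
rewrite (ncBC l) (ncBC (v N) (u N)) => h1 h2.
by lra.
Qed.

End ComplexLimitTools.

(** * Means of products and their approximation *)

Section PairCorrelation.
Variables (R : realType) (G : topologicalZmodType).
Hypothesis G_hd : hausdorff_space G.
Variable haar : radon R G.
Hypothesis haarP : is_haar haar.
Variable A : nat -> set G.
Hypothesis A_vh : van_hove haar A.
Implicit Types (K D : set G) (f g h p q chi xi : G -> R[i]).
Local Notation mean := (mean haar A).
Local Notation absmean := (absmean haar A).
Local Notation bap := (bap haar A).
Local Notation chi_mean := (@chi_mean R G).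

(** An arbitrary finite index type lets products of polynomials be indexed by pairs. *)
Definition tpoly (I : finType) (a : I -> R[i]) (chi : I -> G -> R[i]) : G -> R[i] :=
  fun x => \sum_i a i * chi i x.

Lemma tpoly_trig (I : finType) (a : I -> R[i]) (chi : I -> G -> R[i]) :
  (forall i, character (chi i)) -> trig_poly (tpoly a chi).
Proof.
move=> hc; exists #|I|, (fun k => a (enum_val k)), (fun k => chi (enum_val k)).
split; first by move=> k; exact: hc.
apply/funext => x; rewrite /tpoly.
rewrite (reindex (@enum_val I I)) /=; last first.
  by apply: onW_bij; exact: enum_val_bij.
by [].
Qed.

Lemma cont_term (I : finType) (a : I -> R[i]) (chi : I -> G -> R[i]) i :
  (forall i, character (chi i)) -> cont (fun x => a i * chi i x).
Proof. by move=> hc; apply: ccontM (character_cont (hc i)); exact: ccont_cst. Qed.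

Lemma tpoly_cont (I : finType) (a : I -> R[i]) (chi : I -> G -> R[i]) :
  (forall i, character (chi i)) -> cont (tpoly a chi).
Proof. by move=> hc; apply: ccont_sum => i; exact: cont_term. Qed.

Lemma tpoly_bound (I : finType) (a : I -> R[i]) (chi : I -> G -> R[i]) :
  (forall i, character (chi i)) ->
  exists2 B : R, 0 <= B & forall x, nc (tpoly a chi x) <= B.
Proof.
move=> hc; exists (\sum_i nc (a i)); first by apply: sumr_ge0 => i _; exact: nc_ge0.
move=> x; apply: le_trans (nc_sum _ _ _) _; apply: ler_sum => i _.
by rewrite Normc.normcM (character_nc _ (hc i)) mulr1.
Qed.

Lemma tpoly_mean (I : finType) (a : I -> R[i]) (chi : I -> G -> R[i]) :
  (forall i, character (chi i)) ->
  mean n (tpoly a chi) @[n --> \oo] -->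
    (\sum_i a i * chi_mean (chi i) : R[i]^o).
Proof.
move=> hc.
have -> : (fun n => mean n (tpoly a chi)) =
    (fun n => \sum_i a i * mean n (chi i)).
  apply/funext => n; rewrite /tpoly.
  rewrite (mean_sum G_hd A_vh n _ (fun i => cont_term a i hc)).
  by apply: eq_bigr => i _; rewrite (meanZ G_hd A_vh)//; exact: character_cont.
apply: (@ccvg_sum _ _ _ (fun i n => a i * mean n (chi i))) => i.
apply: (@ccvgMl _ (fun n => mean n (chi i))); exact: (chi_meanP G_hd haarP A_vh (hc i)).
Qed.

(** The last factor is 1 if the two characters coincide and 0 otherwise, by orthogonality. Summing
    over all pairs allows characters to be repeated within a family. *)
Definition corr_coef (I J : finType) (a : I -> R[i]) (chi : I -> G -> R[i])
    (b : J -> R[i]) (xi : J -> G -> R[i]) (k : I * J) : R[i] :=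
  a k.1 * cj (b k.2) * chi_mean (fun x => chi k.1 x * cj (xi k.2 x)).

Definition corr_poly (I J : finType) (a : I -> R[i]) (chi : I -> G -> R[i])
    (b : J -> R[i]) (xi : J -> G -> R[i]) : G -> R[i] :=
  tpoly (corr_coef a chi b xi) (fun k => xi k.2).

Lemma tpoly_corr (I J : finType) (a : I -> R[i]) (chi : I -> G -> R[i])
    (b : J -> R[i]) (xi : J -> G -> R[i]) t :
  (forall i, character (chi i)) -> (forall j, character (xi j)) ->
  mean n (fun x => tpoly a chi x * cj (tpoly b xi (x - t))) @[n --> \oo] -->
    (corr_poly a chi b xi t : R[i]^o).
Proof.
move=> hc hx.
have -> : (fun x => tpoly a chi x * cj (tpoly b xi (x - t))) =
    tpoly (fun k : I * J => a k.1 * cj (b k.2) * xi k.2 t)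
          (fun k x => chi k.1 x * cj (xi k.2 x)).
  apply/funext => x; rewrite /tpoly rmorph_sum /= big_distrlr /=.
  rewrite pair_bigA /=; apply: eq_bigr => -[i j] _ /=.
  by rewrite !conjCM (characterD _ _ (hx j)) (characterN _ (hx j)) !conjCM conjcK; ring.
have hk k : character (fun x => chi k.1 x * cj (xi k.2 x)).
  by apply: character_cMJ.
have -> : corr_poly a chi b xi t = \sum_(k : I * J)
    (a k.1 * cj (b k.2) * xi k.2 t) * chi_mean (fun x => chi k.1 x * cj (xi k.2 x)).
  by apply: eq_bigr => k _; rewrite /corr_coef mulrAC.
exact: (@tpoly_mean _ (fun k : I * J => a k.1 * cj (b k.2) * xi k.2 t) _ hk).
Qed.

Lemma trig_polyP p : trig_poly p -> exists n (a : 'I_n -> R[i]) (chi : 'I_n -> G -> R[i]),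
  (forall i, character (chi i)) /\ p = tpoly a chi.
Proof. by move=> [n [a [chi [hc ->]]]]; exists n, a, chi. Qed.

Lemma bap_approx f : bap f -> forall e : R, 0 < e ->
  exists n (a : 'I_n -> R[i]) (chi : 'I_n -> G -> R[i]), (forall i, character (chi i)) /\
    \forall n \near \oo, absmean n (fun x => f x - tpoly a chi x) < e.
Proof.
move=> [_ _ h] e /h [p /trig_polyP [n [a [chi [hc ->]]]] hp].
by exists n, a, chi.
Qed.

Lemma character_bap chi : character chi -> bap chi.
Proof.
move=> hc; split; first exact: character_cont.
  by exists 1 => x; rewrite character_nc.
move=> e e0; exists chi.
  exists 1%N, (fun=> 1), (fun=> chi); split => //.
  by apply/funext => x; rewrite big_ord1 mul1r.
near=> n; apply: (@le_lt_trans _ _ 0) => //.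
apply: (absmean_bound G_hd A_vh).
  by apply: ccontB; exact: character_cont.
by move=> x; rewrite subrr Normc.normc0.
Unshelve. all: by end_near. Qed.

(** The difference of the products is the conjugate of the shifted [g] times [f - p], plus [p] times
    the conjugate of the shifted [g - q]. The bound of [p] is not controlled by that of [f], so [q]
    is chosen after [p]. Neither depends on [t]; only the rank from which the estimate holds does,
    and this rank disappears in the limit. *)
Lemma pair_approx f g : bap f -> bap g -> forall e : R, 0 < e ->
  exists n (a : 'I_n -> R[i]) (chi : 'I_n -> G -> R[i])
    m (b : 'I_m -> R[i]) (xi : 'I_m -> G -> R[i]),
  [/\ forall i, character (chi i), forall j, character (xi j),
    \forall n \near \oo, absmean n (fun x => f x - tpoly a chi x) < e,
    \forall n \near \oo, absmean n (fun x => g x - tpoly b xi x) < e &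
    forall t, \forall n \near \oo,
      nc (mean n (fun x => f x * cj (g (x - t))) -
          mean n (fun x => tpoly a chi x * cj (tpoly b xi (x - t)))) < e].
Proof.
move=> bf bg e e0; have [cf _ _] := bf; have [cg [Bg hBg] _] := bg.
have Bg0 : 0 <= Bg by apply: le_trans (hBg 0); exact: nc_ge0.
(* After the factor 2 of [nc_mean], [e / 2] is shared out: [e / 6] each for [f - p], for [g - q] and
   for the boundary error of its shift. *)
have e1 : 0 < e / (6 * (Bg + 1)) by rewrite divr_gt0// mulr_gt0// ltr_wpDl.
have [n [a [chi [hc happ]]]] := bap_approx bf e1.
have [Bp Bp0 hBp] := tpoly_bound a hc; have cp := tpoly_cont a hc.
have e2 : 0 < e / (6 * (Bp + 1)) by rewrite divr_gt0// mulr_gt0// ltr_wpDl.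
have [m [b [xi [hx hbpp]]]] := bap_approx bg e2.
have [Bq Bq0 hBq] := tpoly_bound b hx; have cq := tpoly_cont b hx.
set p := tpoly a chi in happ hBp cp *; set q := tpoly b xi in hbpp hBq cq *.
have small (B : R) : 0 <= B -> e / (6 * (B + 1)) <= e.
  move=> B0; rewrite ler_pdivrMr; last by rewrite mulr_gt0// ltr_wpDl.
  by rewrite ler_pMr//; lra.
exists n, a, chi, m, b, xi; split => //.
- by apply: filterS happ => k /lt_le_trans; apply; exact: small.
- by apply: filterS hbpp => k /lt_le_trans; apply; exact: small.
move=> t.
have c1 : compact [set t] by exact: compact_set1.
have [K sK tK] := symk_hull c1; have [cK K0 _] := sK.
have C0 : 0 < 4 * (Bg + Bq) + 1 by rewrite ltr_wpDl// mulr_ge0// addr_ge0.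
have e3 : 0 < e / (6 * (Bp + 1)) / (4 * (Bg + Bq) + 1) by rewrite divr_gt0.
apply: filterS3 happ hbpp (bndr_cvg G_hd A_vh cK e3) => k h1 h2 h3.
have sh (h : G -> R[i]) : cont h -> cont (fun x => h (x - t)).
  by move=> ch; apply: (ccont_comp (g := fun x : G => x + - t)) ch; exact: contG_shift.
have cF := ccontM cf (ccont_conj (sh _ cg)).
have cP := ccontM cp (ccont_conj (sh _ cq)).
rewrite -(meanB G_hd A_vh)//.
apply: le_lt_trans (nc_mean G_hd A_vh _ (ccontB cF cP)) _.
pose gq x := g x - q x.
have cgq : cont gq := ccontB cg cq.
have cfp : cont (fun x => f x - p x) := ccontB cf cp.
have hgq x : nc (gq x) <= Bg + Bq by apply: le_trans (ncB _ _) _; exact: lerD.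
have le1 x : nc (f x * cj (g (x - t)) - p x * cj (q (x - t))) <=
    Bg * nc (f x - p x) + Bp * nc (gq (x - t)).
  have -> : f x * cj (g (x - t)) - p x * cj (q (x - t)) =
      cj (g (x - t)) * (f x - p x) + p x * cj (gq (x - t)).
    by rewrite /gq rmorphB; ring.
  apply: le_trans (le_normcD _ _) _; rewrite !Normc.normcM !ncJ.
  by apply: lerD; rewrite ler_wpM2r ?nc_ge0.
have le2 := absmean_le2 G_hd A_vh k (ccontB cF cP) cfp (sh _ cgq) le1.
have le3 := absmean_shift G_hd haarP A_vh k sK (tK t erefl) cgq hgq.
set X := absmean k _ in le2 le3 *; set Y := absmean k (fun x => f x - p x) in le2 h1.
set Z := absmean k (fun x => gq (x - t)) in le2 le3.
set W := absmean k gq in le3.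
have h2' : W < e / (6 * (Bp + 1)) by [].
have h3' : 4 * (Bg + Bq) * bndr haar A K k <= e / (6 * (Bp + 1)).
  have := bndr_ge0 haar A K k; move: h3; rewrite ltr_pdivlMr//.
  by set r := bndr _ _ _ _; set d := e / _; move=> h3 r0; nra.
have f1 : Bg * Y <= e / 6.
  apply: le_trans (ler_wpM2l Bg0 (ltW h1)) _.
  have -> : Bg * (e / (6 * (Bg + 1))) = e / 6 * (Bg / (Bg + 1)).
    by field; rewrite gt_eqF// ltr_wpDl.
  by rewrite ler_piMr ?divr_ge0// ?ltW// ltr_pdivrMr ?ltr_wpDl// mul1r ltrDl.
have f2 : Bp * Z <= e / 3.
  have -> : e / 3 = e / 6 * 2 by field.
  apply: le_trans (_ : Bp * (2 * (e / (6 * (Bp + 1)))) <= _).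
    by rewrite ler_wpM2l//; lra.
  have -> : Bp * (2 * (e / (6 * (Bp + 1)))) = e / 6 * 2 * (Bp / (Bp + 1)).
    by field; rewrite gt_eqF// ltr_wpDl.
  rewrite ler_piMr//; first by rewrite mulr_ge0// divr_ge0// ltW.
  by rewrite ltW// ltr_pdivrMr ?ltr_wpDl// mul1r ltrDl.
(* If [Bp] is 0, strictness cannot be taken from the bound on [Z]. *)
have strict : Bp * Z < e / 3.
  have [B0|B0] := eqVneq Bp 0; first by rewrite B0 mul0r divr_gt0.
  have Bp1 : 0 < Bp by rewrite lt_neqAle eq_sym B0.
  have -> : e / 3 = e / 6 * 2 by field.
  apply: (@lt_le_trans _ _ (Bp * (2 * (e / (6 * (Bp + 1)))))).
    by rewrite ltr_pM2l//; lra.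
  have -> : Bp * (2 * (e / (6 * (Bp + 1)))) = e / 6 * 2 * (Bp / (Bp + 1)).
    by field; rewrite gt_eqF// ltr_wpDl.
  rewrite ler_piMr//; first by rewrite mulr_ge0// divr_ge0// ltW.
  by rewrite ltW// ltr_pdivrMr ?ltr_wpDl// mul1r ltrDl.
by lra.
Qed.

Lemma pair_limit f g : bap f -> bap g -> exists c : G -> R[i], forall t,
  mean n (fun x => f x * cj (g (x - t))) @[n --> \oo] --> (c t : R[i]^o).
Proof.
move=> bf bg.
suff /choice[c hc] : forall t, exists l : R[i],
    mean n (fun x => f x * cj (g (x - t))) @[n --> \oo] --> (l : R[i]^o).
  by exists c.
move=> t; apply: ccvg_approx => e e0.
have [n [a [chi [m [b [xi [hc hx _ _ h]]]]]]] := pair_approx bf bg e0.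
exists (fun n => mean n (fun x => tpoly a chi x * cj (tpoly b xi (x - t)))).
exists (corr_poly a chi b xi t); split; last exact: h.
exact: tpoly_corr.
Qed.

Lemma pair_limit_approx f g (c : G -> R[i]) : bap f -> bap g ->
  (forall t, mean n (fun x => f x * cj (g (x - t))) @[n --> \oo] -->
    (c t : R[i]^o)) -> forall e : R, 0 < e ->
  exists n (a : 'I_n -> R[i]) (chi : 'I_n -> G -> R[i])
    m (b : 'I_m -> R[i]) (xi : 'I_m -> G -> R[i]),
  [/\ forall i, character (chi i), forall j, character (xi j),
    \forall n \near \oo, absmean n (fun x => f x - tpoly a chi x) < e,
    \forall n \near \oo, absmean n (fun x => g x - tpoly b xi x) < e &
    forall t, nc (c t - corr_poly a chi b xi t) <= e].
Proof.
move=> bf bg hlim e e0.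
have [n [a [chi [m [b [xi [hc hx h1 h2 h]]]]]]] := pair_approx bf bg e0.
exists n, a, chi, m, b, xi; split => // t.
apply: (nc_le_lim (ccvgB (hlim t) (@tpoly_corr _ _ a chi b xi t hc hx))).
by apply: filterS (h t) => k /ltW.
Qed.

End PairCorrelation.

(** * Fourier-Bohr coefficients of correlations *)

Section Coefficients.
Variables (R : realType) (G : topologicalZmodType).
Hypothesis G_hd : hausdorff_space G.
Variable haar : radon R G.
Hypothesis haarP : is_haar haar.
Variable A : nat -> set G.
Hypothesis A_vh : van_hove haar A.
Implicit Types (mu nu : cmeasure R G) (K D : set G) (f g h p q chi xi phi psi : G -> R[i]).
Local Notation mean := (mean haar A).
Local Notation absmean := (absmean haar A).
Local Notation bap := (bap haar A).
Local Notation chi_mean := (@chi_mean R G).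

(** Only the pairs whose second character is [psi] survive; for them the orthogonality factor in
    [corr_coef] compares the first character with [psi], so the sum over pairs factorizes. *)
Lemma corr_poly_coef (I J : finType) (a : I -> R[i]) (chi : I -> G -> R[i])
    (b : J -> R[i]) (xi : J -> G -> R[i]) (psi : G -> R[i]) :
  (forall i, character (chi i)) -> (forall j, character (xi j)) ->
  character psi ->
  mean n (fun x => corr_poly a chi b xi x * cj (psi x)) @[n --> \oo] -->
    ((\sum_i a i * chi_mean (fun x => chi i x * cj (psi x))) *
     cj (\sum_j b j * chi_mean (fun x => xi j x * cj (psi x))) : R[i]^o).
Proof.
move=> hc hx hp.
have hk (k : I * J) : character (fun x => xi k.2 x * cj (psi x)).
  exact: character_cMJ.
have -> : (fun x => corr_poly a chi b xi x * cj (psi x)) =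
    tpoly (corr_coef a chi b xi) (fun k x => xi k.2 x * cj (psi x)).
  apply/funext => x; rewrite /corr_poly /tpoly mulr_suml.
  by apply: eq_bigr => k _; rewrite mulrA.
have -> : (\sum_i a i * chi_mean (fun x => chi i x * cj (psi x))) *
     cj (\sum_j b j * chi_mean (fun x => xi j x * cj (psi x))) =
    \sum_(k : I * J) corr_coef a chi b xi k *
      chi_mean (fun x => xi k.2 x * cj (psi x)).
  rewrite rmorph_sum /= big_distrlr /= pair_bigA /=.
  apply: eq_bigr => -[i j] _ /=; rewrite /corr_coef /=.
  rewrite {2 4}/chi_mean; case: asboolP => h.
    have -> : xi j = psi.
      apply/funext => x; have h1 := ncJM (character_nc x hp).
      by rewrite -[LHS]mulr1 -h1 [psi x * _]mulrC mulrA h mul1r.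
    by rewrite !mulr1; ring.
  by rewrite !mulr0 conjc0 mulr0.
exact: (@tpoly_mean _ _ G_hd _ haarP _ A_vh _ (corr_coef a chi b xi) _ hk).
Qed.

Lemma mean_diff_bound n f g (e : R) : cont f -> cont g ->
  absmean n (fun x => f x - g x) < e -> forall psi, character psi ->
  nc (mean n (fun x => f x * cj (psi x)) - mean n (fun x => g x * cj (psi x))) <
    2 * e.
Proof.
move=> cf cg h psi hp.
have cp : cont (fun x => cj (psi x)) := ccont_conj (character_cont hp).
rewrite -(meanB G_hd A_vh n (ccontM cf cp) (ccontM cg cp)).
have cB : cont (fun x => f x * cj (psi x) - g x * cj (psi x)).
  exact: ccontB (ccontM cf cp) (ccontM cg cp).
apply: le_lt_trans (nc_mean G_hd A_vh n cB) _.
rewrite ltr_pM2l//; apply: le_lt_trans h; rewrite -[leRHS]mul1r.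
apply: (absmean_le G_hd A_vh n cB (ccontB cf cg)) => x.
by rewrite -mulrBl Normc.normcM ncJ character_nc// mulr1 mul1r.
Qed.

Lemma coef_limit f g (c : G -> R[i]) psi (af ag : R[i]) : bap f -> bap g ->
  cont c ->
  (forall t, mean n (fun x => f x * cj (g (x - t))) @[n --> \oo] -->
    (c t : R[i]^o)) -> character psi ->
  mean n (fun x => f x * cj (psi x)) @[n --> \oo] --> (af : R[i]^o) ->
  mean n (fun x => g x * cj (psi x)) @[n --> \oo] --> (ag : R[i]^o) ->
  mean n (fun x => c x * cj (psi x)) @[n --> \oo] --> (af * cj ag : R[i]^o).
Proof.
move=> bf bg cc hlim hp haf hag; apply/ccvgP => e e0.
have [cf _ _] := bf; have [cg _ _] := bg.
(* Bounds the sum of all errors divided by [d]. As [d] is at most 1, the quadratic term [4 * d ^+ 2]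
   of the product estimate is at most [4 * d]. *)
pose N := 8 + 2 * (nc ag + 2) + 2 * nc af.
have N0 : 0 < N.
  by rewrite /N; have := nc_ge0 ag; have := nc_ge0 af; lra.
pose d := Num.min 1 (e / N).
have d0 : 0 < d by rewrite lt_min ltr01 divr_gt0.
have d1 : d <= 1 by rewrite ge_min lexx.
have dN : d * N <= e by rewrite -ler_pdivlMr// ge_min lexx orbT.
have [n [a [chi [m [b [xi [hc hx h1 h2 h3]]]]]]] := pair_limit_approx
   G_hd haarP A_vh bf bg hlim d0.
have cp := tpoly_cont a hc; have cq := tpoly_cont b hx.
pose P := \sum_i a i * chi_mean (fun x => chi i x * cj (psi x)).
pose Q := \sum_j b j * chi_mean (fun x => xi j x * cj (psi x)).
have limP (k : nat) (a' : 'I_k -> R[i]) (chi' : 'I_k -> G -> R[i]) :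
    (forall i, character (chi' i)) ->
    mean n (fun x => tpoly a' chi' x * cj (psi x)) @[n --> \oo] -->
    (\sum_i a' i * chi_mean (fun x => chi' i x * cj (psi x)) : R[i]^o).
  move=> hc'.
  have -> : (fun x => tpoly a' chi' x * cj (psi x)) =
      tpoly a' (fun i x => chi' i x * cj (psi x)).
    apply/funext => x; rewrite /tpoly mulr_suml.
    by apply: eq_bigr => i _; rewrite mulrA.
  apply: (@tpoly_mean _ _ G_hd _ haarP _ A_vh) => i.
  exact: character_cMJ.
have afP : nc (af - P) <= 2 * d.
  apply: (nc_le_lim (ccvgB haf (limP _ a chi hc))).
  by apply: filterS h1 => k h1; apply: ltW; exact: mean_diff_bound.
have agQ : nc (ag - Q) <= 2 * d.
  apply: (nc_le_lim (ccvgB hag (limP _ b xi hx))).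
  by apply: filterS h2 => k h2; apply: ltW; exact: mean_diff_bound.
have /ccvgP := @corr_poly_coef _ _ a chi b xi psi hc hx hp.
rewrite -/P -/Q => /(_ d d0); apply: filterS => k hk.
have ccp : cont (corr_poly a chi b xi) by apply: tpoly_cont => i; exact: hx.
have cps : cont (fun x => cj (psi x)) := ccont_conj (character_cont hp).
have cD : cont (fun x => (c x - corr_poly a chi b xi x) * cj (psi x)).
  exact: ccontM (ccontB cc ccp) cps.
have h4 : nc (mean k (fun x => c x * cj (psi x)) -
    mean k (fun x => corr_poly a chi b xi x * cj (psi x))) <= 2 * d.
  rewrite -(meanB G_hd A_vh k (ccontM cc cps) (ccontM ccp cps)).
  have -> : (fun x => c x * cj (psi x) - corr_poly a chi b xi x * cj (psi x)) =
      (fun x => (c x - corr_poly a chi b xi x) * cj (psi x)).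
    by apply/funext => x; rewrite mulrBl.
  apply: le_trans (nc_mean G_hd A_vh k cD) _; rewrite ler_wpM2l//.
  apply: (absmean_bound G_hd A_vh k cD) => x.
  by rewrite Normc.normcM ncJ character_nc// mulr1.
have h5 : nc (P * cj Q - af * cj ag) <= 2 * d * (nc ag + 2 * d) + nc af * (2 * d).
  have -> : P * cj Q - af * cj ag = (P - af) * cj Q + af * cj (Q - ag).
    by rewrite rmorphB; ring.
  apply: le_trans (le_normcD _ _) _; rewrite !Normc.normcM !ncJ.
  apply: lerD; last by rewrite ler_wpM2l ?nc_ge0// ncBC.
  apply: ler_pM; rewrite ?nc_ge0//; first by rewrite ncBC.
  have := nc_le_sub Q ag; rewrite ncBC; lra.
apply: le_lt_trans (nc_dist_tri _ (mean k (fun x => corr_poly a chi b xi x * cj (psi x))) _) _.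
have := nc_dist_tri (mean k (fun x => corr_poly a chi b xi x * cj (psi x)))
  (P * cj Q) (af * cj ag) => h6.
apply: lt_le_trans dN.
have := nc_ge0 ag; have := nc_ge0 af; move: h4 h5 h6 hk.
set x1 := nc (mean k _ - mean k _); set x2 := nc (P * _ - _).
set x3 := nc (mean k _ - af * _); set x4 := nc (mean k _ - _) => h4 h5 h6 hk p1 p2.
rewrite /N; nra.
Qed.

End Coefficients.

(** * The limit of the twisted convolutions *)

Section TwistLimit.
Variables (R : realType) (G : topologicalZmodType).
Hypothesis G_lc : locally_compact [set: G].
Hypothesis G_hd : hausdorff_space G.
Variable haar : radon R G.
Hypothesis haarP : is_haar haar.
Variable A : nat -> set G.
Hypothesis A_vh : van_hove haar A.
Implicit Types (mu nu : cmeasure R G) (K D : set G) (f g h p q chi xi phi psi : G -> R[i]).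
Local Notation hint := (cm_int (cm_of_radon haar)).
Local Notation mean := (mean haar A).
Local Notation bap := (bap haar A).
Let rA n := vh_relc A_vh n.

Lemma bndr_mul_cvg K (C : R) : compact K -> forall e : R, 0 < e ->
  \forall n \near \oo, C * bndr haar A K n < e.
Proof.
move=> cK e e0; have C0 : 0 < `|C| + 1 by rewrite ltr_wpDl.
have e1 : 0 < e / (`|C| + 1) by rewrite divr_gt0.
apply: filterS (bndr_cvg G_hd A_vh cK e1) => n; rewrite ltr_pdivlMr// mulrC => h.
have b0 := bndr_ge0 haar A K n; apply: le_lt_trans h.
apply: ler_wpM2r => //; apply: le_trans (ler_norm _) _.
by rewrite lerDl.
Qed.

Lemma conv_fun_bap mu K phi : tb_fun mu -> besicovitch_ap haar A mu ->
  symk K -> cont phi -> (forall x, ~ K x -> phi x = 0) -> bap (conv_fun mu phi).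
Proof.
move=> tmu bmu sK cphi phi0; have [cK _ _] := sK.
apply: (Bap2_bap G_hd A_vh); last first.
- exact/bmu/(cont_Cc G_hd cphi cK phi0).
- have [C C0 hC] := tmu K cK; have [M [M0 hM]] := bounded_compact cphi cK.
  exists (C * M); apply: (conv_fun_bound sK hC cphi phi0) => x.
  have [Kx|nK] := pselect (K x); first exact: hM.
  by rewrite phi0// Normc.normc0.
- exact: (conv_fun_cont G_lc G_hd mu cphi cK phi0).
Qed.

(** Integrating [chi (t - x) * beta (t - x)] against the conjugate of [chi t] gives [c] times the
    conjugate of [chi x]. So smearing by [chi] times [beta] multiplies the coefficient by [c], up to
    the boundary term of [swap_estimate]. *)
Lemma fb_limit mu K (beta chi : G -> R[i]) (c l : R[i]) : tb_fun mu ->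
  symk K -> cont beta -> (forall x, ~ K x -> beta x = 0) ->
  hint K beta = c -> c != 0 -> character chi ->
  mean n (fun t => conv_fun mu (fun x => chi x * beta x) t * cj (chi t))
    @[n --> \oo] --> (l : R[i]^o) ->
  fb_mean haar A mu chi n @[n --> \oo] --> (l / c : R[i]^o).
Proof.
move=> tmu sK cb b0 hc c0 hchi hl; have [cK K0 _] := sK.
have cchi := character_cont hchi.
pose phi x := chi x * beta x; have cphi : cont phi := ccontM cchi cb.
have phi0 x : ~ K x -> phi x = 0 by move=> /b0; rewrite /phi => ->; rewrite mulr0.
have [M [M0 hM]] := bounded_compact cphi cK.
have phiM x : nc (phi x) <= M.
  have [Kx|nK] := pselect (K x); first exact: hM.
  by rewrite phi0// Normc.normc0.
have [C C0 hC] := tmu K cK.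
have ccj : cont (fun x => cj (chi x)) := ccont_conj cchi.
have cj1 x : nc (cj (chi x)) <= 1 by rewrite ncJ character_nc.
have key n : nc (c * fb_mean haar A mu chi n -
    mean n (fun t => conv_fun mu phi t * cj (chi t))) <=
    4 * (C * M * 1) * bndr haar A K n.
  have rW := sumset_relc A_vh n cK.
  have := swap_estimate G_lc G_hd A_vh n sK hC C0 cphi phi0 phiM ccj cj1.
  have -> : cm_int mu (A n) (fun x => hint (sumset (A n) K)
      (fun t => phi (t - x) * cj (chi t))) = c * cm_int mu (A n) (fun s => cj (chi s)).
    rewrite -(cm_intZ G_hd mu c (rA n) ccj); apply: eq_cm_int => x Ax.
    have cbx : cont (fun t => beta (t - x)).
      by apply: (ccont_comp (g := fun t : G => t + - x)) cb; exact: contG_shift.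
    rewrite mulrC -hc -(hint_shift G_hd haarP (- x) (relc_compact G_hd cK) cb).
    rewrite -(@cm_int_mkcond _ _ _ [set t | K (t - x)] (sumset (A n) K)).
    - rewrite -(cm_intZ G_hd _ _ rW cbx); apply: eq_cm_int => t _.
      rewrite /phi (characterD _ _ hchi) (characterN _ hchi).
      have h1 := ncJM (character_nc t hchi).
      transitivity (chi t * cj (chi t) * (cj (chi x) * beta (t - x))); first by ring.
      by rewrite h1 mul1r.
    - by move=> t /= Ktx; exists x => //; exists (t - x) => //; rewrite addrC subrK.
    - by move=> t _ nK; rewrite b0.
  move=> h; rewrite /fb_mean /mean [c * _]mulrCA -mulrBr Normc.normcM ncR.
  have v0 := vol_gt0 G_hd A_vh n.
  rewrite gtr0_norm ?invr_gt0// [leLHS]mulrC /bndr [leRHS]mulrA.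
  by rewrite ler_wpM2r// invr_ge0 ltW.
have lim1 : c * fb_mean haar A mu chi n @[n --> \oo] --> (l : R[i]^o).
  apply: (ccvg_near hl) => e e0.
  apply: filterS (bndr_mul_cvg (4 * (C * M * 1)) cK e0) => n hn.
  exact: le_lt_trans (key n) hn.
have := @ccvgMl _ (fun n => c * fb_mean haar A mu chi n) c^-1 l lim1.
rewrite mulrC; under [X in X @ _]eq_fun do rewrite mulrA mulVf// mul1r.
by [].
Qed.

Definition twist_mean mu nu n phi : R[i] :=
  ((vol haar (A n))^-1)%:C * twist mu nu (A n) phi.

Lemma twist_mean_eberlein mu nu n phi : cont phi ->
  ((vol haar (A n))^-1)%:C * conv_restr mu (A n) (tilde nu) [set - x | x in A n] phi
  = twist_mean mu nu n phi.
Proof. by move=> cphi; rewrite (conv_restr_twist G_hd mu nu (rA n) cphi). Qed.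

Lemma conv_fun_shift nu psi t x :
  conv_fun nu (fun y => psi (y - t)) x = conv_fun nu psi (x - t).
Proof. by apply: eq_cm_int => s _; rewrite addrAC. Qed.

(** The shift is moved into [psi], and the compact set is enlarged to hold the translated support.
    The constants of [product_estimate] may then depend on [t], which is fixed here. *)
Lemma corr_limit mu nu K phi psi (c : R[i]) t : tb_fun mu -> tb_fun nu ->
  symk K -> cont phi -> (forall x, ~ K x -> phi x = 0) ->
  cont psi -> (forall x, ~ K x -> psi x = 0) ->
  mean n (fun x => conv_fun mu phi x * cj (conv_fun nu psi (x - t)))
    @[n --> \oo] --> (c : R[i]^o) ->
  twist_mean mu nu n (fun u => corr haar K phi psi (u - t)) @[n --> \oo] -->
    (c : R[i]^o).
Proof.
move=> tmu tnu sK cphi phi0 cpsi psi0 hc; have [cK K0 oK] := sK.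
have cKt : compact (K `|` [set t + x | x in K]).
  by apply: compactU => //; exact: compact_shift.
have [L sL KL] := symk_hull cKt; have [cL L0 oL] := sL.
pose psit x := psi (x - t).
have cpsit : cont psit.
  by apply: (ccont_comp (g := fun t' : G => t' + - t)) cpsi; exact: contG_shift.
have phi0L x : ~ L x -> phi x = 0.
  by move=> nL; apply: phi0 => Kx; apply: nL; apply: KL; left.
have psi0L x : ~ L x -> psit x = 0.
  move=> nL; apply: psi0 => Kx; apply: nL; apply: KL; right.
  by exists (x - t) => //; rewrite addrC subrK.
have [C C0 hC] := tmu L cL; have [C' C'0 hC'] := tnu L cL.
have bd (f : G -> R[i]) : cont f -> (forall x, ~ L x -> f x = 0) ->
    exists M : R, forall x, nc (f x) <= M.
  move=> cf f0; have [M [M0 hM]] := bounded_compact cf cL; exists M => x.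
  have [Kx|nK] := pselect (L x); first exact: hM.
  by rewrite f0// Normc.normc0.
have [M hM] := bd _ cphi phi0L; have [M' hM'] := bd _ cpsit psi0L.
have corrE : (fun u => corr haar K phi psi (u - t)) = corr haar L phi psit.
  apply/funext => u; rewrite /corr; apply/esym.
  rewrite (@cm_int_mkcond _ _ _ K L); first last.
  - by move=> x _ nK; rewrite phi0// mul0r.
  - by move=> x Kx; apply: KL; left.
  by apply: eq_cm_int => x _; rewrite /psit addrA.
rewrite corrE; apply: (ccvg_near hc) => e e0.
apply: filterS (bndr_mul_cvg (8 * (C * M * (C' * M'))) cL e0) => n hn.
apply: le_lt_trans hn.
have := product_estimate G_lc G_hd haarP A_vh n sL hC C0 hC' C'0 cphi phi0L hM
  cpsit psi0L hM'.
have v0 := vol_gt0 G_hd A_vh n.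
have -> : hint (A n) (fun x => conv_fun mu phi x * cj (conv_fun nu psit x)) =
    hint (A n) (fun x => conv_fun mu phi x * cj (conv_fun nu psi (x - t))).
  by apply: eq_cm_int => x _; rewrite conv_fun_shift.
move=> h; rewrite /twist_mean /mean -mulrBr Normc.normcM ncR.
rewrite gtr0_norm ?invr_gt0// [leLHS]mulrC /bndr [leRHS]mulrA.
by rewrite ler_wpM2r// invr_ge0 ltW.
Qed.

Lemma corr_support K phi psi (D E : set G) : (forall x, ~ D x -> phi x = 0) ->
  (forall x, ~ E x -> psi x = 0) ->
  forall u, ~ sumset E [set - x | x in D] u -> corr haar K phi psi u = 0.
Proof.
move=> phi0 psi0 u nu; rewrite /corr.
rewrite (@eq_cm_int _ _ _ _ _ (fun=> 0)); last first.
  move=> t _; have [Dt|nD] := pselect (D t); last by rewrite phi0// mul0r.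
  rewrite psi0 ?conjc0 ?mulr0// => Etu; apply: nu; exists (t + u) => //.
  by exists (- t); [exists t|rewrite addrAC subrr add0r].
rewrite (@cm_int_mkcond _ _ _ set0)//.
by rewrite cm_of_radonE /cint /Rintegral !integral_set0.
Qed.

(* Take for b a normalized bump at 0 and for psi the conjugate of phi. *)
Lemma corr_dense phi K0 : cont phi -> compact K0 ->
  (forall x, ~ K0 x -> phi x = 0) ->
  exists2 L, compact L & (forall x, ~ L x -> phi x = 0) /\
  forall e : R, 0 < e -> exists K (b : G -> R[i]) (psi : G -> R[i]),
    [/\ symk K, cont b /\ (forall x, ~ K x -> b x = 0),
        cont psi /\ (forall x, ~ K x -> psi x = 0),
        (forall u, ~ L u -> corr haar K b psi u = 0) &
        forall u, nc (phi u - corr haar K b psi u) <= e].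
Proof.
move=> cphi cK0 phi0.
(* [U0] is fixed before [e], and all bumps vanish off [U0]; so [L] serves every [e]. *)
have [U0 [oU0 pU0] U00] := precompact_nbhs G_lc (0 : G).
have cU0 : compact (closure U0) by rewrite -precompactE.
pose L := sumset K0 [set - x | x in closure U0].
have cL : compact L by apply: compact_sumset => //; exact: compact_opp.
exists L => //; split.
  move=> x nL; apply: phi0 => Kx; apply: nL; exists x => //.
  exists 0; rewrite ?addr0//; exists 0; last by rewrite oppr0.
  exact: subset_closure.
move=> e e0.
(* Half of [e], since [hint_nc] loses a factor 2. *)
have e20 : 0 < e / 2 by rewrite divr_gt0.
have [U nU hU] := Cc_ucont cphi cK0 phi0 e20.
have nUU : nbhs 0 (U `&` U0).
  by apply: filterI => //; exact: open_nbhs_nbhs.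
have [b [K1 [cb b01 bs sK1 [bU bK [c c0 hc]]]]] :=
  bump_exists G_lc G_hd haarP A_vh nUU.
have [cK1 _ _] := sK1.
have cK01 : compact (K0 `|` K1) by exact: compactU.
have [K sK KK] := symk_hull cK01; have [cK _ _] := sK.
pose b' x := (b x / c)%:C; pose psi x := cj (phi x).
have cbr : rcont (fun x => b x / c) by apply: (rcontM cb); exact: rcont_cst.
have cb' : cont b' := ccont_R cbr.
have cpsi : cont psi := ccont_conj cphi.
have b'0 x : ~ K x -> b' x = 0.
  by move=> nK; rewrite /b' bK ?mul0r// => Kx; apply: nK; apply: KK; right.
have b'U x : ~ (U `&` U0) x -> b' x = 0 by move=> nUx; rewrite /b' bU// mul0r.
have psi0 x : ~ K x -> psi x = 0.
  move=> nK; rewrite /psi phi0 ?conjc0// => Kx; apply: nK; apply: KK; by left.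
exists K, b', psi; split => //.
  apply: corr_support.
  - move=> x ncl; apply: b'U => -[_ U0x]; apply: ncl; exact: subset_closure.
  - by move=> x /phi0 h; rewrite /psi h conjc0.
move=> u; have rK := relc_compact G_hd cK.
have hb : hint K b' = 1.
  have -> : b' = (fun x => c^-1%:C * (b x)%:C).
    by apply/funext => x; rewrite /b' mulrC rmorphM.
  rewrite (cm_intZ G_hd _ _ rK (ccont_R cb)).
  rewrite (@cm_int_mkcond _ _ _ K1 K).
  - by rewrite hc -rmorphM /= mulVf// gt_eqF.
  - by move=> x Kx; apply: KK; right.
  - by move=> x _ nK; rewrite bK.
have cphiu : cont (fun t => phi (t + u)).
  by apply: (ccont_comp (g := fun t : G => t + u)) cphi; exact: contG_shift.
have cd : cont (fun t => b' t * (phi u - phi (t + u))).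
  by apply: (ccontM cb'); apply: (ccontB _ cphiu); exact: ccont_cst.
have -> : phi u - corr haar K b' psi u = hint K (fun t => b' t * (phi u - phi (t + u))).
  have -> : (fun t => b' t * (phi u - phi (t + u))) =
      (fun t => phi u * b' t - b' t * cj (psi (t + u))).
    by apply/funext => t; rewrite /psi conjcK; ring.
  rewrite (cm_intB G_hd _ rK).
  - by rewrite (cm_intZ G_hd _ _ rK cb') hb mulr1.
  - by apply: (ccontM _ cb'); exact: ccont_cst.
  - apply: (ccontM cb'); apply: ccont_conj.
    by apply: (ccont_comp (g := fun t : G => t + u)) cpsi; exact: contG_shift.
apply: le_trans (hint_nc G_hd haar rK cd) _.
have -> : e = 2 * (e / 2) by field.
rewrite ler_wpM2l//.
have <- : \int[haar]_(x in K) (e / 2 * (b x / c)) = e / 2.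
  rewrite (RintegralZ_relc G_hd haar (e / 2) rK cbr).
  have : complex.Re (hint K b') = 1 by rewrite hb.
  by rewrite cm_of_radonE /cint /= => ->; rewrite mulr1.
have cer : rcont (fun x => e / 2 * (b x / c)).
  by apply: (rcontM _ cbr); exact: rcont_cst.
apply: (le_Rintegral_relc G_hd _ rK (ccont_nc cd) cer) => t _.
have bc0 : 0 <= b t / c by case/andP: (b01 t) => b0 _; rewrite divr_ge0// ltW.
rewrite Normc.normcM /b' ncR ger0_norm// mulrC.
have [Ut|nUt] := pselect ((U `&` U0) t); last by rewrite bU// mul0r !mulr0.
rewrite ler_wpM2r// ncBC ltW//; apply: hU.
by rewrite addrK; case: Ut.
Qed.

Lemma twist_meanB mu nu n phi psi : cont phi -> cont psi ->
  twist_mean mu nu n (fun x => phi x - psi x) =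
  twist_mean mu nu n phi - twist_mean mu nu n psi.
Proof.
by move=> cphi cpsi; rewrite /twist_mean (twistB G_hd mu nu (rA n) cphi cpsi) mulrBr.
Qed.

Lemma twist_mean_bound mu nu : tb_fun mu -> tb_fun nu -> forall K, compact K ->
  exists2 C : R, 0 <= C &
  \forall n \near \oo, forall (t : G) phi (s : R), cont phi ->
    (forall x, ~ K (x - t) -> phi x = 0) -> (forall x, nc (phi x) <= s) ->
    nc (twist_mean mu nu n phi) <= C * s.
Proof.
move=> tmu tnu K cK.
have [C C0 hC] := twist_bound G_lc G_hd haarP A_vh tmu tnu cK.
exists C => //; apply: filterS hC => n hn t phi s cphi phi0 phis.
have v0 := vol_gt0 G_hd A_vh n.
rewrite /twist_mean Normc.normcM ncR gtr0_norm ?invr_gt0// mulrC ler_pdivrMr//.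
exact: (hn t).
Qed.

(** All approximating correlations vanish off the same [L], so the constant [C] is fixed before the
    tolerance, and replacing [phi] costs at most [C] times the uniform error for all large [n]. *)
Lemma twist_mean_cvg mu nu phi : tb_fun mu -> tb_fun nu ->
  besicovitch_ap haar A mu -> besicovitch_ap haar A nu -> Cc phi ->
  exists l : R[i], twist_mean mu nu n phi @[n --> \oo] --> (l : R[i]^o).
Proof.
move=> tmu tnu bmu bnu /Cc_cont[cphi [K0 cK0 phi0]].
have [L cL [phiL hL]] := corr_dense cphi cK0 phi0.
have [C C0 hC] := twist_mean_bound tmu tnu cL.
apply: ccvg_approx => e e0.
have C1 : 0 < C + 1 by rewrite ltr_wpDl.
have e1 : 0 < e / (C + 1) / 2 by rewrite !divr_gt0.
have [K [b [psi [sK [cb b0] [cpsi psi0] cL0 hd]]]] := hL _ e1.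
have [cK _ _] := sK.
have bf := conv_fun_bap tmu bmu sK cb b0.
have bg := conv_fun_bap tnu bnu sK cpsi psi0.
have [c hc] := pair_limit G_hd haarP A_vh bf bg.
have := corr_limit tmu tnu sK cb b0 cpsi psi0 (hc 0).
have -> : (fun u => corr haar K b psi (u - 0)) = corr haar K b psi.
  by apply/funext => u; rewrite subr0.
move=> hl; exists (fun n => twist_mean mu nu n (corr haar K b psi)), (c 0).
split => //; apply: filterS hC => n hn.
have ccor := corr_cont G_hd haar (relc_compact G_hd cK) cb cpsi.
rewrite -twist_meanB//.
apply: le_lt_trans (hn 0 _ (e / (C + 1) / 2) (ccontB cphi ccor) _ hd) _.
  by move=> x; rewrite subr0 => nL; rewrite phiL// cL0// subrr.
have -> : C * (e / (C + 1) / 2) = e * (C / (C + 1) / 2) by ring.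
rewrite gtr_pMr// ltr_pdivrMr// ltr_pdivrMr// mul1r; lra.
Qed.

End TwistLimit.

(** * Uniform limits of trigonometric polynomials *)

Section UniformLimits.
Variables (R : realType) (G : topologicalZmodType).
Implicit Types (f g h chi : G -> R[i]).

Lemma bounded_ucontinuous_limit f :
  (forall e : R, 0 < e -> exists2 g, bounded_ucontinuous g &
    forall x, nc (f x - g x) <= e) -> bounded_ucontinuous f.
Proof.
move=> h; split.
  have [g [[M gM] _] fg] := h 1 ltr01; exists (1 + M) => x.
  by apply: le_trans (nc_le_sub _ (g x)) _; exact: lerD.
move=> e e0; have e30 : 0 < e / 3 by rewrite divr_gt0.
have [g [_ /(_ _ e30)[U nU hU]] fg] := h _ e30; exists U => // x y Uxy.
have := nc_dist_tri (f x) (g x) (f y); have := nc_dist_tri (g x) (g y) (f y).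
have := hU _ _ Uxy; have := fg x; have := fg y; rewrite (ncBC (g y)).
by move=> h1 h2 h3 h4 h5; lra.
Qed.

Lemma bounded_ucontinuousD f g : bounded_ucontinuous f ->
  bounded_ucontinuous g -> bounded_ucontinuous (fun x => f x + g x).
Proof.
move=> [[M hM] uf] [[N hN] ug]; split.
  by exists (M + N) => x; apply: le_trans (le_normcD _ _) _; exact: lerD.
move=> e e0; have e20 : 0 < e / 2 by rewrite divr_gt0.
have [U nU hU] := uf _ e20; have [V nV hV] := ug _ e20.
exists (U `&` V); first exact: filterI.
move=> x y [/hU h1 /hV h2].
have -> : f x + g x - (f y + g y) = (f x - f y) + (g x - g y) by ring.
by apply: le_lt_trans (le_normcD _ _) _; rewrite [ltRHS]splitr; exact: ltrD.
Qed.

Lemma character_ucontinuous (c : R[i]) chi : character chi ->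
  bounded_ucontinuous (fun x => c * chi x).
Proof.
move=> hc; split.
  by exists (nc c) => x; rewrite Normc.normcM character_nc// mulr1.
move=> e e0; have c1 : 0 < nc c + 1 by rewrite ltr_wpDl// nc_ge0.
have e1 : 0 < e / (nc c + 1) by rewrite divr_gt0.
exists [set z | nc (chi z - chi 0) < e / (nc c + 1)].
  exact: (contE (character_cont hc)).
move=> x y /=; rewrite character0// => h.
have -> : c * chi x - c * chi y = c * (chi (x - y) - 1) * chi y.
  by rewrite -{1}[x](subrK y) (characterD _ _ hc); ring.
rewrite !Normc.normcM character_nc// mulr1.
apply: (@le_lt_trans _ _ (nc c * (e / (nc c + 1)))).
  by rewrite ler_wpM2l ?nc_ge0// ltW.
by rewrite mulrCA gtr_pMr// ltr_pdivrMr// mul1r ltrDl.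
Qed.

Lemma trig_poly_ucontinuous f : trig_poly f -> bounded_ucontinuous f.
Proof.
move=> [n [c [chi [hc ->]]]].
elim: (index_enum _) => [|i r ih].
  under eq_fun do rewrite big_nil.
  split; first by exists 0 => x; rewrite Normc.normc0.
  by move=> e e0; exists setT => [|x y _]; [exact: filterT|rewrite subrr Normc.normc0].
under eq_fun do rewrite big_cons.
apply: bounded_ucontinuousD ih; exact: character_ucontinuous.
Qed.

Definition unif_ap f := forall e : R, 0 < e ->
  exists2 p, trig_poly p & forall x, nc (f x - p x) <= e.

Lemma unif_ap_ucontinuous f : unif_ap f -> bounded_ucontinuous f.
Proof.
move=> h; apply: bounded_ucontinuous_limit => e /h[p tp fp].
by exists p => //; exact: trig_poly_ucontinuous.
Qed.

Lemma nbhs_uniformP (u : G -> R[i]) (P : set (G -> R[i])) :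
  nbhs (u : {uniform G -> R[i]^o}) P <->
  exists2 e : R, 0 < e & [set v | forall x, nc (v x - u x) < e] `<=` P.
Proof.
split.
  move=> /uniform_nbhs[E [+ EP]]; rewrite -entourage_ballE => -[e /= e0 eE].
  (* A positive element of [R[i]] is real, so its real part is the radius. *)
  have e0' : 0 < complex.Re e by move: e0; rewrite ltcE => /andP[].
  exists (complex.Re e) => // v hv; apply: EP => x _ /=; apply: eE => /=.
  rewrite -ball_normE /ball_ /= nc_norm ltcE /= ncBC hv andbT.
  by move: e0; rewrite ltcE => /andP[].
move=> [e e0 eP]; apply/uniform_nbhs.
exists [set xy : R[i]^o * R[i]^o | ball xy.1 (e%:C) xy.2]; split.
  by rewrite -entourage_ballE; exists e%:C => //=; rewrite ltcR.
move=> v /= hv; apply: eP => x /=; have := hv x I.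
by rewrite -ball_normE /ball_ /= nc_norm ltcR ncBC.
Qed.

(** A cluster point of the image in a compact segment is a limit, because an ultrafilter contains
    each set or its complement. *)
Lemma ultra_bounded_limit (T : Type) (F : set_system T) (r : T -> R) (B : R) :
  UltraFilter F -> F [set v | `|r v| <= B] ->
  exists l : R, forall e : R, 0 < e -> F [set v | `|r v - l| < e].
Proof.
move=> UF FB; have PF := @ultra_proper _ _ UF.
have cB : compact [set` `[- B, B]] := @segment_compact _ _ _.
have FrB : (r @ F) [set` `[- B, B]].
  change (F [set v | r v \in `[- B, B]]).
  by apply: filterS FB => v /= h; rewrite in_itv/= -ler_norml.
have [l [_ cl]] := cB (r @ F) _ FrB.
exists l => e e0.
have [//|hC] := in_ultra_setVsetC [set v | `|r v - l| < e] UF.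
have FC : (r @ F) [set y | ~ (`|y - l| < e)] by [].
have nl : nbhs l (ball l e) by exact: nbhsx_ballx.
have [y [/= h1 h2]] := cl _ _ FC nl.
by exfalso; apply: h1; move: h2; rewrite /ball /= distrC.
Qed.

Lemma ultra_bounded_climit (T : Type) (F : set_system T) (r : T -> R[i]) (B : R) :
  UltraFilter F -> F [set v | nc (r v) <= B] ->
  exists l : R[i], forall e : R, 0 < e -> F [set v | nc (r v - l) < e].
Proof.
move=> UF FB; have PF := @ultra_proper _ _ UF.
have [|a ha] := @ultra_bounded_limit T F (fun v => complex.Re (r v)) B UF _.
  by apply: filterS FB => v /=; apply: le_trans; exact: nc_Re.
have [|b hb] := @ultra_bounded_limit T F (fun v => complex.Im (r v)) B UF _.
  by apply: filterS FB => v /=; apply: le_trans; exact: nc_Im.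
exists (a +i* b) => e e0; have e20 : 0 < e / 2 by rewrite divr_gt0.
apply: filterS2 (ha _ e20) (hb _ e20) => v /= h1 h2.
apply: le_lt_trans (nc_ReIm _) _; move: h1 h2; case: (r v) => c d /= h1 h2.
by rewrite [ltRHS]splitr; exact: ltrD.
Qed.

Lemma translate_trig n (a : 'I_n -> R[i]) (chi : 'I_n -> G -> R[i]) t x :
  (forall i, character (chi i)) ->
  tpoly a chi (x - t) = \sum_i a i * chi i (- t) * chi i x.
Proof.
move=> hc; apply: eq_bigr => i _; rewrite (characterD _ _ (hc i)); ring.
Qed.

(** A translate of a trigonometric polynomial is determined by the finitely many values of its
    characters at the shift, and these converge along any ultrafilter. So an ultrafilter on the hull
    of [f] is, for each [e], concentrated within [e] of one function; it is Cauchy and converges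
    uniformly. *)
Lemma unif_ap_sap f : unif_ap f -> sap_fun f.
Proof.
move=> uf; have buf := unif_ap_ucontinuous uf; split => //.
set K0 := (X in compact X).
have K0P v : K0 v -> forall e : R, 0 < e ->
    exists t, forall x, nc (v x - translate t f x) < e.
  move=> [clv _] e e0.
  have nv : nbhs (v : {uniform G -> R[i]^o}) [set w | forall x, nc (w x - v x) < e].
    by apply/nbhs_uniformP; exists e.
  have [w [[t _ <-] hw]] := clv _ nv; exists t => x.
  by rewrite ncBC; exact: hw.
have [[B hB] _] := buf.
rewrite compact_ultra => F UF FK; have PF := @ultra_proper _ _ UF.
have fin e : 0 < e -> exists w : G -> R[i], F [set v | forall x, nc (v x - w x) <= e].
  move=> e0; have e30 : 0 < e / 3 by rewrite divr_gt0.
  have [p /trig_polyP[n [a [chi [hc pE]]]] fp] := uf _ e30.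
  (* A shift is chosen for each [v], so that the values of the characters become functions on the
     space where the ultrafilter lives. *)
  have /choice[tt htt] : forall v : G -> R[i], exists t, K0 v ->
      forall x, nc (v x - translate t f x) < e / 3.
    move=> v; have [/K0P /(_ _ e30) [t ht]|nK] := pselect (K0 v); first by exists t.
    by exists 0.
  have /choice[l hl] : forall i, exists l : R[i], forall d : R, 0 < d ->
      F [set v | nc (chi i (- tt v) - l) < d].
    move=> i; apply: (@ultra_bounded_climit _ F _ 1 UF).
    by apply: filterS filterT => v _ /=; rewrite character_nc.
  pose M := \sum_i nc (a i) + 1.
  have M0 : 0 < M by rewrite ltr_wpDl// sumr_ge0// => i _; exact: nc_ge0.
  have d0 : 0 < e / 3 / M by rewrite !divr_gt0.
  exists (fun x => \sum_i a i * l i * chi i x).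
  have Fall : F [set v | forall i, nc (chi i (- tt v) - l i) < e / 3 / M].
    apply: (@filter_forall _ _
      (fun i => [set v | nc (chi i (- tt v) - l i) < e / 3 / M]) F) => i.
    exact: hl.
  apply: filterS2 FK Fall => v Kv hv x.
  have h1 := htt v Kv x.
  have h2 : nc (translate (tt v) f x - p (x - tt v)) <= e / 3 by exact: fp.
  have h3 : nc (p (x - tt v) - \sum_i a i * l i * chi i x) <= e / 3.
    rewrite pE translate_trig// -sumrB.
    apply: le_trans (nc_sum _ _ _) _.
    apply: (@le_trans _ _ (\sum_i nc (a i) * (e / 3 / M))).
      apply: ler_sum => i _; rewrite -mulrBl -mulrBr !Normc.normcM character_nc//.
      by rewrite mulr1 ler_wpM2l ?nc_ge0// ltW.
    rewrite -mulr_suml mulrCA; apply: ler_piMr; first exact: ltW.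
    by rewrite ler_pdivrMr// mul1r /M lerDl ler01.
  have := nc_dist_tri (v x) (translate (tt v) f x) (\sum_i a i * l i * chi i x).
  have := nc_dist_tri (translate (tt v) f x) (p (x - tt v)) (\sum_i a i * l i * chi i x).
  by move=> h4 h5; lra.
(* The pointwise limit along the ultrafilter; concentration around a single [w] makes it a uniform
   limit. *)
have /choice[u hu] : forall x, exists l : R[i], forall e : R, 0 < e ->
    F [set v : G -> R[i] | nc (v x - l) < e].
  move=> x; apply: (@ultra_bounded_climit _ F (fun v : G -> R[i] => v x) (1 + B) UF).
  apply: filterS FK => v Kv /=; have [t ht] := K0P v Kv 1 ltr01.
  apply: le_trans (nc_le_sub _ (translate t f x)) _.
  by apply: lerD; [exact: ltW|exact: hB].
have ucv e : 0 < e -> F [set v | forall x, nc (v x - u x) < e].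
  move=> e0; have e40 : 0 < e / 4 by rewrite divr_gt0.
  have [w hw] := fin _ e40.
  apply: filterS (hw) => v hv x.
  have uw : nc (u x - w x) <= e / 4 + e / 4.
    have [v' [/= h1 h2]] := @filter_ex _ F _ _ (filterI (hu x _ e40) hw).
    apply: le_trans (nc_dist_tri _ (v' x) _) _; apply: lerD; last exact: h2.
    by rewrite ncBC ltW.
  have := nc_dist_tri (v x) (w x) (u x); have := hv x; rewrite (ncBC (w x)).
  by move=> h1 h2; lra.
(* The closure is taken inside C_u(G), so the limit has to stay there. *)
have buu : bounded_ucontinuous u.
  apply: bounded_ucontinuous_limit => e e0.
  have [v [[_ bv] hv]] := @filter_ex _ F _ _ (filterI FK (ucv e e0)).
  by exists v => // x; rewrite ncBC ltW.
exists u; split.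
  split => // P /nbhs_uniformP[e e0 eP]; have e20 : 0 < e / 2 by rewrite divr_gt0.
  have [v [Kv hv]] := @filter_ex _ F _ _ (filterI FK (ucv _ e20)).
  have [t ht] := K0P v Kv _ e20.
  exists (translate t f); split; first by exists t.
  apply: eP => x; have := nc_dist_tri (translate t f x) (v x) (u x).
  have := hv x; have := ht x; rewrite (ncBC (v x) (translate t f x)).
  by move=> h1 h2 h3; lra.
move=> P /nbhs_uniformP[e e0 eP]; apply: filterS (ucv e e0) => v; exact: eP.
Qed.

End UniformLimits.

(** * The Riesz representation theorem *)

Section Cone.
Variables (R : realType) (G : topologicalZmodType).
Hypothesis G_sc : @second_countable G.
Hypothesis G_lc : locally_compact [set: G].
Hypothesis G_hd : hausdorff_space G.
Implicit Types (f g h : G -> R) (U V K : set G).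

(** The cone of nonnegative functions in C_c(G). Functionals are only given on this cone, where the
    positive part of a real functional is defined directly. *)
Variant ccp f : Prop :=
  CCP of rcont f & (forall x, 0 <= f x) &
    (exists2 K, compact K & forall x, ~ K x -> f x = 0).

Lemma ccp_cont f : ccp f -> rcont f. Proof. by case. Qed.

Lemma ccp_ge0 f x : ccp f -> 0 <= f x. Proof. by case. Qed.

Lemma ccp0 : ccp (fun=> 0).
Proof.
split => //; first exact: rcont_cst.
by exists set0 => //; exact: compact0.
Qed.

Lemma ccpD f g : ccp f -> ccp g -> ccp (fun x => f x + g x).
Proof.
move=> [cf f0 [K cK fK]] [cg g0 [L cL gL]]; split; first exact: rcontD.
  by move=> x; exact: addr_ge0.
exists (K `|` L); first exact: compactU.
by move=> x nKL; rewrite fK ?gL ?addr0// => h; apply: nKL; [right|left].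
Qed.

Lemma ccpZ (a : R) f : 0 <= a -> ccp f -> ccp (fun x => a * f x).
Proof.
move=> a0 [cf f0 [K cK fK]]; split.
- by apply: rcontM cf; exact: rcont_cst.
- by move=> x; exact: mulr_ge0.
- by exists K => // x /fK ->; rewrite mulr0.
Qed.

Lemma rcont_max f g : rcont f -> rcont g -> rcont (fun x => Num.max (f x) (g x)).
Proof.
move=> [cf] [cg]; split => x; apply: (@continuous_max _ _ f g x); first exact: cf.
exact: cg.
Qed.

Lemma rcont_min f g : rcont f -> rcont g -> rcont (fun x => Num.min (f x) (g x)).
Proof.
move=> [cf] [cg]; split => x; apply: (@continuous_min _ _ f g x); first exact: cf.
exact: cg.
Qed.

Lemma ccp_le f g : rcont f -> ccp g -> (forall x, 0 <= f x <= g x) -> ccp f.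
Proof.
move=> cf [cg g0 [K cK gK]] fg; split => //; first by move=> x; case/andP: (fg x).
exists K => // x /gK h; have /andP[f0 f1] := fg x.
by apply/eqP; rewrite eq_le f0 -h f1.
Qed.

Lemma ccp_max f g : ccp f -> ccp g -> ccp (fun x => Num.max (f x) (g x)).
Proof.
move=> hf hg; apply: (ccp_le _ (ccpD hf hg)).
  exact: rcont_max (ccp_cont hf) (ccp_cont hg).
move=> x; have f0 := ccp_ge0 x hf; have g0 := ccp_ge0 x hg.
by rewrite le_max f0 /= ge_max lerDl lerDr g0 f0.
Qed.

Lemma ccp_min f (g : G -> R) : ccp f -> rcont g -> (forall x, 0 <= g x) ->
  ccp (fun x => Num.min (f x) (g x)).
Proof.
move=> hf cg g0; apply: (ccp_le _ hf); first exact: rcont_min (ccp_cont hf) cg.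
by move=> x; rewrite le_min (ccp_ge0 x hf) g0 /= ge_min lexx.
Qed.

Lemma ccpB f g : ccp f -> ccp g -> (forall x, g x <= f x) ->
  ccp (fun x => f x - g x).
Proof.
move=> hf hg gf; apply: (ccp_le _ hf).
  exact: rcontB (ccp_cont hf) (ccp_cont hg).
by move=> x; rewrite subr_ge0 gf /= gerBl; exact: ccp_ge0.
Qed.

Lemma ccp_cut f (d : R) : 0 <= d -> ccp f -> ccp (fun x => Num.max (f x - d) 0).
Proof.
move=> d0 hf; apply: (ccp_le _ hf).
  apply: rcont_max; last exact: rcont_cst.
  by apply: rcontB; [exact: ccp_cont|exact: rcont_cst].
move=> x; rewrite le_max lexx orbT /= ge_max (ccp_ge0 x hf) andbT.
by rewrite gerBl.
Qed.

Lemma ccp_sum (F : nat -> G -> R) n : (forall i, ccp (F i)) ->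
  ccp (fun x => \sum_(i < n) F i x).
Proof.
move=> hF; elim: n => [|n ih].
  by under eq_fun do rewrite big_ord0; exact: ccp0.
by under eq_fun do rewrite big_ord_recr /=; exact: ccpD.
Qed.

Lemma ccp_hat K : compact K -> exists2 h, ccp h & forall x, h x <= 1 /\ (K x -> h x = 1).
Proof.
move=> cK; have [f [cf f01 f1 _ cS]] :=
  urysohn_compact R G_lc G_hd cK openT (@subsetT _ K).
exists f; last by move=> x; split; [case/andP: (f01 x)|exact: f1].
split => //; first by move=> x; case/andP: (f01 x).
exists (closure [set x | f x != 0]) => // x nx; apply/eqP/negPn/negP => fx.
by apply: nx; exact: subset_closure.
Qed.

Lemma nbhs_gt (c y : R) : c < y -> nbhs y [set z | c < z].
Proof. by move=> cy; apply: open_nbhs_nbhs; split => //; exact: open_gt. Qed.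

Lemma ccp_local V (x : G) : open V -> V x ->
  exists N : set G, nbhs x N /\ exists h, [/\ ccp h, forall y, h y <= 1,
    forall y, ~ V y -> h y = 0 & forall y, N y -> h y = 1].
Proof.
move=> oV Vx; have c1 : compact [set x] by exact: compact_set1.
have xV : [set x] `<=` V by move=> _ ->.
have [f [cf f01 f1 f0 cS]] := urysohn_compact R G_lc G_hd c1 oV xV.
have hf : ccp f.
  split => //; first by move=> y; case/andP: (f01 y).
  exists (closure [set x | f x != 0]) => // y ny; apply/eqP/negPn/negP => fy.
  by apply: ny; exact: subset_closure.
exists [set y | 2^-1 < f y]; split.
  have hx : 2^-1 < f x by rewrite f1// invf_lt1 ?ltr1n.
  by have [cf'] := cf; exact: (cf' x _ (nbhs_gt hx)).
(* Doubling and capping produces the value 1 on a whole neighbourhood of [x]. *)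
exists (fun y => Num.min (2 * f y) 1); split.
- apply: ccp_min; first by apply: ccpZ.
    exact: rcont_cst.
  by move=> _; exact: ler01.
- by move=> y; rewrite ge_min lexx orbT.
- by move=> y /f0 ->; rewrite mulr0 min_l// ler01.
- move=> y /= hy; rewrite min_r//.
  by move: hy; rewrite -(ltr_pM2l (ltr0n R 2)) divff// => /ltW.
Qed.

(** Each point of [V] lies in a basic open set on which some function of the cone, at most 1 and
    vanishing off [V], equals 1. One such function is attached to each basic set that admits it, and
    maxima over the first [n] codes increase. *)
Lemma open_exhaust V : open V -> exists u : nat -> G -> R,
  [/\ forall n, ccp (u n), forall n x, u n x <= 1,
      forall n x, ~ V x -> u n x = 0, forall n x, u n x <= u n.+1 x &
      forall x, V x -> exists n, u n x = 1].
Proof.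
move=> oV; have [B cB [oB bB]] := G_sc.
have /countable_injP[code injc] := cB.
pose good (g : G -> R) (b : set G) := [/\ ccp g, forall y, g y <= 1,
  forall y, ~ V y -> g y = 0 & forall y, b y -> g y = 1].
have /choice[w hw] : forall k : nat, exists g : G -> R,
    [/\ ccp g, forall y, g y <= 1, forall y, ~ V y -> g y = 0 &
    forall b, B b -> code b = k -> (exists g', good g' b) -> forall y, b y -> g y = 1].
  move=> k; have [[b [Bb bk [g' [h1 h2 h3 h4]]]]|no] :=
      pselect (exists b, [/\ B b, code b = k & exists g', good g' b]).
    exists g'; split => // b' Bb' b'k _ y b'y; apply: h4.
    by rewrite (injc b b') ?inE// b'k.
  (* Numbers that code no suitable basic set contribute the zero function. *)
  exists (fun=> 0); split => //; first exact: ccp0.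
  by move=> b Bb bk hg; exfalso; apply: no; exists b.
pose u := fix u n x := if n is n'.+1 then Num.max (u n' x) (w n' x) else (0 : R).
have uS n x : u n.+1 x = Num.max (u n x) (w n x) by [].
have hu n : [/\ ccp (u n), forall x, u n x <= 1 & forall x, ~ V x -> u n x = 0].
  elim: n => [|n [h1 h2 h3]].
    by split => //; exact: ccp0.
  have [w1 w2 w3 _] := hw n; split.
  - exact: ccp_max.
  - by move=> x; rewrite uS ge_max h2 w2.
  - by move=> x nV; rewrite uS h3// w3// maxxx.
exists u; split.
- by move=> n; case: (hu n).
- by move=> n; case: (hu n).
- by move=> n; case: (hu n).
- by move=> n x; rewrite uS le_max lexx.
move=> x Vx; have [N [xN [h [h1 h2 h3 h4]]]] := ccp_local oV Vx.
have [b [Bb bx] bN] := bB x N xN.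
exists (code b).+1; rewrite uS.
have [w1 w2 w3 w4] := hw (code b).
have [h5 h6 h7] := hu (code b).
rewrite (w4 b)//; first by rewrite max_r.
by exists h; split => // y /bN; exact: h4.
Qed.

Variable Lam : (G -> R) -> R.
Hypothesis LamD : forall f g, ccp f -> ccp g ->
  Lam (fun x => f x + g x) = Lam f + Lam g.
Hypothesis LamZ : forall (a : R) f, 0 <= a -> ccp f ->
  Lam (fun x => a * f x) = a * Lam f.
Hypothesis Lam_ge0 : forall f, ccp f -> 0 <= Lam f.

Lemma Lam_le f g : ccp f -> ccp g -> (forall x, f x <= g x) -> Lam f <= Lam g.
Proof.
move=> hf hg fg; have hd := ccpB hg hf fg.
have -> : Lam g = Lam f + Lam (fun x => g x - f x).
  by rewrite -LamD//; congr Lam; apply/funext => x; rewrite addrC subrK.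
by rewrite lerDl; exact: Lam_ge0.
Qed.

Lemma Lam_sum (F : nat -> G -> R) n : (forall i, ccp (F i)) ->
  Lam (fun x => \sum_(i < n) F i x) = \sum_(i < n) Lam (F i).
Proof.
move=> hF; elim: n => [|n ih].
  rewrite big_ord0 -[RHS](mul0r (Lam (fun=> 0))) -LamZ//; last exact: ccp0.
  by congr Lam; apply/funext => x; rewrite big_ord0 mulr0.
rewrite big_ord_recr /= -ih -LamD//; last exact: ccp_sum.
by congr Lam; apply/funext => x; rewrite big_ord_recr.
Qed.

(** Converts a uniform error [d] where [f] is nonzero into an error [e] of [Lam], without any
    continuity assumption on [Lam] beyond positivity. *)
Lemma small_hat f (e : R) : ccp f -> 0 < e -> exists d h,
  [/\ 0 < d, ccp h, Lam (fun x => d * h x) <= e,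
   (forall x, h x <= 1) & (forall x, f x != 0 -> h x = 1)].
Proof.
move=> [cf f0 [K cK fK]] e0; have [h hh h1] := ccp_hat cK.
have M0 : 0 < Lam h + 1 by rewrite ltr_wpDl// Lam_ge0.
exists (e / (Lam h + 1)), h; split => //.
- by rewrite divr_gt0.
- rewrite LamZ//; last by rewrite divr_ge0// ltW.
  by rewrite mulrAC ler_pdivrMr// ler_wpM2l ?lerDl// ltW.
- by move=> x; case: (h1 x).
- move=> x fx; apply: (h1 x).2; apply: contrapT => /fK h0.
  by rewrite h0 eqxx in fx.
Qed.

(* Dini's argument. *)
Lemma Lam_dini f (s : nat -> G -> R) (e : R) : ccp f -> (forall n, ccp (s n)) ->
  (forall n x, s n x <= s n.+1 x) ->
  (forall x (d : R), 0 < d -> exists n, f x < s n x + d) -> 0 < e ->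
  exists n, Lam f <= Lam (s n) + e.
Proof.
move=> hf hs smono sf e0; have [cf f0 [K cK fK]] := hf.
have [d [h [d0 hh hLam h1 hf1]]] := small_hat hf e0.
have mono m n x : (m <= n)%N -> s m x <= s n x.
  by move=> mn; apply: (@homo_leq _ (fun n => s n x) (fun a b => a <= b)) => //;
    exact: le_trans.
have [n hn] : exists n, forall x, K x -> f x <= s n x + d.
  apply: (@compact_ind _ K (fun S => exists n, forall x, S x -> f x <= s n x + d)) => //.
  - by exists 0%N.
  - by move=> A B AB [n hn]; exists n => x /AB; exact: hn.
  - move=> A B [n hn] [m hm]; exists (maxn n m) => x [/hn|/hm] hx;
      apply: le_trans hx _; rewrite lerD2r; apply: mono.
      exact: leq_maxl.
    exact: leq_maxr.
  - move=> x _; have [n hn] := sf x d d0.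
    exists [set y | 0 < s n y + d - f y]; last first.
      by exists n => y /=; rewrite subr_gt0 => /ltW.
    have [cg] : rcont (fun y => s n y + d - f y).
      apply: (rcontB _ cf); apply: (rcontD (ccp_cont (hs n))); exact: rcont_cst.
    have hx : 0 < s n x + d - f x by rewrite subr_gt0.
    exact: (cg x _ (nbhs_gt hx)).
exists n; have hdh : ccp (fun x => d * h x) by apply: ccpZ => //; exact: ltW.
apply: (@le_trans _ _ (Lam (fun x => s n x + d * h x))); last first.
  by rewrite LamD// lerD2l.
apply: Lam_le => //; first exact: ccpD.
move=> x; have [fx|fx] := eqVneq (f x) 0.
  by rewrite fx addr_ge0// ?mulr_ge0// ?(ccp_ge0 x (hs n))// ?(ccp_ge0 x hh)// ltW.
rewrite hf1// mulr1; apply: hn; apply: contrapT => /fK h0.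
by rewrite h0 eqxx in fx.
Qed.

(** Functions have to vanish off [V], but their supports may meet its boundary; so a normalized
    layer of [f] above height [c] is admissible for the set where [f] exceeds [c]. *)
Definition below V : set (\bar R) :=
  [set (Lam g)%:E | g in [set g | [/\ ccp g, forall x, g x <= 1 &
     forall x, ~ V x -> g x = 0]]].

Definition inner_mass V : \bar R := ereal_sup (below V).

Lemma Lam_le_inner V g : ccp g -> (forall x, g x <= 1) ->
  (forall x, ~ V x -> g x = 0) -> ((Lam g)%:E <= inner_mass V)%E.
Proof. by move=> hg g1 g0; apply: ereal_sup_ubound; exists g. Qed.

Lemma inner_mass_ge0 V : (0 <= inner_mass V)%E.
Proof.
apply: le_trans (@Lam_le_inner V (fun=> 0) ccp0 _ _) => //.
by rewrite lee_fin Lam_ge0//; exact: ccp0.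
Qed.

Lemma inner_mass_mono U V : U `<=` V -> (inner_mass U <= inner_mass V)%E.
Proof.
move=> UV; apply: ge_ereal_sup => _ [g [hg g1 g0] <-].
by apply: Lam_le_inner => // x nV; apply: g0 => /UV.
Qed.

(** The exhausting functions are summed diagonally: the [N]-th functions of the first [N] sets.
    These sums increase and are eventually at least 1 at each point of the union, so Dini's argument
    puts them above [g] up to [e]. *)
Lemma inner_mass_bigcup (V : nat -> set G) : (forall n, open (V n)) ->
  (inner_mass (\bigcup_n V n) <= \sum_(i <oo) inner_mass (V i))%E.
Proof.
move=> oV; apply: ge_ereal_sup => _ [g [hg g1 g0] <-].
have /choice[u hu] := fun n => open_exhaust (oV n).
apply/lee_addgt0Pr => e e0.
pose s N x := \sum_(i < N) u i N x.
have hs N : ccp (s N).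
  by apply: (@ccp_sum (fun i => u i N)) => i; case: (hu i).
have umono i m n x : (m <= n)%N -> u i m x <= u i n x.
  move=> mn; apply: (@homo_leq _ (fun n => u i n x) (fun a b => a <= b)) => //.
    exact: le_trans.
  by move=> k; case: (hu i).
have smono n x : s n x <= s n.+1 x.
  rewrite /s big_ord_recr /=; apply: ler_wpDr.
    by apply: ccp_ge0; case: (hu n).
  by apply: ler_sum => i _; case: (hu i).
have sf x (d : R) : 0 < d -> exists n, g x < s n x + d.
  move=> d0; have [[i _ Vx]|nV] := pselect ((\bigcup_n V n) x); last first.
    by exists 0%N; rewrite g0// /s big_ord0 add0r.
  have [_ _ _ _ /(_ x Vx)[k uk]] := hu i.
  (* [i.+1] brings the term of [V i] into the sum, [k] makes this term at least 1 at [x]. *)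
  exists (maxn i.+1 k); apply: (@le_lt_trans _ _ 1) => //.
  rewrite -[ltLHS]addr0; apply: ler_ltD => //.
  pose j : 'I_(maxn i.+1 k) := Ordinal (leq_maxl i.+1 k).
  rewrite /s (bigD1 j)//= -[leLHS]addr0; apply: lerD.
    by rewrite -uk; apply: umono; exact: leq_maxr.
  by apply: sumr_ge0 => l _; apply: ccp_ge0; case: (hu l).
have [N hN] := Lam_dini hg hs smono sf e0.
apply: (@le_trans _ _ (\sum_(i < N) (Lam (u i N))%:E + e%:E)%E).
  rewrite sumEFin -EFinD lee_fin -(@Lam_sum (fun i => u i N) N)//.
  by move=> i; case: (hu i).
rewrite leeD2r//.
apply: (@le_trans _ _ (\sum_(i < N) inner_mass (V i))%E).
  by apply: lee_sum => i _; have [h1 h2 h3 _ _] := hu i;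
    exact: (Lam_le_inner (h1 N) (h2 N) (h3 N)).
rewrite -(big_mkord xpredT (fun i => inner_mass (V i))).
apply: nneseries_lim_ge => i _ _; exact: inner_mass_ge0.
Qed.

Definition outer_mass (E : set G) : \bar R :=
  ereal_inf [set inner_mass U | U in [set U | open U /\ E `<=` U]].

Lemma outer_mass_open U : open U -> outer_mass U = inner_mass U.
Proof.
move=> oU; apply/eqP; rewrite eq_le; apply/andP; split.
  by apply: ereal_inf_lbound; exists U => //; split.
by apply: le_ereal_inf_tmp => _ [V [oV UV] <-]; exact: inner_mass_mono.
Qed.

Lemma outer_mass_le E U : open U -> E `<=` U -> (outer_mass E <= inner_mass U)%E.
Proof. by move=> oU EU; apply: ereal_inf_lbound; exists U. Qed.

Lemma outer_mass_ge0 E : (0 <= outer_mass E)%E.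
Proof. by apply: le_ereal_inf_tmp => _ [V _ <-]; exact: inner_mass_ge0. Qed.

Lemma outer_mass0 : outer_mass set0 = 0%E.
Proof.
rewrite outer_mass_open; last exact: open0.
apply/eqP; rewrite eq_le inner_mass_ge0 andbT.
apply: ge_ereal_sup => _ [g [hg g1 g0] <-]; rewrite lee_fin.
have -> : Lam g = Lam (fun x => 0 * g x).
  by congr Lam; apply/funext => x; rewrite mul0r g0.
by rewrite LamZ// mul0r.
Qed.

Lemma outer_mass_mono : {homo outer_mass : E F / E `<=` F >-> (E <= F)%E}.
Proof.
move=> E F EF; apply: le_ereal_inf_tmp => _ [V [oV FV] <-].
by apply: outer_mass_le => //; exact: subset_trans FV.
Qed.

Lemma outer_mass_approx E (e : R) : 0 < e -> (outer_mass E < +oo)%E ->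
  exists U, [/\ open U, E `<=` U & (inner_mass U <= outer_mass E + e%:E)%E].
Proof.
move=> e0 Efin; have Ef : outer_mass E \is a fin_num.
  by rewrite ge0_fin_numE// outer_mass_ge0.
have [_ [U [oU EU] <-] hU] := lb_ereal_inf_adherent e0 Ef.
by exists U; split => //; exact: ltW.
Qed.

Lemma outer_mass_subadd : sigma_subadditive outer_mass.
Proof.
move=> E; have [[i ioo]|] := pselect (exists i, outer_mass (E i) = +oo%E).
  rewrite (eseries_pinfty _ _ ioo) ?leey// => n _.
  by rewrite -ltNye (lt_le_trans _ (outer_mass_ge0 _)).
rewrite -forallNE => Eoo; apply/lee_addgt0Pr => e e0.
have /choice[U hU] : forall n, exists U, [/\ open U, E n `<=` U &
    (inner_mass U <= outer_mass (E n) + (e / (2 ^ n.+1)%:R)%:E)%E].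
  move=> n; apply: outer_mass_approx.
    by rewrite divr_gt0// ltr0n expn_gt0.
  by rewrite ltey; apply/eqP; exact: Eoo.
apply: le_trans (epsilon_trick xpredT (fun n => outer_mass_ge0 (E n)) (ltW e0)).
apply: (@le_trans _ _ (inner_mass (\bigcup_n U n))).
  apply: outer_mass_le; first by apply: bigcup_open => n _; case: (hU n).
  by apply: subset_bigcup => n _; case: (hU n).
apply: le_trans (inner_mass_bigcup _) _; first by move=> n; case: (hU n).
by apply: lee_nneseries => [n *|n *]; [exact: inner_mass_ge0|case: (hU n)].
Qed.

End Cone.

(** * The Radon measure of a positive functional *)

Section RieszMeasure.
Variables (R : realType) (G : topologicalZmodType).
Hypothesis G_sc : @second_countable G.
Hypothesis G_lc : locally_compact [set: G].
Hypothesis G_hd : hausdorff_space G.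
Implicit Types (f g h : G -> R) (U V K : set G).
Variable Lam : (G -> R) -> R.
Hypothesis LamD : forall f g, ccp f -> ccp g ->
  Lam (fun x => f x + g x) = Lam f + Lam g.
Hypothesis LamZ : forall (a : R) f, 0 <= a -> ccp f ->
  Lam (fun x => a * f x) = a * Lam f.
Hypothesis Lam_ge0 : forall f, ccp f -> 0 <= Lam f.
Local Notation inner_mass := (inner_mass Lam).
Local Notation outer_mass := (outer_mass Lam).

Let cut d f x := Num.max (f x - d) 0.

Let cut_approx f (e : R) : ccp f -> 0 < e -> exists2 d, 0 < d &
  Lam f <= Lam (cut d f) + e.
Proof.
move=> hf e0; have [d [h [d0 hh hLam h1 hf1]]] :=
  small_hat G_lc G_hd LamZ Lam_ge0 hf e0.
exists d => //; have hc : ccp (cut d f) by apply: ccp_cut => //; exact: ltW.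
have hdh : ccp (fun x => d * h x) by apply: ccpZ => //; exact: ltW.
apply: (@le_trans _ _ (Lam (fun x => cut d f x + d * h x))); last first.
  by rewrite LamD// lerD2l.
apply: (Lam_le LamD Lam_ge0) => //; first exact: ccpD.
move=> x; have [fx|fx] := eqVneq (f x) 0.
  by rewrite fx addr_ge0// ?(ccp_ge0 x hc)// ?(ccp_ge0 x hdh).
by rewrite hf1// mulr1 -lerBlDr le_max lexx.
Qed.

(** The truncation at height [d] of a nearly optimal [f] for the intersection vanishes where
    [f < d]. This part [W] of [U] contains [U] minus [V], and a function admissible for [W] can be
    added to the truncation without exceeding 1. *)
Lemma inner_mass_split U V : open U -> open V ->
  (inner_mass (U `&` V) + outer_mass (U `&` ~` V) <= inner_mass U)%E.
Proof.
move=> oU oV; have [Uoo|Ufin] := eqVneq (inner_mass U) +oo%E.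
  by rewrite Uoo leey.
have fU : inner_mass U \is a fin_num.
  by rewrite ge0_fin_numE ?ltey// inner_mass_ge0.
have lefin (a b : \bar R) : (0 <= a)%E -> (a <= b)%E -> b \is a fin_num ->
    a \is a fin_num.
  move=> a0 ab bf; rewrite ge0_fin_numE//; apply: (le_lt_trans ab).
  by rewrite -ge0_fin_numE//; exact: (le_trans a0 ab).
have igt W : (0 <= inner_mass W)%E by exact: inner_mass_ge0.
have fUV : inner_mass (U `&` V) \is a fin_num.
  by apply: (lefin _ _ (igt _) _ fU); apply: inner_mass_mono; exact: subIsetl.
apply/lee_addgt0Pr => e e0; have e30 : 0 < e / 3 by rewrite divr_gt0.
have [_ [f [hf f1 f0] <-] hLf] := ub_ereal_sup_adherent e30 fUV.
have [d d0 hd] := cut_approx hf e30.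
have hfd : ccp (cut d f) by apply: ccp_cut => //; exact: ltW.
pose W := U `&` [set x | f x < d].
have oW : open W.
  apply: openI => //; have [cf] := ccp_cont hf.
  have -> : [set x | f x < d] = f @^-1` [set y | y < d] by [].
  by apply: open_comp => [x _|]; [exact: cf|exact: open_lt].
have fW : inner_mass W \is a fin_num.
  by apply: (lefin _ _ (igt _) _ fU); apply: inner_mass_mono; exact: subIsetl.
have [_ [g [hg g1 g0] <-] hLg] := ub_ereal_sup_adherent e30 fW.
have UW : (outer_mass (U `&` ~` V) <= inner_mass W)%E.
  apply: outer_mass_le => // x [Ux nVx]; split => //=.
  by rewrite f0// => -[_ /nVx].
have hsum : ((Lam (fun x => cut d f x + g x))%:E <= inner_mass U)%E.
  apply: Lam_le_inner; first exact: ccpD.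
  - move=> x; have [fd|fd] := ltP (f x) d.
      by rewrite /cut max_r ?add0r// subr_le0 ltW.
    rewrite g0 ?addr0; last by move=> [_ /=]; rewrite ltNge fd.
    by rewrite /cut ge_max ler01 andbT; have := f1 x; lra.
  - move=> x nU; rewrite g0; last by move=> [].
    rewrite addr0 /cut f0; last by move=> [].
    by rewrite max_r// sub0r oppr_le0 ltW.
apply: le_trans (leeD (lexx _) UW) _.
move: hLf hLg hsum; rewrite -/(inner_mass _) -/(inner_mass _).
rewrite -(fineK fUV) -(fineK fW) -(fineK fU) -!EFinB -!EFinD !lte_fin !lee_fin.
by rewrite LamD// => h1 h2 h3; lra.
Qed.

Lemma outer_mass_carath V X : open V ->
  (outer_mass (X `&` V) + outer_mass (X `&` ~` V) <= outer_mass X)%E.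
Proof.
move=> oV; apply: le_ereal_inf_tmp => _ [U [oU XU] <-].
apply: le_trans (inner_mass_split oU oV); apply: leeD.
  by apply: outer_mass_le; [exact: openI|exact: setSI].
by apply: outer_mass_mono; exact: setSI.
Qed.

(** [om] and, below, [rm] are copies of [outer_mass] on the types to which the outer measure and the
    measure structures are attached. *)
Definition om : set (pointed_group G) -> \bar R := outer_mass.

Let om0 : om set0 = 0%E.
Proof. exact: outer_mass0. Qed.

Let om_ge0 X : (0 <= om X)%E.
Proof. exact: outer_mass_ge0. Qed.

Let om_mono : {homo om : E F / E `<=` F >-> (E <= F)%E}.
Proof. exact: outer_mass_mono. Qed.

Let om_subadd : sigma_subadditive om.
Proof. exact: outer_mass_subadd. Qed.

HB.instance Definition _ :=
  isOuterMeasure.Build R (pointed_group G) om om0 om_ge0 om_mono om_subadd.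

(** Caratheodory sets form a sigma-algebra, so open sets suffice. *)
Let borel_carath (E : set (borel G)) : measurable E -> om.-caratheodory E.
Proof.
pose M : set (set (pointed_group G)) := [set E | om.-caratheodory E].
have sM : sigma_algebra setT M.
  exact: (@sigma_algebra_measurable _ (caratheodory_type om)).
have oM : @open G `<=` M.
  move=> V oV; apply: le_caratheodory_measurable => X.
  exact: outer_mass_carath.
by apply: (@smallest_sub _ _ (@open G : set (set (pointed_group G))) M sM oM).
Qed.

Definition rm : set (borel G) -> \bar R := om.

Let rm0 : rm set0 = 0%E. Proof. exact: om0. Qed.

Let rm_ge0 E : (0 <= rm E)%E. Proof. exact: om_ge0. Qed.

Let rm_additive : semi_sigma_additive rm.
Proof.
move=> F mF tF mUF.
apply: (@caratheodory_measure_sigma_additive R (pointed_group G) om F) => //.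
- by move=> i; exact: (borel_carath (mF i)).
- exact: (borel_carath mUF).
Qed.

HB.instance Definition _ := isMeasure.Build _ _ _ rm rm0 rm_ge0 rm_additive.

Lemma rm_open U : open U -> rm U = inner_mass U.
Proof. exact: outer_mass_open. Qed.

Lemma rm_radon : is_radon rm.
Proof.
split.
(* The open set where [h] exceeds 1/2 contains [K], and functions admissible for it are at most
   [2 * h]. *)
- move=> K cK; have [h hh h1] := ccp_hat R G_lc G_hd cK.
  have oU : open [set x | 2^-1 < h x].
    have [ch] := ccp_cont hh.
    have -> : [set x | 2^-1 < h x] = h @^-1` [set y | 2^-1 < y] by [].
    by apply: open_comp => [x _|]; [exact: ch|exact: open_gt].
  apply: (@le_lt_trans _ _ (inner_mass [set x | 2^-1 < h x])).
    apply: outer_mass_le => // x Kx /=; rewrite (h1 x).2// invf_lt1 ?ltr1n//.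
  apply: (@le_lt_trans _ _ (2 * Lam h)%:E); last exact: ltry.
  apply: ge_ereal_sup => _ [g [hg g1 g0] <-]; rewrite lee_fin -LamZ//.
  apply: (Lam_le LamD Lam_ge0) => //; first exact: ccpZ.
  move=> x; have [hx|hx] := ltP (2^-1) (h x).
    by apply: le_trans (g1 x) _; move: hx; rewrite -(ltr_pM2l (ltr0n R 2)) divff// => /ltW.
  rewrite g0 ?mulr_ge0 ?(ccp_ge0 x hh)//=.
  by move=> /=; apply/negP; rewrite -leNgt.
- move=> E mE; rewrite /rm /om /outer_mass; congr ereal_inf.
  apply/seteqP; split=> _ [U [oU EU] <-]; exists U; try by split.
    exact: rm_open.
  by rewrite -rm_open.
- move=> V oV; apply/eqP; rewrite eq_le; apply/andP; split; last first.
    by apply: ge_ereal_sup => _ [K [cK KV] <-]; exact: om_mono.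
  rewrite rm_open//; apply: ge_ereal_sup => _ [g [hg g1 g0] <-].
  apply/lee_addgt0Pr => e e0; have [d d0 hd] := cut_approx hg e0.
  have hgd : ccp (cut d g) by apply: ccp_cut => //; exact: ltW.
  (* The truncation of [g] vanishes off [K], so it competes in the inner mass of every open set
     containing [K]. *)
  pose K := [set x | d <= g x].
  have gpos x : K x -> g x != 0 by move=> /= /(lt_le_trans d0) /gt_eqF ->.
  have cK : compact K.
    have [[cg] _ [L cL gL]] := hg; apply: (subclosed_compact _ cL).
      have -> : K = g @^-1` [set y | d <= y] by [].
      by apply: preimage_closed => [x _|]; [exact: cg|exact: closed_ge].
    by move=> x /gpos gx; apply: contrapT => /gL /eqP; apply/negP.
  have KV : K `<=` V by move=> x /gpos gx; apply: contrapT => /g0 /eqP; apply/negP.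
  apply: (@le_trans _ _ ((Lam (cut d g))%:E + e%:E)%E); first by rewrite -EFinD lee_fin.
  rewrite leeD2r//; apply: (@le_trans _ _ (rm K)); last first.
    by apply: ereal_sup_ubound; exists K.
  apply: le_ereal_inf_tmp => _ [U [oU KU] <-]; apply: Lam_le_inner => //.
    move=> x; rewrite /cut ge_max ler01 andbT; have := g1 x; lra.
  move=> x nU; rewrite /cut max_r// subr_le0 leNgt; apply/negP => dg.
  by apply: nU; apply: KU; exact: ltW.
Qed.

Definition riesz_radon : radon R G := Radon rm_radon.

Lemma le_Rintegral_set (m : radon R G) (D E : set G) f : relc E ->
  measurable (D : set (borel G)) -> D `<=` E -> rcont f -> (forall x, 0 <= f x) ->
  \int[m]_(x in D) f x <= \int[m]_(x in E) f x.
Proof.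
move=> rE mD DE cf f0; have [mE _] := rE.
have mED : measurable (E `\` D : set (borel G)) by exact: measurableD.
have -> : \int[m]_(x in E) f x =
    \int[m]_(x in D) f x + \int[m]_(x in E `\` D) f x.
  rewrite -Rintegral_setU.
  - by rewrite setDUK.
  - exact: mD.
  - exact: mED.
  - by rewrite setDUK//; exact: continuous_integrable.
  - by apply/eqP; rewrite setIC setDKI.
by rewrite lerDl; apply: Rintegral_ge0 => x _.
Qed.

Lemma Rintegral_mkcond0 (m : radon R G) (D E : set G) f : D `<=` E ->
  (forall x, E x -> ~ D x -> f x = 0) ->
  \int[m]_(x in E) f x = \int[m]_(x in D) f x.
Proof.
move=> DE f0; rewrite Rintegral_mkcond [RHS]Rintegral_mkcond.
congr (Rintegral _ _ _); apply/funext => x; rewrite !patchE.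
case: ifPn; case: ifPn => //; rewrite ?inE ?notin_setE.
- by move=> nD Ex; rewrite f0.
- by move=> /DE.
Qed.

(* Comparison on the layers (min f (k+1)d) - (min f kd), each of which lies
   between d 1_{f > (k+1)d} and d 1_{f > kd}. *)
Lemma riesz_integral f : ccp f -> \int[riesz_radon]_x f x = Lam f.
Proof.
move=> hf; have [cf f0 [K cK fK]] := hf.
have rK : relc K by exact: relc_compact.
have [B [B0 hB]] := bounded_compact (ccont_R cf) cK.
have fB x : f x <= B.
  have [Kx|nK] := pselect (K x); last by rewrite fK.
  by have := hB x Kx; rewrite ncR; apply: le_trans; exact: ler_norm.
have -> : \int[riesz_radon]_x f x = \int[riesz_radon]_(x in K) f x.
  by apply: Rintegral_mkcond0 => // x _; exact: fK.
pose V (c : R) := [set x | c < f x].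
have oV c : open (V c).
  have [cf'] := cf; have -> : V c = f @^-1` [set y | c < y] by [].
  by apply: open_comp => [x _|]; [exact: cf'|exact: open_gt].
have VK c : 0 <= c -> V c `<=` K.
  by move=> c0 x /= hx; apply: contrapT => /fK h; move: hx; rewrite /V /= h ltNge c0.
have rV c : 0 <= c -> relc (V c).
  by move=> c0; apply: (relc_sub rK); [exact: measurable_open|exact: VK].
pose mV c := fine (riesz_radon (V c)).
have step (d : R) : 0 < d -> `|\int[riesz_radon]_(x in K) f x - Lam f| <= d * mV 0.
  move=> d0; pose F n x := Num.min (f x) (n%:R * d).
  have nd0 n : 0 <= n%:R * d by rewrite mulr_ge0// ltW.
  have hF n : ccp (F n).
    apply: (ccp_min hf); first exact: rcont_cst.
    by move=> _; exact: nd0.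
  have FS n x : F n x <= F n.+1 x.
    rewrite /F le_min ge_min lexx /= ge_min; apply/orP; right.
    by rewrite ler_pM2r// ler_nat.
  pose p n x := F n.+1 x - F n x.
  have hp n : ccp (p n) by apply: ccpB.
  have p0 n x : f x <= n%:R * d -> p n x = 0.
    move=> h; rewrite /p /F !min_l ?subrr//; apply: le_trans h _.
    by rewrite ler_pM2r// ler_nat.
  have pd n x : p n x <= d.
    rewrite /p /F; case: (leP (f x) (n%:R * d)) => h1;
      case: (leP (f x) (n.+1%:R * d)) => h2; move: h1 h2; rewrite -natr1; lra.
  have pd1 n x : n.+1%:R * d < f x -> p n x = d.
    move=> h; rewrite /p /F !min_r ?ltW//; first by rewrite -natr1; ring.
    by apply: le_lt_trans h; rewrite ler_pM2r// ler_nat.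
  have est n : [/\ d * mV (n.+1%:R * d) <= Lam (p n), Lam (p n) <= d * mV (n%:R * d),
      d * mV (n.+1%:R * d) <= \int[riesz_radon]_(x in K) p n x &
      \int[riesz_radon]_(x in K) p n x <= d * mV (n%:R * d)].
    have rVn := rV _ (nd0 n); have rVn1 := rV _ (nd0 n.+1).
    have [mVn _] := rVn; have [mVn1 _] := rVn1.
    have cp := ccp_cont (hp n).
    have VS : V (n.+1%:R * d) `<=` V (n%:R * d).
      move=> x; apply: le_lt_trans.
      by rewrite ler_pM2r// ler_nat.
    have IE : \int[riesz_radon]_(x in K) p n x =
        \int[riesz_radon]_(x in V (n%:R * d)) p n x.
      apply: Rintegral_mkcond0; first exact: VK.
      by move=> x _ nV; apply: p0; rewrite leNgt; apply/negP.
    have cstE c : measurable (V c : set (borel G)) ->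
        \int[riesz_radon]_(x in V c) d = d * mV c by move=> mVc; rewrite Rintegral_cst.
    have hpd : ccp (fun x => d^-1 * p n x).
      by apply: ccpZ => //; rewrite invr_ge0 ltW.
    have LamE : Lam (p n) = d * Lam (fun x => d^-1 * p n x).
      by rewrite LamZ ?invr_ge0 ?ltW// mulrA divff ?gt_eqF// mul1r.
    split.
    - rewrite LamE ler_pM2l// -lee_fin fineK; last exact: relc_fin_num.
      rewrite [riesz_radon _](rm_open (oV _)).
      apply: ge_ereal_sup => _ [g [hg g1 g0] <-]; rewrite lee_fin.
      apply: (Lam_le LamD Lam_ge0) => // x.
      have [h|h] := ltP (n.+1%:R * d) (f x).
        by rewrite pd1// mulVf ?gt_eqF//; exact: g1.
      rewrite g0; first exact: (ccp_ge0 x hpd).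
      by move=> /=; apply/negP; rewrite -leNgt.
    - rewrite LamE ler_pM2l// -lee_fin fineK; last exact: relc_fin_num.
      rewrite [riesz_radon _](rm_open (oV _)); apply: Lam_le_inner => //.
        by move=> x; rewrite mulrC ler_pdivrMr// mul1r.
      by move=> x nV; rewrite p0 ?mulr0// leNgt; apply/negP.
    - rewrite IE -cstE//; apply: (@le_trans _ _ (\int[riesz_radon]_(x in V (n.+1%:R * d)) p n x)).
        apply: le_Rintegral_relc => //; first exact: rcont_cst.
        by move=> x Vx; rewrite pd1.
      exact: (le_Rintegral_set riesz_radon rVn mVn1 VS cp (fun x => ccp_ge0 x (hp n))).
    - by rewrite IE -cstE//; apply: le_Rintegral_relc => //; exact: rcont_cst.
  (* The error of one layer is at most [d] times the measure of the points with value between its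
     two heights; these terms telescope. *)
  have ind n : `|\int[riesz_radon]_(x in K) F n x - Lam (F n)| <=
      d * (mV 0 - mV (n%:R * d)).
    elim: n => [|n ih].
      have F0 x : F 0%N x = 0 by rewrite /F mul0r min_r.
      have -> : F 0%N = (fun x => 0 * f x) by apply/funext => x; rewrite F0 mul0r.
      rewrite (RintegralZ_relc G_hd _ _ rK cf) LamZ// !mul0r subrr normr0 subrr mulr0.
      exact: lexx.
    have -> : F n.+1 = (fun x => F n x + p n x).
      by apply/funext => x; rewrite /p addrC subrK.
    rewrite (RintegralD_relc G_hd _ rK (ccp_cont (hF n)) (ccp_cont (hp n))) LamD//.
    have [e1 e2 e3 e4] := est n.
    move: ih e1 e2 e3 e4.
    set I1 := \int[riesz_radon]_(x in K) F n x; set I2 := \int[riesz_radon]_(x in K) p n x.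
    set m0 := mV 0; set m1 := mV (n%:R * d); set m2 := mV (n.+1%:R * d).
    rewrite !mulrBr !ler_norml => /andP[h1 h2] e1 e2 e3 e4.
    by apply/andP; split; lra.
  have [n hn] : exists n : nat, B <= n%:R * d.
    exists (Num.truncn (B / d)).+1; rewrite -ler_pdivrMr//.
    by apply: ltW; apply: truncnS_gt.
  have -> : f = F n.
    by apply/funext => x; rewrite /F min_l//; apply: le_trans hn.
  apply: le_trans (ind n) _; rewrite ler_pM2l// gerBl.
  exact: fine_ge0.
apply/eqP; rewrite -subr_eq0 -normr_le0.
apply/ler_addgt0Pr => e e0; rewrite add0r.
have M0 : 0 < mV 0 + 1 by rewrite ltr_wpDl// fine_ge0.
apply: le_trans (step (e / (mV 0 + 1)) _) _; first by rewrite divr_gt0.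
by rewrite mulrAC ler_pdivrMr// ler_wpM2l ?lerDl// ltW.
Qed.

End RieszMeasure.

(** * Jordan decomposition of a bounded real functional *)

Section JordanDecomposition.
Variables (R : realType) (G : topologicalZmodType).
Hypothesis G_sc : @second_countable G.
Hypothesis G_lc : locally_compact [set: G].
Hypothesis G_hd : hausdorff_space G.
Implicit Types (f g h : G -> R) (K : set G).
Variable l : (G -> R) -> R.
Hypothesis lD : forall f g, ccp f -> ccp g ->
  l (fun x => f x + g x) = l f + l g.
Hypothesis lZ : forall (a : R) f, 0 <= a -> ccp f ->
  l (fun x => a * f x) = a * l f.
Hypothesis l_bounded : forall K, compact K -> exists C : R, forall f (s : R),
  ccp f -> (forall x, ~ K x -> f x = 0) -> (forall x, f x <= s) -> l f <= C * s.

Let dom f : set R := [set l g | g in [set g | ccp g /\ forall x, g x <= f x]].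

(** The Riesz-Kantorovich formula for the positive part of [l]. *)
Definition positive_part f : R := sup (dom f).

Let dom_has_sup f : ccp f -> has_sup (dom f).
Proof.
move=> hf; have [cf f0 [K cK fK]] := hf; split.
  exists (l (fun=> 0)); exists (fun=> 0) => //; split; first exact: ccp0.
  by move=> x; exact: f0.
have [C hC] := l_bounded cK; have [B [B0 hB]] := bounded_compact (ccont_R cf) cK.
exists (C * B) => _ [g [hg gf] <-]; apply: hC => // x.
  move=> nK; apply/eqP; rewrite eq_le (ccp_ge0 x hg) andbT.
  by rewrite -(fK x nK).
have [Kx|nK] := pselect (K x).
  apply: le_trans (gf x) _; have := hB x Kx; rewrite ncR; apply: le_trans.
  exact: ler_norm.
by apply: le_trans (gf x) _; rewrite fK.
Qed.

Let le_positive_part f g : ccp f -> ccp g -> (forall x, g x <= f x) ->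
  l g <= positive_part f.
Proof.
move=> hf hg gf; apply: ub_le_sup; first by case: (dom_has_sup hf).
by exists g.
Qed.

Let positive_part_le f (c : R) : ccp f ->
  (forall g, ccp g -> (forall x, g x <= f x) -> l g <= c) -> positive_part f <= c.
Proof.
move=> hf h; apply: ge_sup; first by case: (dom_has_sup hf).
by move=> _ [g [hg gf] <-]; exact: h.
Qed.

Let positive_partD f g : ccp f -> ccp g ->
  positive_part (fun x => f x + g x) = positive_part f + positive_part g.
Proof.
move=> hf hg; have hfg := ccpD hf hg.
apply/eqP; rewrite eq_le; apply/andP; split.
  apply: positive_part_le => // h hh hfgx.
  (* Riesz decomposition: a function below [f + g] is the sum of one below [f] and one below [g]. *)
  pose h1 x := Num.min (h x) (f x).
  have hh1 : ccp h1.
    by apply: (ccp_min hh (ccp_cont hf)) => x; exact: ccp_ge0.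
  have h1h x : h1 x <= h x by rewrite ge_min lexx.
  have hh2 := ccpB hh hh1 h1h.
  have -> : l h = l h1 + l (fun x => h x - h1 x).
    by rewrite -lD//; congr l; apply/funext => x; rewrite addrC subrK.
  apply: lerD; apply: le_positive_part => // x; first by rewrite ge_min lexx orbT.
  rewrite /h1; case: (leP (h x) (f x)) => hx; first by rewrite subrr; exact: ccp_ge0.
  by rewrite lerBlDl; exact: hfgx.
rewrite -lerBrDr; apply: positive_part_le => // h1 hh1 hf1.
rewrite lerBrDl -lerBrDr; apply: positive_part_le => // h2 hh2 hg2.
rewrite lerBrDr -lD//; apply: le_positive_part => //; first exact: ccpD.
by move=> x; rewrite addrC; apply: lerD.
Qed.

Let positive_part_ge0 f : ccp f -> 0 <= positive_part f.
Proof.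
move=> hf; have -> : 0 = l (fun=> 0).
  rewrite -[LHS](mul0r (l (fun=> 0))) -lZ//; last exact: ccp0.
  by congr l; apply/funext => x; rewrite mul0r.
apply: le_positive_part => //; first exact: ccp0.
by move=> x; exact: ccp_ge0.
Qed.

Let positive_partZ (a : R) f : 0 <= a -> ccp f ->
  positive_part (fun x => a * f x) = a * positive_part f.
Proof.
move=> a0 hf.
(* One inequality suffices for positive scalars: it is applied to [a] and to its inverse. *)
have le1 (b : R) g : 0 < b -> ccp g ->
    b * positive_part g <= positive_part (fun x => b * g x).
  move=> b0 hg; rewrite -ler_pdivlMl//; apply: positive_part_le => // h hh hgx.
  rewrite ler_pdivlMl// -lZ//; last exact: ltW.
  apply: le_positive_part; [by apply: ccpZ => //; exact: ltW|
    by apply: ccpZ => //; exact: ltW|].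
  by move=> x; rewrite ler_pM2l.
have [->|an0] := eqVneq a 0.
  rewrite mul0r; apply/eqP; rewrite eq_le positive_part_ge0 ?andbT; last exact: ccpZ.
  apply: positive_part_le; first exact: ccpZ.
  move=> g hg g0; have -> : l g = l (fun x => 0 * g x).
    congr l; apply/funext => x; apply/eqP; rewrite mul0r eq_le (ccp_ge0 x hg) andbT.
    by rewrite -(mul0r (f x)).
  by rewrite lZ// mul0r.
have a1 : 0 < a by rewrite lt_neqAle eq_sym an0.
apply/eqP; rewrite eq_le le1// andbT.
have := le1 a^-1 (fun x => a * f x); rewrite invr_gt0 => /(_ a1 (ccpZ a0 hf)).
have -> : (fun x => a^-1 * (a * f x)) = f.
  by apply/funext => x; rewrite mulrA mulVf// mul1r.
by rewrite ler_pdivrMl.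
Qed.

(** The negative part [positive_part f - l f] is nonnegative because [f] itself competes in the
    supremum. *)
Lemma jordan_radon : exists mp mn : radon R G, forall f, ccp f ->
  \int[mp]_x f x - \int[mn]_x f x = l f.
Proof.
have nD f g : ccp f -> ccp g ->
    positive_part (fun x => f x + g x) - l (fun x => f x + g x) =
    positive_part f - l f + (positive_part g - l g).
  by move=> hf hg; rewrite positive_partD// lD// opprD addrACA.
have nZ (a : R) f : 0 <= a -> ccp f ->
    positive_part (fun x => a * f x) - l (fun x => a * f x) =
    a * (positive_part f - l f).
  by move=> a0 hf; rewrite positive_partZ// lZ// mulrBr.
have n0 f : ccp f -> 0 <= positive_part f - l f.
  by move=> hf; rewrite subr_ge0; apply: le_positive_part => // x.
exists (riesz_radon G_sc G_lc G_hd positive_partD positive_partZ positive_part_ge0).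
exists (riesz_radon G_sc G_lc G_hd (Lam := fun f => positive_part f - l f) nD nZ n0).
by move=> f hf; rewrite !riesz_integral// opprB addrC subrK.
Qed.

End JordanDecomposition.

(** * Complex functionals *)

Section ComplexRiesz.
Variables (R : realType) (G : topologicalZmodType).
Hypothesis G_sc : @second_countable G.
Hypothesis G_lc : locally_compact [set: G].
Hypothesis G_hd : hausdorff_space G.
Variable L : (G -> R[i]) -> R[i].
Hypothesis LD : forall f g, Cc f -> Cc g -> L (fun x => f x + g x) = L f + L g.
Hypothesis LZ : forall c f, Cc f -> L (fun x => c * f x) = c * L f.
Hypothesis L_bounded : forall K, compact K -> exists C : R, forall f (s : R),
  cont f -> (forall x, ~ K x -> f x = 0) -> (forall x, nc (f x) <= s) ->
  nc (L f) <= C * s.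

(** On real functions the real and imaginary parts of [L] are bounded real functionals; their Jordan
    decompositions provide the four components of [eta]. *)
Lemma complex_riesz : exists eta : cmeasure R G,
  forall f, Cc f -> cm_int eta setT f = L f.
Proof.
pose C (f : G -> R) : G -> R[i] := fun x => (f x)%:C.
have CcC f : ccp f -> Cc (C f).
  move=> [cf f0 [K cK fK]]; apply: (cont_Cc G_hd (ccont_R cf) cK) => x nK.
  by rewrite /C fK.
have part (P : R[i] -> R) : (forall z w, P (z + w) = P z + P w) ->
    (forall (a : R) z, P (a%:C * z) = a * P z) -> (forall z, P z <= nc z) ->
    exists mp mn : radon R G, forall f, ccp f ->
      \int[mp]_x f x - \int[mn]_x f x = P (L (C f)).
  move=> PD PZ Pn; apply: (jordan_radon G_sc G_lc G_hd (l := fun f => P (L (C f)))).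
  - move=> f g hf hg; rewrite -PD -LD; [|exact: CcC..].
    by congr (P (L _)); apply/funext => x; rewrite /C rmorphD.
  - move=> a f a0 hf; rewrite -PZ -LZ; last exact: CcC.
    by congr (P (L _)); apply/funext => x; rewrite /C rmorphM.
  - move=> K cK; have [B hB] := L_bounded cK; exists B => f s hf f0 fs.
    apply: le_trans (Pn _) _; apply: hB.
    + exact: ccont_R (ccp_cont hf).
    + by move=> x nK; rewrite /C f0.
    + by move=> x; rewrite /C ncR ger0_norm//; exact: ccp_ge0.
have [m1 [m2 h12]] : exists mp mn : radon R G, forall f, ccp f ->
      \int[mp]_x f x - \int[mn]_x f x = complex.Re (L (C f)).
  apply: part.
  - by move=> [a b] [c d].
  - by move=> a [c d] /=; rewrite mul0r subr0.
  - by move=> z; apply: le_trans (nc_Re z); exact: ler_norm.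
have [m3 [m4 h34]] : exists mp mn : radon R G, forall f, ccp f ->
      \int[mp]_x f x - \int[mn]_x f x = complex.Im (L (C f)).
  apply: part.
  - by move=> [a b] [c d].
  - by move=> a [c d] /=; rewrite mul0r addr0.
  - by move=> z; apply: le_trans (nc_Im z); exact: ler_norm.
pose eta := CMeasure m1 m2 m3 m4; exists eta.
have cintC (m : radon R G) (f : G -> R) : cint m setT (C f) = (\int[m]_x f x)%:C.
  rewrite /cint /C; congr (_ +i* _).
  by rewrite /Rintegral (eq_integral (cst 0%E)) ?integral0.
have base f : ccp f -> cm_int eta setT (C f) = L (C f).
  move=> hf; rewrite /cm_int /eta; cbn [re_pos re_neg im_pos im_neg].
  rewrite !cintC -!rmorphB h12// h34//.
  by case: (L _) => a b; simpc.
move=> f /Cc_cont[cf [K cK fK]].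
have cparts (u : G -> R) : rcont u -> (forall x, ~ K x -> u x = 0) ->
    ccp (fun x => Num.max (u x) 0).
  move=> cu uK; split.
  - by apply: rcont_max cu _; exact: rcont_cst.
  - by move=> x; rewrite le_max lexx orbT.
  - by exists K => // x nK; rewrite uK// maxxx.
have cN (u : G -> R) : rcont u -> rcont (fun x => - u x).
  move=> cu; have -> : (fun x => - u x) = (fun x => 0 - u x).
    by apply/funext => x; rewrite sub0r.
  by apply: rcontB cu; exact: rcont_cst.
pose u x := complex.Re (f x); pose v x := complex.Im (f x).
have cu : rcont u := ccont_Re cf; have cv : rcont v := ccont_Im cf.
have u0 x : ~ K x -> u x = 0 by move=> nK; rewrite /u fK.
have v0 x : ~ K x -> v x = 0 by move=> nK; rewrite /v fK.
have p1 := cparts u cu u0; have p3 := cparts v cv v0.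
have p2 : ccp (fun x => Num.max (- u x) 0).
  by apply: cparts; [exact: cN|move=> x nK; rewrite u0// oppr0].
have p4 : ccp (fun x => Num.max (- v x) 0).
  by apply: cparts; [exact: cN|move=> x nK; rewrite v0// oppr0].
(* Four functions of the cone span [f], so agreement on the cone extends by linearity. *)
have fE : f = (fun x => (C (fun x => Num.max (u x) 0) x +
    -1 * C (fun x => Num.max (- u x) 0) x) +
    ('i * C (fun x => Num.max (v x) 0) x +
    - 'i * C (fun x => Num.max (- v x) 0) x)).
  apply/funext => x; rewrite /C /u /v; case: (f x) => a b /=; simpc.
  by congr (_ +i* _); [case: (leP a 0) => ha; [rewrite max_l ?oppr_ge0|rewrite max_r
    ?oppr_le0 1?ltW]|case: (leP b 0) => hb; [rewrite max_l ?oppr_ge0|rewrite max_r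
    ?oppr_le0 1?ltW]] => //; rewrite ?sub0r ?opprK ?subr0.
have CcZ c (g : G -> R) : ccp g -> Cc (fun x => c * C g x).
  move=> hg; have [cg [K' cK' gK']] := Cc_cont (CcC _ hg).
  apply: (cont_Cc G_hd _ cK'); first by apply: (ccontM _ cg); exact: ccont_cst.
  by move=> x nK; rewrite gK'// mulr0.
have CcD (g h : G -> R[i]) : Cc g -> Cc h -> Cc (fun x => g x + h x).
  move=> /Cc_cont[cg [K1 cK1 gK1]] /Cc_cont[ch [K2 cK2 hK2]].
  apply: (cont_Cc G_hd (ccontD cg ch) (compactU cK1 cK2)) => x nK.
  by rewrite gK1 ?hK2 ?addr0// => h'; apply: nK; [right|left].
have ID (g h : G -> R[i]) : Cc g -> Cc h ->
    cm_int eta setT (fun x => g x + h x) = cm_int eta setT g + cm_int eta setT h.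
  move=> /Cc_cont[cg [K1 cK1 gK1]] /Cc_cont[ch [K2 cK2 hK2]].
  have rK := relc_compact G_hd (compactU cK1 cK2).
  rewrite !(@cm_int_compact _ _ eta (K1 `|` K2)).
  - exact: cm_intD.
  - by move=> x nK; apply: hK2 => h'; apply: nK; right.
  - by move=> x nK; apply: gK1 => h'; apply: nK; left.
  - by move=> x nK; rewrite gK1 ?hK2 ?addr0// => h'; apply: nK; [right|left].
have IZ c (g : G -> R) : ccp g -> cm_int eta setT (fun x => c * C g x) = c * L (C g).
  move=> hg; rewrite -(base _ hg); have [cg [K' cK' gK']] := Cc_cont (CcC _ hg).
  rewrite !(@cm_int_compact _ _ eta K')//; last by move=> x nK; rewrite gK'// mulr0.
  exact: (cm_intZ G_hd _ _ (relc_compact G_hd cK') cg).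
rewrite fE ID; last 2 first.
- by apply: CcD; [exact: CcC|exact: CcZ].
- by apply: CcD; exact: CcZ.
rewrite ID; [|exact: CcC|exact: CcZ].
rewrite ID; [|exact: CcZ|exact: CcZ].
rewrite !IZ// base//.
rewrite LD; last 2 first.
- by apply: CcD; [exact: CcC|exact: CcZ].
- by apply: CcD; exact: CcZ.
rewrite LD; [|exact: CcC|exact: CcZ].
rewrite LD; [|exact: CcZ|exact: CcZ].
by rewrite !LZ; [|exact: CcC..].
Qed.

End ComplexRiesz.

(** * The twisted Eberlein convolution *)

Section TwistedConvolution.
Variables (R : realType) (G : topologicalZmodType).
Hypothesis G_sc : @second_countable G.
Hypothesis G_lc : locally_compact [set: G].
Hypothesis G_hd : hausdorff_space G.
Variable haar : radon R G.
Hypothesis haarP : is_haar haar.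
Variable A : nat -> set G.
Hypothesis A_vh : van_hove haar A.
Variables mu nu : cmeasure R G.
Hypothesis tmu : tb_fun mu.
Hypothesis tnu : tb_fun nu.
Hypothesis bmu : besicovitch_ap haar A mu.
Hypothesis bnu : besicovitch_ap haar A nu.
Local Notation hint := (cm_int (cm_of_radon haar)).
Local Notation mean := (mean haar A).
Local Notation bap := (bap haar A).
Local Notation tmean := (twist_mean haar A mu nu).
Let rA n := vh_relc A_vh n.

Lemma twisted_eberlein_exists : exists eta, is_twisted_eberlein haar A mu nu eta.
Proof.
have /choice[L hL] : forall phi : G -> R[i], exists l : R[i], Cc phi ->
    tmean n phi @[n --> \oo] --> (l : R[i]^o).
  (* Off C_c(G) the value 0 is a default. *)
  move=> phi; have [hphi|nphi] := pselect (Cc phi); last by exists 0.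
  by have [l hl] := twist_mean_cvg G_lc G_hd haarP A_vh tmu tnu bmu bnu hphi; exists l.
have CcD (f g : G -> R[i]) : Cc f -> Cc g -> Cc (fun x => f x + g x).
  move=> /Cc_cont[cf [K1 cK1 fK1]] /Cc_cont[cg [K2 cK2 gK2]].
  apply: (cont_Cc G_hd (ccontD cf cg) (compactU cK1 cK2)) => x nK.
  by rewrite fK1 ?gK2 ?addr0// => h'; apply: nK; [right|left].
have CcZ c (f : G -> R[i]) : Cc f -> Cc (fun x => c * f x).
  move=> /Cc_cont[cf [K1 cK1 fK1]].
  apply: (cont_Cc G_hd _ cK1); first by apply: (ccontM _ cf); exact: ccont_cst.
  by move=> x nK; rewrite fK1// mulr0.
have [eta heta] : exists eta : cmeasure R G, forall f, Cc f -> cm_int eta setT f = L f.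
  apply: (complex_riesz G_sc G_lc G_hd).
  - move=> f g hf hg; apply: (ccvg_unique (hL _ (CcD _ _ hf hg))).
    have [cf _] := Cc_cont hf; have [cg _] := Cc_cont hg.
    have := ccvgD (hL _ hf) (hL _ hg).
    under [X in X @ _ --> _ -> _]eq_fun do
      rewrite /twist_mean -mulrDr -(twistD G_hd mu nu (rA _) cf cg).
    by [].
  - move=> c f hf; apply: (ccvg_unique (hL _ (CcZ c _ hf))).
    have [cf _] := Cc_cont hf; have := @ccvgMl _ _ c _ (hL _ hf).
    under [X in X @ _ --> _ -> _]eq_fun do
      rewrite /twist_mean mulrCA -(twistZ G_hd mu nu c (rA _) cf).
    by [].
  - move=> K cK; have [C C0 hC] := twist_mean_bound G_lc G_hd haarP A_vh tmu tnu cK.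
    exists C => f s cf f0 fs; apply: (nc_le_lim (hL _ (cont_Cc G_hd cf cK f0))).
    by apply: filterS hC => n hn; apply: (hn 0) => // x; rewrite subr0; exact: f0.
exists eta => phi hphi; have [cphi _] := Cc_cont hphi; rewrite (heta _ hphi).
under [X in X @ _ --> _]eq_fun do rewrite (twist_mean_eberlein G_hd A_vh mu nu _ cphi).
exact: hL.
Qed.

(** * Properties of an arbitrary vague limit *)

Variable eta : cmeasure R G.
Hypothesis eta_lim : is_twisted_eberlein haar A mu nu eta.

Let heta phi : Cc phi -> tmean n phi @[n --> \oo] --> (cm_int eta setT phi : R[i]^o).
Proof.
move=> hphi; have [cphi _] := Cc_cont hphi; have := eta_lim hphi.
under [X in X @ _ --> _ -> _]eq_fun do rewrite (twist_mean_eberlein G_hd A_vh mu nu _ cphi).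
by [].
Qed.

Lemma shift_Cc (phi : G -> R[i]) t : Cc phi -> Cc (fun x => phi (x - t)).
Proof.
move=> /Cc_cont[cphi [K cK phi0]].
have cs : cont (fun x => phi (x - t)).
  by apply: (ccont_comp (g := fun x : G => x + - t)) cphi; exact: contG_shift.
apply: (cont_Cc G_hd cs (compact_shift (t := t) cK)) => x nK; apply: phi0 => Kx; apply: nK.
by exists (x - t) => //; rewrite addrC subrK.
Qed.

(** The constant of [twist_mean_bound] serves all translates and all large [n], so it passes to the
    limit. *)
Lemma eberlein_tb : tb_fun eta.
Proof.
move=> K cK; have [C C0 hC] := twist_mean_bound G_lc G_hd haarP A_vh tmu tnu cK.
exists C => // t g s cg g0 gs.
have hg : Cc g.
  apply: (cont_Cc G_hd cg (compact_shift (t := t) cK)) => x nK; apply: g0 => Kx; apply: nK.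
  by exists (x - t) => //; rewrite addrC subrK.
apply: (nc_le_lim (heta hg)).
by apply: filterS hC => n hn; exact: (hn t).
Qed.

(** One sequence with two known limits. Smearing [eta] by a reflected correlation thus gives exactly
    the mean of the shifted product. *)
Lemma conv_eberlein_corr K phi psi (c : R[i]) t : symk K ->
  cont phi -> (forall x, ~ K x -> phi x = 0) ->
  cont psi -> (forall x, ~ K x -> psi x = 0) ->
  mean n (fun x => conv_fun mu phi x * cj (conv_fun nu psi (x - t)))
    @[n --> \oo] --> (c : R[i]^o) ->
  cm_int eta setT (fun u => corr haar K phi psi (u - t)) = c.
Proof.
move=> sK cphi phi0 cpsi psi0 hc; have [cK _ _] := sK.
have hl := corr_limit G_lc G_hd haarP A_vh tmu tnu sK cphi phi0 cpsi psi0 hc.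
have ccor := corr_cont G_hd haar (relc_compact G_hd cK) cphi cpsi.
apply: (ccvg_unique (heta _) hl); apply: shift_Cc.
apply: (cont_Cc G_hd ccor); last exact: (corr_support _ _ phi0 psi0).
by apply: compact_sumset => //; exact: compact_opp.
Qed.

(** Replacing the test function by a correlation is paid for by [eberlein_tb], with one constant for
    all translates and hence uniformly in [t]; the other half of [e] goes to the polynomial. *)
Lemma eberlein_sap : sap_measure eta.
Proof.
move=> Phi hPhi; apply: unif_ap_sap => e e0.
have [cPhi [K0 cK0 Phi0]] := Cc_cont hPhi.
(* Smearing integrates [Phi (t - u)], the translate by [t] of the reflected function. *)
pose phi u := Phi (- u).
have cphi : cont phi.
  by apply: (ccont_comp (g := fun u : G => - u)) cPhi; exact: opp_continuous.
have phi0 x : ~ [set - y | y in K0] x -> phi x = 0.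
  by move=> nK; apply: Phi0 => Kx; apply: nK; exists (- x) => //; rewrite opprK.
have [L cL [phiL hL]] := corr_dense G_lc G_hd haarP A_vh cphi (compact_opp cK0) phi0.
have [C C0 hC] := eberlein_tb cL.
have C1 : 0 < C + 1 by rewrite ltr_wpDl.
have e1 : 0 < e / 2 / (C + 1) by rewrite !divr_gt0.
have [K [b [psi [sK [cb b0] [cpsi psi0] cL0 hd]]]] := hL _ e1.
have [cK _ _] := sK.
have bf := conv_fun_bap G_lc G_hd A_vh tmu bmu sK cb b0.
have bg := conv_fun_bap G_lc G_hd A_vh tnu bnu sK cpsi psi0.
have [c hc] := pair_limit G_hd haarP A_vh bf bg.
have e2 : 0 < e / 2 by rewrite divr_gt0.
have [n [a [chi [m [b' [xi [_ hxi _ _ hp]]]]]]] :=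
  pair_limit_approx G_hd haarP A_vh bf bg hc e2.
exists (corr_poly a chi b' xi); first by apply: tpoly_trig => k; exact: hxi.
move=> t; have ccor := corr_cont G_hd haar (relc_compact G_hd cK) cb cpsi.
have cd : cont (fun u => phi (u - t) - corr haar K b psi (u - t)).
  apply: (ccont_comp (g := fun u : G => u + - t) (f := fun u => phi u - corr haar K b psi u)).
    exact: contG_shift.
  exact: ccontB.
have h1 : nc (conv_fun eta Phi t - c t) <= e / 2.
  have -> : conv_fun eta Phi t - c t =
      cm_int eta setT (fun u => phi (u - t) - corr haar K b psi (u - t)).
    rewrite -(conv_eberlein_corr sK cb b0 cpsi psi0 (hc t)).
    have -> : conv_fun eta Phi t = cm_int eta setT (fun u => phi (u - t)).
      by apply: eq_cm_int => u _; rewrite /phi opprB.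
    have out (f : G -> R[i]) : (forall x, ~ L x -> f x = 0) ->
        forall x, ~ [set t + y | y in L] x -> f (x - t) = 0.
      move=> f0 x nL; apply: f0 => Lx; apply: nL.
      by exists (x - t) => //; rewrite addrC subrK.
    have o1 := out _ phiL; have o2 := out _ cL0.
    rewrite (@cm_int_compact _ _ eta _ _ o1) (@cm_int_compact _ _ eta _ _ o2).
    rewrite (@cm_int_compact _ _ eta [set t + y | y in L]); last first.
      by move=> x nL; rewrite o1// o2// subrr.
    rewrite (cm_intB G_hd _ (relc_compact G_hd (compact_shift (t := t) cL)))//.
      by apply: (ccont_comp (g := fun u : G => u + - t)) cphi; exact: contG_shift.
    by apply: (ccont_comp (g := fun u : G => u + - t)) ccor; exact: contG_shift.
  apply: le_trans (hC t _ (e / 2 / (C + 1)) cd _ _) _.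
  - by move=> x nL; rewrite phiL// cL0// subrr.
  - by move=> x; exact: hd.
  - rewrite mulrCA ger_pMr// ler_pdivrMr// mul1r lerDl; exact: ler01.
rewrite [e]splitr; apply: le_trans (nc_dist_tri _ (c t) _) _.
exact: lerD.
Qed.

(** The correlation of [chi] times a bump with itself is, after reflection, [chi] times the
    autocorrelation [B] of the bump. So [eta] smeared by [chi] times [B] is the correlation of the
    smeared measures, and the factors of [fb_limit], namely [c], [c] and the square of [c],
    cancel. *)
Lemma eberlein_fb chi : character chi -> exists am an : R[i],
  [/\ fb_mean haar A mu chi n @[n --> \oo] --> (am : R[i]^o),
      fb_mean haar A nu chi n @[n --> \oo] --> (an : R[i]^o) &
      fb_mean haar A eta chi n @[n --> \oo] --> (am * cj an : R[i]^o)].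
Proof.
move=> hchi; have cchi := character_cont hchi.
have [b [K [cb b01 bs sK [_ bK [c c0 hc]]]]] :=
  bump_exists G_lc G_hd haarP A_vh (@filterT _ (nbhs (0 : G)) _).
have [cK _ oK] := sK; have rK := relc_compact G_hd cK.
pose beta x := (b x)%:C; have cbeta : cont beta := ccont_R cb.
have beta0 x : ~ K x -> beta x = 0 by move=> nK; rewrite /beta bK.
pose phi x := chi x * beta x; have cphi : cont phi := ccontM cchi cbeta.
have phi0 x : ~ K x -> phi x = 0 by move=> nK; rewrite /phi beta0// mulr0.
have cC : c%:C != 0 by rewrite fmorph_eq0 gt_eqF.
have bf := conv_fun_bap G_lc G_hd A_vh tmu bmu sK cphi phi0.
have bg := conv_fun_bap G_lc G_hd A_vh tnu bnu sK cphi phi0.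
(* The coefficient is the mean of a product with [chi], itself almost periodic, at shift 0. *)
have coef (h : G -> R[i]) : bap h -> exists a : R[i],
    mean n (fun x => h x * cj (chi x)) @[n --> \oo] --> (a : R[i]^o).
  move=> bh; have [a ha] := pair_limit G_hd haarP A_vh bh (character_bap G_hd A_vh hchi).
  exists (a 0); have := ha 0.
  have -> // : (fun x => h x * cj (chi (x - 0))) = (fun x => h x * cj (chi x)).
  by apply/funext => x; rewrite subr0.
have [af haf] := coef _ bf; have [ag hag] := coef _ bg.
have [c1 hc1] := pair_limit G_hd haarP A_vh bf bg.
pose B t := hint K (fun s => beta s * beta (s - t)).
have corrE t : corr haar K phi phi (- t) = chi t * B t.
  have cst : cont (fun s => beta s * beta (s - t)).
    apply: (ccontM cbeta).
    by apply: (ccont_comp (g := fun s : G => s + - t)) cbeta; exact: contG_shift.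
  rewrite /corr /B -(cm_intZ G_hd _ _ rK cst); apply: eq_cm_int => s _.
  rewrite /phi (characterD _ _ hchi) (characterN _ hchi) !conjCM conjcK.
  have h1 := ncJM (character_nc s hchi).
  rewrite [cj (beta _)]conjc_real.
  transitivity (chi s * cj (chi s) * (chi t * (beta s * beta (s - t)))); first by ring.
  by rewrite h1 mul1r.
have [K2 sK2 KK2] := symk_hull (compact_sumset cK cK).
have [cK2 _ _] := sK2; have rK2 := relc_compact G_hd cK2.
have cB : cont B.
  apply: (@cm_int_param_cont _ _ G_hd (cm_of_radon haar) K G
    (fun p => beta p.2 * beta (p.2 - p.1)) rK).
  by apply: ccontM; [exact: cont_snd|exact: cont_sub21].
(* Read off from the support of the correlation, since [chi] has no zeros. *)
have B0 t : ~ K2 t -> B t = 0.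
  move=> nK; have h0 := corr_support haar K phi0 phi0.
  have := h0 (- t); rewrite corrE => {}h0.
  have hn : chi t != 0.
    apply/eqP => h1; have := character_nc t hchi; rewrite h1 Normc.normc0.
    by move/eqP; rewrite eq_sym oner_eq0.
  apply/eqP; rewrite -(mulrI_eq0 _ (mulfI hn)); apply/eqP/h0 => -[x Kx [_ [y Ky <-] e]].
  apply: nK; apply: KK2; exists y => //; exists (- x); first exact: oK.
  by rewrite -[t]opprK -e opprD opprK addrC.
(* Fubini; the symmetry of the bump turns [beta (s - t)] into a translate of [beta]. *)
have hB : hint K2 B = c%:C * c%:C.
  rewrite /B (@cm_int_fubini _ _ G_hd (cm_of_radon haar) (cm_of_radon haar) K2 K
    (fun p => beta p.2 * beta (p.2 - p.1)) rK2 rK); last first.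
    by apply: ccontM; [exact: cont_snd|exact: cont_sub21].
  rewrite /= -[X in _ = _ * X]hc -(cm_intZ G_hd _ _ rK cbeta); apply: eq_cm_int => s Ks.
  have cbs : cont (fun t => beta (s - t)) by exact: cont_mirror.
  rewrite (cm_intZ G_hd _ _ rK2 cbs) mulrC; congr (_ * _).
  rewrite -hc -(hint_shift G_hd haarP (- s) rK cbeta).
  rewrite (@cm_int_mkcond _ _ _ [set t | K (t - s)] K2).
  - by apply: eq_cm_int => t _; rewrite /beta -bs opprB.
  - move=> t /= Kts; apply: KK2; exists s => //; exists (t - s) => //.
    by rewrite addrC subrK.
  - move=> t _ nK; apply: beta0 => h; apply: nK => /=.
    by rewrite -opprB; exact: oK.
have convE : conv_fun eta (fun x => chi x * B x) = c1.
  apply/funext => t; rewrite -(conv_eberlein_corr sK cphi phi0 cphi phi0 (hc1 t)).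
  by apply: eq_cm_int => u _; rewrite -corrE opprB.
have cc1 : cont c1.
  rewrite -convE; apply: (conv_fun_cont G_lc G_hd eta (ccontM cchi cB) cK2) => x nK.
  by rewrite B0// mulr0.
have hl := coef_limit G_hd haarP A_vh bf bg cc1 hc1 hchi haf hag.
exists (af / c%:C), (ag / c%:C); split.
- exact: (fb_limit G_lc G_hd haarP A_vh tmu sK cbeta beta0 hc cC hchi haf).
- exact: (fb_limit G_lc G_hd haarP A_vh tnu sK cbeta beta0 hc cC hchi hag).
- have -> : af / c%:C * cj (ag / c%:C) = af * cj ag / (c%:C * c%:C).
    have cV : (c^-1)%:C = (c%:C)^-1 by exact: fmorphV.
    rewrite -[X in cj (ag * X)]cV conjCM [cj (_%:C)]conjc_real cV invfM; ring.
  apply: (fb_limit G_lc G_hd haarP A_vh eberlein_tb sK2 cB B0 hB _ hchi).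
    by rewrite mulf_neq0.
  by rewrite convE.
Qed.

End TwistedConvolution.

Theorem corollary4p39 (R : realType) (G : topologicalZmodType)
    (G_second_countable : @second_countable G)
    (G_locally_compact : locally_compact [set: G])
    (G_hausdorff : hausdorff_space G)
    (haar : radon R G) (haarP : is_haar haar)
    (A : nat -> set G) (A_van_hove : van_hove haar A)
    (mu nu : cmeasure R G)
    (mu_bounded : translation_bounded mu) (nu_bounded : translation_bounded nu)
    (mu_bap : besicovitch_ap haar A mu) (nu_bap : besicovitch_ap haar A nu) :
  (exists eta, is_twisted_eberlein haar A mu nu eta) /\
  (forall eta, is_twisted_eberlein haar A mu nu eta ->
    sap_measure eta /\
    forall chi, character chi ->
      [/\ fb_exists haar A mu chi, fb_exists haar A nu chi,
          fb_exists haar A eta chi &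
          fb_coeff haar A eta chi
            = fb_coeff haar A mu chi * (fb_coeff haar A nu chi)^*]).
Proof.
have tmu := translation_bounded_tb G_hausdorff mu_bounded.
have tnu := translation_bounded_tb G_hausdorff nu_bounded.
split; first exact: (twisted_eberlein_exists G_second_countable G_locally_compact
  G_hausdorff haarP A_van_hove tmu tnu mu_bap nu_bap).
move=> eta heta; split.
  exact: (eberlein_sap G_locally_compact G_hausdorff haarP A_van_hove tmu tnu
    mu_bap nu_bap heta).
move=> chi hchi; have [am [an [hm hn he]]] := eberlein_fb G_locally_compact
  G_hausdorff haarP A_van_hove tmu tnu mu_bap nu_bap heta hchi.
have limE (lam : cmeasure R G) (l : R[i]) :
    fb_mean haar A lam chi n @[n --> \oo] --> (l : R[i]^o) ->
    fb_coeff haar A lam chi = l.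
  move=> h; exact: (cvg_lim (@norm_hausdorff _ R[i]^o) h).
split; [exact: cvgP hm|exact: cvgP hn|exact: cvgP he|].
by rewrite (limE _ _ hm) (limE _ _ hn) (limE _ _ he).
Qed.
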